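(* Let $x\in\mathbb{C}\setminus\{0\}$. Then $$\lim_{K\to\infty}\left(\sum_{-K\le k\le K}W_k(x)+\log\bigl(\pi^{2K}(2K)!\bigr)-\left(2K+\tfrac12\right)\log(x)\right)=\frac{\log(2)}{2}\;,$$ where $K$ runs through positive integers.
   Context: Lambert branches: $\log$ is the principal determination of the logarithm (imaginary part in $]-\pi,\pi]$). For $z\in\mathbb{C}\setminus\{0\}$ and $k\in\mathbb{Z}$, if $z\notin[-1/e,0[$ or $k\notin\{0,-1\}$, then $W_k(z)$ is the unique complex solution $w$ of $w+\log(w)=\log(z)+2k\pi i$; if $z\in[-1/e,0[$, then $W_{-1}(z)$ and $W_0(z)$ are the real solutions of $we^w=z$ characterized by $W_{-1}(z)\le -1\le W_0(z)$ (equal when $z=-1/e$). *)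

(* Defs.v *)
From Stdlib Require Import Reals ZArith Lra.
From Coquelicot Require Import Coquelicot.
Open Scope R_scope.

Definition Cexp (w : C) : C := (exp (Re w) * cos (Im w), exp (Re w) * sin (Im w)).

(* Argument in ]-PI, PI]; the value at 0 is junk. *)
Definition Arg (z : C) : R :=
  if Rle_dec 0 (Im z) then acos (Re z / Cmod z) else - acos (Re z / Cmod z).

(* The value at 0 is junk; [Cexp_Clog], [Im_Clog_bound] and [Clog_unique] below
   characterise it as the principal logarithm elsewhere. *)
Definition Clog (z : C) : C := (ln (Cmod z), Arg z).

Lemma Re_div_Cmod_bound (z : C) : z <> 0%C -> -1 <= Re z / Cmod z <= 1.
Proof.
intros Hz.
assert (Hp := Cmod_gt_0 z); apply Hp in Hz.
assert (Hr := proj1 (Rabs_le_between _ _) (re_le_Cmod z)).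
split.
- apply (Rmult_le_reg_r (Cmod z)); [exact Hz|].
  unfold Rdiv; rewrite Rmult_assoc, Rinv_l; lra.
- apply (Rmult_le_reg_r (Cmod z)); [exact Hz|].
  unfold Rdiv; rewrite Rmult_assoc, Rinv_l; lra.
Qed.

Lemma Im_Clog_bound (z : C) : z <> 0%C -> - PI < Im (Clog z) <= PI.
Proof.
intros Hz.
change (Im (Clog z)) with (Arg z).
assert (Hb := acos_bound (Re z / Cmod z)).
assert (Hpi := PI_RGT_0).
unfold Arg; destruct (Rle_dec 0 (Im z)) as [H|H]; [lra|].
split; [|lra].
assert (Hp := Cmod_gt_0 z).
assert (Hc := proj1 Hp Hz).
assert (Hr := Re_div_Cmod_bound z Hz).
destruct (Rle_lt_or_eq_dec _ _ (proj2 Hb)) as [Hlt|Heq]; [lra|].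
exfalso.
assert (Hcos := cos_acos _ Hr); rewrite Heq, cos_PI in Hcos.
assert (HRe : Re z = - Cmod z).
{ apply (Rmult_eq_reg_r (/ Cmod z)); [|apply Rinv_neq_0_compat; lra].
  fold (Re z / Cmod z); rewrite <- Hcos; field; lra. }
assert (Hsq : Cmod z ^ 2 = Re z ^ 2 + Im z ^ 2) by (apply pow2_sqrt, Rplus_le_le_0_compat; apply pow2_ge_0).
rewrite HRe in Hsq; nra.
Qed.

Lemma Cexp_Clog (z : C) : z <> 0%C -> Cexp (Clog z) = z.
Proof.
intros Hz.
assert (Hc := proj1 (Cmod_gt_0 z) Hz).
assert (Hr := Re_div_Cmod_bound z Hz).
assert (Hsq : Cmod z ^ 2 = Re z ^ 2 + Im z ^ 2)
  by (apply pow2_sqrt, Rplus_le_le_0_compat; apply pow2_ge_0).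
assert (Hcos : cos (Arg z) = Re z / Cmod z).
{ unfold Arg; destruct (Rle_dec 0 (Im z)); rewrite ?cos_neg; apply cos_acos, Hr. }
assert (Hs : sqrt (1 - (Re z / Cmod z)²) = Rabs (Im z) / Cmod z).
{ rewrite <- (sqrt_Rsqr (Rabs (Im z) / Cmod z)).
  - f_equal. unfold Rdiv; rewrite !Rsqr_mult, <- Rsqr_abs.
    apply (Rmult_eq_reg_r (Cmod z ^ 2)); [|nra].
    rewrite Rmult_minus_distr_r, Rmult_1_l; unfold Rsqr; field_simplify; lra.
  - apply Rmult_le_pos; [apply Rabs_pos|left; apply Rinv_0_lt_compat, Hc]. }
assert (Hsin : sin (Arg z) = Im z / Cmod z).
{ unfold Arg; destruct (Rle_dec 0 (Im z)) as [H|H].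
  - rewrite sin_acos, Hs, Rabs_pos_eq; auto.
  - rewrite sin_neg, sin_acos, Hs, Rabs_left; [field|..]; auto; lra. }
unfold Cexp; change (Im (Clog z)) with (Arg z).
change (Re (Clog z)) with (ln (Cmod z)).
rewrite exp_ln, Hcos, Hsin by exact Hc.
apply injective_projections; cbn [fst snd]; unfold Re, Im; field; lra.
Qed.

Lemma Clog_unique (z w : C) : Cexp w = z -> - PI < Im w <= PI -> w = Clog z.
Proof.
intros Hw Hb; subst z.
destruct w as [a t]; cbn [Im snd] in Hb.
assert (Hpi := PI_RGT_0).
assert (He := exp_pos a).
assert (Hm : Cmod (Cexp (a, t)) = exp a).
{ unfold Cmod, Cexp, Re, Im; cbn [fst snd].
  transitivity (sqrt (exp a ^ 2)); [f_equal|apply sqrt_pow2; lra].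
  transitivity (exp a ^ 2 * ((sin t)² + (cos t)²)); [unfold Rsqr; ring|].
  rewrite sin2_cos2; ring. }
unfold Clog; rewrite Hm, ln_exp; f_equal.
unfold Arg; rewrite Hm.
replace (Re (Cexp (a, t)) / exp a) with (cos t)
  by (unfold Cexp, Re, Im; cbn [fst snd]; field; lra).
change (Im (Cexp (a, t))) with (exp a * sin t).
destruct (Rle_dec 0 (exp a * sin t)) as [H|H].
- rewrite acos_cos; [reflexivity|].
  split; [|lra].
  destruct (Rle_lt_dec 0 t) as [H0|H0]; [exact H0|exfalso].
  assert (Hs := sin_lt_0_var t (proj1 Hb) H0); nra.
- rewrite <- cos_neg, acos_cos; [ring|].
  destruct (Rle_lt_dec t 0) as [H0|H0]; [lra|exfalso; apply H].
  apply Rmult_le_pos; [lra|apply sin_ge_0; lra].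
Qed.

(* The real interval [-1/e, 0[ inside C. *)
Definition slit (z : C) : Prop := Im z = 0 /\ - / exp 1 <= Re z < 0.

(* [w <> 0] is needed because [Clog] is total: log(w) must make sense. *)
Definition is_LambertW (k : Z) (z w : C) : Prop :=
  (~ slit z \/ (k <> 0%Z /\ k <> (-1)%Z) ->
     w <> 0%C /\
     (w + Clog w)%C = (Clog z + 2 * RtoC (IZR k) * RtoC PI * Ci)%C) /\
  (slit z -> k = (-1)%Z -> Im w = 0 /\ (w * Cexp w)%C = z /\ Re w <= -1) /\
  (slit z -> k = 0%Z -> Im w = 0 /\ (w * Cexp w)%C = z /\ -1 <= Re w).

(* Junk when the solution is not unique, in particular possibly at z = 0. *)
Definition LambertW (k : Z) (z : C) : C :=
  iota (T := CompleteNormedModule.CompleteSpace _ C_R_CompleteNormedModule) (is_LambertW k z).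

Lemma LambertW_unique (k : Z) (z w : C) :
  is_LambertW k z w -> (forall w', is_LambertW k z w' -> w' = w) ->
  LambertW k z = w.
Proof.
intros Hw Hu.
exact (iota_unique (V := C_R_CompleteNormedModule) (is_LambertW k z) w Hu Hw).
Qed.

(* Main.v *)
(* The values W_k(x) with |k| <= K are the zeros of F(w) = w e^w - x in a
   rectangle whose horizontal edges pass through points zeta_+, zeta_- with
   zeta + log zeta = log x +- (2K+1) pi i, where w e^w / x = -1. By the residue
   theorem 2 pi i times their sum is the integral of w F'/F over the boundary.
   Up to errors that vanish with K, the integrand is w + 1 to the right of zeta_+
   and zeta_- and 0 to their left; at the transition the substitution
   w = zeta + s gives exactly - w e^w / x = (1 + s/zeta) e^s, and after splitting
   off a logarithmic derivative both edges contribute the same real integral,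
   with opposite orientations. Hence 2 pi i times the sum is
   P(zeta_+) - P(zeta_-) + o(1) with P(w) = w^2/2 + w. Expanding
   zeta_+, zeta_- around +- (2K+1) pi i turns the sum into
   (2K + 1/2)(log x - log((2K+1) pi)) + 2K + 1 + o(1), and Stirling's formula
   for (2K)! yields the constant log(2)/2. *)
Require Import Defs.
From Stdlib Require Import Reals ZArith.
From Coquelicot Require Import Coquelicot.
From Stdlib Require Import Lra Lia List Classical.
Open Scope R_scope.

(** * Calculus along curves in the complex plane *)

(** Only the boundary of the rectangle is ever estimated. Expansions of [LambertW k x] for large [k]
    would leave the small indices uncontrolled, although each contributes a fixed amount to the
    limit; the contour integral needs information only at points of modulus about
    [N = (2 K + 1) pi]. In the transition zone of a horizontal edge the integrand has size [N], so
    an approximation with relative error [1/N] would lose the constant. Therefore the part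
    proportional to [zeta] is kept as an exact logarithmic derivative: it integrates to [zeta log 2]
    on each side of [zeta], with opposite signs, up to exponentially small terms. What is left has
    size 1 and only its limit [profile] matters. Edges through exact solutions of [w e^w = - x] keep
    [w e^w / x] in the left half plane, away from the value 1 at which F vanishes. For [x = -1/e]
    the branches 0 and -1 meet at the double zero -1 of F, so zeros must be counted with
    multiplicity. The logarithmic equation is degenerate exactly for right-hand sides with imaginary
    part [PI] or [- PI] and real part at most -1, which is where the definition switches to real
    branches. *)

Lemma C_ext (z w : C) : Re z = Re w -> Im z = Im w -> z = w.
Proof. destruct z, w; cbn; intros; f_equal; assumption. Qed.

Lemma Cmod_le_Re_Im (z : C) : Cmod z <= Rabs (Re z) + Rabs (Im z).
Proof.
replace z with (RtoC (Re z) + Ci * RtoC (Im z))%C at 1.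
- eapply Rle_trans; [apply Cmod_triangle|].
  rewrite Cmod_mult, Cmod_Ci, !Cmod_R; lra.
- apply C_ext; cbn; unfold Re, Im; ring.
Qed.

Lemma Im_le_Cmod (z : C) : Rabs (Im z) <= Cmod z.
Proof. exact (Rle_trans _ _ _ (Rmax_r _ _) (Rmax_Cmod z)). Qed.

Lemma Cexp_plus (z w : C) : Cexp (z + w) = (Cexp z * Cexp w)%C.
Proof.
apply C_ext; cbn; unfold Re, Im;
  rewrite exp_plus, ?cos_plus, ?sin_plus; ring.
Qed.

Lemma Cexp_0 : Cexp 0 = 1%C.
Proof. apply C_ext; cbn; rewrite exp_0, ?cos_0, ?sin_0; ring. Qed.

Lemma Cmod_Cexp (w : C) : Cmod (Cexp w) = exp (Re w).
Proof.
assert (H := exp_pos (Re w)).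
unfold Cmod, Cexp; cbn [fst snd].
transitivity (sqrt (exp (Re w) ^ 2)); [f_equal|apply sqrt_pow2; lra].
transitivity (exp (Re w) ^ 2 * ((sin (Im w))² + (cos (Im w))²)); [unfold Rsqr; ring|].
rewrite sin2_cos2; ring.
Qed.

Lemma Cexp_neq_0 (w : C) : Cexp w <> 0%C.
Proof. apply Cmod_gt_0; rewrite Cmod_Cexp; apply exp_pos. Qed.

Lemma Cexp_opp (w : C) : Cexp (- w) = (/ Cexp w)%C.
Proof.
assert (H := Cexp_neq_0 w).
assert (E : (Cexp (- w) * Cexp w)%C = 1%C)
  by (rewrite <- Cexp_plus, <- Cexp_0; f_equal; ring).
transitivity ((Cexp (- w) * Cexp w) * / Cexp w)%C; [field; exact H|].
rewrite E; ring.
Qed.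

Lemma Cexp_RtoC (r : R) : Cexp (RtoC r) = RtoC (exp r).
Proof. apply C_ext; cbn; rewrite ?cos_0, ?sin_0; ring. Qed.

Definition cderiv (g : R -> C) (t : R) (l : C) : Prop :=
  is_derive (fun s => Re (g s)) t (Re l) /\ is_derive (fun s => Im (g s)) t (Im l).

Lemma cderiv_ext_val (g : R -> C) (t : R) (l l' : C) :
  l = l' -> cderiv g t l -> cderiv g t l'.
Proof. intros ->; exact (fun H => H). Qed.

Lemma cderiv_ext_loc (f g : R -> C) (t : R) (l : C) :
  locally t (fun s => f s = g s) -> cderiv f t l -> cderiv g t l.
Proof.
intros He [H1 H2]; split.
- eapply is_derive_ext_loc; [|exact H1].
  apply (filter_imp _ _ (fun s (E : f s = g s) => f_equal Re E) He).
- eapply is_derive_ext_loc; [|exact H2].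
  apply (filter_imp _ _ (fun s (E : f s = g s) => f_equal Im E) He).
Qed.

Lemma cderiv_const (c : C) (t : R) : cderiv (fun _ => c) t 0.
Proof. split; cbn; auto_derive; auto. Qed.

Lemma cderiv_plus (f g : R -> C) (t : R) (l m : C) :
  cderiv f t l -> cderiv g t m -> cderiv (fun s => f s + g s)%C t (l + m)%C.
Proof.
intros [H1 H2] [H3 H4]; split; [exact (is_derive_plus _ _ _ _ _ H1 H3)|exact (is_derive_plus _ _ _ _ _ H2 H4)].
Qed.

Lemma cderiv_mult (f g : R -> C) (t : R) (l m : C) :
  cderiv f t l -> cderiv g t m ->
  cderiv (fun s => f s * g s)%C t (l * g t + f t * m)%C.
Proof.
intros [H1 H2] [H3 H4]; split.
- eapply is_derive_ext; [intros s; reflexivity|].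
  replace (Re (l * g t + f t * m)%C)
    with ((Re l * Re (g t) + Re (f t) * Re m) - (Im l * Im (g t) + Im (f t) * Im m))
    by (cbn; unfold Re, Im; ring).
  apply (is_derive_minus (K := R_AbsRing) (V := R_NormedModule)
    (fun s => Re (f s) * Re (g s)) (fun s => Im (f s) * Im (g s)));
    apply Derive.is_derive_mult; assumption.
- replace (Im (l * g t + f t * m)%C)
    with ((Re l * Im (g t) + Re (f t) * Im m) + (Im l * Re (g t) + Im (f t) * Re m))
    by (cbn; unfold Re, Im; ring).
  apply (is_derive_plus (K := R_AbsRing) (V := R_NormedModule)
    (fun s => Re (f s) * Im (g s)) (fun s => Im (f s) * Re (g s)));
    apply Derive.is_derive_mult; assumption.
Qed.

Lemma C_neq_0_sqr (z : C) : z <> 0%C -> Re z * Re z + Im z * Im z <> 0.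
Proof.
intros Hz H; apply Hz, C_ext; cbn; unfold Re, Im in *; nra.
Qed.

Lemma Re_inv (z : C) : Re (/ z)%C = Re z / (Re z * Re z + Im z * Im z).
Proof. cbn; unfold Re, Im; f_equal; ring. Qed.

Lemma Im_inv (z : C) : Im (/ z)%C = - Im z / (Re z * Re z + Im z * Im z).
Proof. cbn; unfold Re, Im; f_equal; ring. Qed.

Lemma cderiv_pair (a b : R -> R) (t : R) (l : C) :
  is_derive a t (Re l) -> is_derive b t (Im l) -> cderiv (fun s => (a s, b s)) t l.
Proof. intros H1 H2; split; assumption. Qed.

Lemma cderiv_eta (F : C -> C) (f : R -> C) (t : R) (m : C) :
  cderiv (fun s => F (Re (f s), Im (f s))) t m -> cderiv (fun s => F (f s)) t m.
Proof.
apply cderiv_ext_loc, filter_forall; intros s; destruct (f s); reflexivity.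
Qed.

Lemma cderiv_inv (f : R -> C) (t : R) (l : C) :
  f t <> 0%C -> cderiv f t l -> cderiv (fun s => / f s)%C t (- (l * (/ f t * / f t)))%C.
Proof.
intros H0 [H1 H2]; apply C_neq_0_sqr in H0.
(* With the two components abstracted as real functions, [auto_derive] sees ordinary real
   expressions; [cderiv_eta] transfers the result back to [f]. *)
assert (G : forall a b : R -> R, is_derive a t (Re l) -> is_derive b t (Im l) ->
  a t * a t + b t * b t <> 0 ->
  cderiv (fun s => / (a s, b s))%C t (- (l * (/ (a t, b t) * / (a t, b t))))%C).
{ clear; intros a b H1 H2 H3.
  assert (D1 : Derive (fun s => a s) t = Re l) by exact (is_derive_unique _ _ _ H1).
  assert (D2 : Derive (fun s => b s) t = Im l) by exact (is_derive_unique _ _ _ H2).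
  assert (E1 : ex_derive a t) by (eexists; exact H1).
  assert (E2 : ex_derive b t) by (eexists; exact H2).
  assert (H4 : a t * (a t * 1) + b t * (b t * 1) <> 0) by (rewrite !Rmult_1_r; exact H3).
  apply cderiv_pair; cbn [fst snd]; auto_derive; try tauto;
    rewrite D1, D2; cbn; unfold Re, Im; field;
    intros E; apply H3; rewrite <- E; ring. }
specialize (G _ _ H1 H2 H0); apply (cderiv_eta Cinv).
eapply cderiv_ext_val; [|exact G]; cbv beta; destruct (f t); reflexivity.
Qed.

Lemma cderiv_Cexp (f : R -> C) (t : R) (l : C) :
  cderiv f t l -> cderiv (fun s => Cexp (f s)) t (l * Cexp (f t))%C.
Proof.
intros [H1 H2].
assert (G : forall a b : R -> R, is_derive a t (Re l) -> is_derive b t (Im l) ->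
  cderiv (fun s => Cexp (a s, b s))%C t (l * Cexp (a t, b t))%C).
{ clear; intros a b H1 H2.
  assert (D1 : Derive (fun s => a s) t = Re l) by exact (is_derive_unique _ _ _ H1).
  assert (D2 : Derive (fun s => b s) t = Im l) by exact (is_derive_unique _ _ _ H2).
  assert (E1 : ex_derive a t) by (eexists; exact H1).
  assert (E2 : ex_derive b t) by (eexists; exact H2).
  apply cderiv_pair; cbn; auto_derive; try tauto;
    rewrite D1, D2; unfold Re, Im; ring. }
exact (G _ _ H1 H2).
Qed.

Lemma cderiv_line (p h : C) (t : R) : cderiv (fun s => p + RtoC s * h)%C t h.
Proof. split; cbn; auto_derive; auto; unfold Re, Im; ring. Qed.

Lemma cderiv_horizontal (c t : R) : cderiv (fun u => (u, c)) t 1.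
Proof. split; cbn; auto_derive; auto. Qed.

Lemma cderiv_vertical (c t : R) : cderiv (fun v => (c, v)) t Ci.
Proof. split; cbn; auto_derive; auto. Qed.

(* Complex derivative, encoded as the chain rule along every differentiable
   curve through [p]; this is all that the contour integrals use, and it makes
   the closure rules immediate. *)
Definition HD (g : C -> C) (p l : C) : Prop :=
  forall (c : R -> C) (t : R) (c' : C),
    cderiv c t c' -> c t = p -> cderiv (fun s => g (c s)) t (c' * l)%C.

Lemma HD_const (a p : C) : HD (fun _ => a) p 0.
Proof.
intros c t c' _ _; apply (cderiv_ext_val _ _ 0); [ring|apply cderiv_const].
Qed.

Lemma HD_id (p : C) : HD (fun w => w) p 1.
Proof. intros c t c' H _; apply (cderiv_ext_val _ _ c'); [ring|exact H]. Qed.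

Lemma HD_plus (f g : C -> C) (p l m : C) :
  HD f p l -> HD g p m -> HD (fun w => f w + g w)%C p (l + m)%C.
Proof.
intros Hf Hg c t c' H E.
apply (cderiv_ext_val _ _ (c' * l + c' * m)); [ring|].
apply cderiv_plus; auto.
Qed.

Lemma HD_mult (f g : C -> C) (p l m : C) :
  HD f p l -> HD g p m -> HD (fun w => f w * g w)%C p (l * g p + f p * m)%C.
Proof.
intros Hf Hg c t c' H E.
apply (cderiv_ext_val _ _ ((c' * l) * g (c t) + f (c t) * (c' * m))); [rewrite E; ring|].
apply (cderiv_mult (fun s => f (c s)) (fun s => g (c s))); auto.
Qed.

Lemma HD_inv (f : C -> C) (p l : C) :
  f p <> 0%C -> HD f p l -> HD (fun w => / f w)%C p (- (l * (/ f p * / f p)))%C.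
Proof.
intros H0 Hf c t c' H E.
apply (cderiv_ext_val _ _ (- ((c' * l) * (/ f (c t) * / f (c t))))%C); [rewrite E; ring|].
apply (cderiv_inv (fun s => f (c s))); [rewrite E; exact H0|auto].
Qed.

Lemma HD_Cexp (p : C) : HD Cexp p (Cexp p).
Proof. intros c t c' H <-; apply cderiv_Cexp, H. Qed.

(** Continuity in two real variables, componentwise, is the form that Green's formula consumes. *)
Definition Ccont (g : C -> C) (p : C) : Prop :=
  continuity_2d_pt (fun u v => Re (g (u, v))) (Re p) (Im p) /\
  continuity_2d_pt (fun u v => Im (g (u, v))) (Re p) (Im p).

Lemma Ccont_const (a p : C) : Ccont (fun _ => a) p.
Proof. split; apply continuity_2d_pt_const. Qed.

Lemma Ccont_id (p : C) : Ccont (fun w => w) p.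
Proof. split; [apply continuity_2d_pt_id1|apply continuity_2d_pt_id2]. Qed.

Lemma Ccont_plus (f g : C -> C) (p : C) :
  Ccont f p -> Ccont g p -> Ccont (fun w => f w + g w)%C p.
Proof.
intros [H1 H2] [H3 H4]; split;
 [exact (continuity_2d_pt_plus _ _ _ _ H1 H3)|exact (continuity_2d_pt_plus _ _ _ _ H2 H4)].
Qed.

Lemma Ccont_opp (f : C -> C) (p : C) : Ccont f p -> Ccont (fun w => - f w)%C p.
Proof.
intros [H1 H2]; split;
 [exact (continuity_2d_pt_opp _ _ _ H1)|exact (continuity_2d_pt_opp _ _ _ H2)].
Qed.

Lemma Ccont_mult (f g : C -> C) (p : C) :
  Ccont f p -> Ccont g p -> Ccont (fun w => f w * g w)%C p.
Proof.
intros [H1 H2] [H3 H4]; split.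
- exact (continuity_2d_pt_minus _ _ _ _ (continuity_2d_pt_mult _ _ _ _ H1 H3)
    (continuity_2d_pt_mult _ _ _ _ H2 H4)).
- exact (continuity_2d_pt_plus _ _ _ _ (continuity_2d_pt_mult _ _ _ _ H1 H4)
    (continuity_2d_pt_mult _ _ _ _ H2 H3)).
Qed.

Lemma Ccont_inv (f : C -> C) (p : C) :
  f p <> 0%C -> Ccont f p -> Ccont (fun w => / f w)%C p.
Proof.
intros H0 [H1 H2]; apply C_neq_0_sqr in H0.
destruct p as [a b].
assert (H3 : continuity_2d_pt
   (fun u v => / (Re (f (u, v)) * Re (f (u, v)) + Im (f (u, v)) * Im (f (u, v)))) a b).
{ apply continuity_2d_pt_inv; [|exact H0].
  apply continuity_2d_pt_plus; apply continuity_2d_pt_mult; assumption. }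
split.
- apply (continuity_2d_pt_ext (fun u v => Re (f (u, v)) *
    / (Re (f (u, v)) * Re (f (u, v)) + Im (f (u, v)) * Im (f (u, v))))).
  + intros u v; symmetry; apply Re_inv.
  + apply continuity_2d_pt_mult; assumption.
- apply (continuity_2d_pt_ext (fun u v => - Im (f (u, v)) *
    / (Re (f (u, v)) * Re (f (u, v)) + Im (f (u, v)) * Im (f (u, v))))).
  + intros u v; symmetry; apply Im_inv.
  + apply continuity_2d_pt_mult; [apply continuity_2d_pt_opp|]; assumption.
Qed.

Lemma Ccont_Cexp (f : C -> C) (p : C) : Ccont f p -> Ccont (fun w => Cexp (f w)) p.
Proof.
intros [H1 H2]; split; cbn; apply continuity_2d_pt_mult;
 apply continuity_1d_2d_pt_comp; auto.
- apply derivable_continuous_pt, derivable_pt_exp.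
- apply derivable_continuous_pt, derivable_pt_cos.
- apply derivable_continuous_pt, derivable_pt_exp.
- apply derivable_continuous_pt, derivable_pt_sin.
Qed.

Ltac ccont := repeat first [assumption|apply Ccont_const|apply Ccont_id
  |apply Ccont_plus|apply Ccont_opp|apply Ccont_mult|apply Ccont_Cexp].

Lemma Ccont_inv_sub (a p : C) : (p + - a)%C <> 0%C -> Ccont (fun w => / (w + - a))%C p.
Proof. intros H; apply (Ccont_inv (fun w => w + - a)%C); [exact H|ccont]. Qed.

Definition near (p : C) (P : C -> Prop) : Prop :=
  locally_2d (fun u v => P (u, v)) (Re p) (Im p).

Lemma near_imp (p : C) (P Q : C -> Prop) :
  (forall w, P w -> Q w) -> near p P -> near p Q.
Proof.
intros H [d Hd]; exists d; intros u v Hu Hv; apply H, Hd; assumption.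
Qed.

Lemma near_and (p : C) (P Q : C -> Prop) :
  near p P -> near p Q -> near p (fun w => P w /\ Q w).
Proof. exact (locally_2d_and _ _ _ _). Qed.

Lemma near_all (p : C) (P : C -> Prop) : (forall w, P w) -> near p P.
Proof. intros H; exists (mkposreal 1 Rlt_0_1); intros; apply H. Qed.

Lemma near_self (p : C) (P : C -> Prop) : near p P -> P p.
Proof. intros H; apply locally_2d_singleton in H; destruct p; exact H. Qed.

Lemma near_near (p : C) (P : C -> Prop) : near p P -> near p (fun w => near w P).
Proof.
intros [d Hd].
assert (H2 : 0 < d / 2) by (assert (H := cond_pos d); lra).
exists (mkposreal _ H2); cbn; intros u v Hu Hv.
exists (mkposreal _ H2); cbn; intros u' v' Hu' Hv'; apply Hd.
- replace (u' - Re p) with ((u' - u) + (u - Re p)) by ring.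
  eapply Rle_lt_trans; [apply Rabs_triang|lra].
- replace (v' - Im p) with ((v' - v) + (v - Im p)) by ring.
  eapply Rle_lt_trans; [apply Rabs_triang|lra].
Qed.

Lemma Ccont_near (p : C) (f g : C -> C) :
  near p (fun w => f w = g w) -> Ccont f p -> Ccont g p.
Proof.
intros H [H1 H2]; split.
- eapply continuity_2d_pt_ext_loc; [|exact H1].
  destruct H as [d Hd]; exists d; intros u v Hu Hv; f_equal; auto.
- eapply continuity_2d_pt_ext_loc; [|exact H2].
  destruct H as [d Hd]; exists d; intros u v Hu Hv; f_equal; auto.
Qed.

Lemma near_Cmod (p : C) (r : R) : 0 < r -> near p (fun w => Cmod (w - p) < r).
Proof.
intros Hr; assert (H : 0 < r / 2) by lra; exists (mkposreal _ H); cbn; intros u v Hu Hv.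
eapply Rle_lt_trans; [apply Cmod_le_Re_Im|]; cbn; unfold Re, Im in *.
unfold Rminus in *; lra.
Qed.

Lemma near_neq_0 (p : C) (f : C -> C) :
  Ccont f p -> f p <> 0%C -> near p (fun w => f w <> 0%C).
Proof.
intros [H1 H2] H0; apply C_neq_0_sqr in H0; destruct p as [a b].
assert (H := continuity_2d_pt_neq_0 _ _ _ (continuity_2d_pt_plus _ _ _ _
  (continuity_2d_pt_mult _ _ _ _ H1 H1) (continuity_2d_pt_mult _ _ _ _ H2 H2)) H0).
revert H; apply near_imp with (P := fun w => Re (f w) * Re (f w) + Im (f w) * Im (f w) <> 0).
intros w Hw E; apply Hw; rewrite E; cbn; ring.
Qed.

Lemma near_neq (p q : C) : p <> q -> near p (fun w => w <> q).
Proof.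
intros H; eapply near_imp; [|apply (near_neq_0 p (fun w => w + - q)%C)].
- cbn; intros w Hw E; apply Hw; rewrite E; ring.
- ccont.
- intros E; apply H; replace p with (p + - q + q)%C by ring; rewrite E; ring.
Qed.

(** Meant for functions defined by cases at [p], such as the extended quotients below: the closure
    rules for continuity do not see through the case distinction, whereas a bound by a multiple of
    the distance does. *)
Lemma Ccont_Lipschitz (f : C -> C) (p : C) (r M : R) :
  0 < r -> (forall w, Cmod (w - p) < r -> Cmod (f w - f p) <= M * Cmod (w - p)) -> Ccont f p.
Proof.
intros Hr H.
assert (G : forall eps : posreal, near p (fun w => Cmod (f w - f p) < eps)).
{ intros eps; assert (He := cond_pos eps).
  assert (HM := Rabs_pos M).
  assert (Hq : 0 < eps / (Rabs M + 1)) by (apply Rdiv_lt_0_compat; lra).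
  eapply near_imp; [|exact (near_and _ _ _ (near_Cmod p r Hr) (near_Cmod p _ Hq))].
  cbn; intros w [H1 H2]; eapply Rle_lt_trans; [apply H, H1|].
  apply Rle_lt_trans with ((Rabs M + 1) * Cmod (w - p)).
  - apply Rmult_le_compat_r; [apply Cmod_ge_0|]; assert (HH := Rle_abs M); lra.
  - apply (Rmult_lt_compat_l (Rabs M + 1)) in H2; [|lra].
    replace ((Rabs M + 1) * (eps / (Rabs M + 1))) with (pos eps) in H2 by (field; lra).
    exact H2. }
split; intros eps; destruct (G eps) as [d Hd]; exists d; intros u v Hu Hv;
 (eapply Rle_lt_trans; [|apply (Hd u v Hu Hv)]); destruct p as [a b].
- apply (re_le_Cmod (f (u, v) - f (a, b))).
- apply (Im_le_Cmod (f (u, v) - f (a, b))).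
Qed.

Lemma cderiv_near (c : R -> C) (t : R) (c' : C) (P : C -> Prop) :
  cderiv c t c' -> near (c t) P -> locally t (fun s => P (c s)).
Proof.
intros [H1 H2] [d Hd].
assert (K1 := ex_derive_continuous _ _ (ex_intro _ _ H1)).
assert (K2 := ex_derive_continuous _ _ (ex_intro _ _ H2)).
assert (L1 := K1 _ (locally_ball (Re (c t)) d)).
assert (L2 := K2 _ (locally_ball (Im (c t)) d)).
unfold filtermap in L1, L2.
assert (L3 := filter_and _ _ L1 L2).
revert L3; apply filter_imp; intros s [A B].
specialize (Hd _ _ A B); destruct (c s); exact Hd.
Qed.

Lemma HD_near (p : C) (f g : C -> C) (l : C) :
  near p (fun w => f w = g w) -> HD f p l -> HD g p l.
Proof.
intros H Hf c t c' Hc E; subst p.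
eapply cderiv_ext_loc; [|apply Hf; [exact Hc|reflexivity]].
exact (cderiv_near c t c' _ Hc H).
Qed.

(** * Complex-valued integrals and Green's formula *)

Definition Ccur (g : R -> C) (t : R) : Prop :=
  continuous (fun s => Re (g s)) t /\ continuous (fun s => Im (g s)) t.

Lemma cderiv_Ccur (g : R -> C) (t : R) (l : C) : cderiv g t l -> Ccur g t.
Proof.
intros [H1 H2]; split; apply (ex_derive_continuous (K := R_AbsRing) (V := R_NormedModule));
  eexists; eassumption.
Qed.

Lemma Ccont_Ccur (g : C -> C) (c : R -> C) (t : R) :
  Ccont g (c t) -> Ccur c t -> Ccur (fun s => g (c s)) t.
Proof.
intros [H1 H2] [H3 H4].
apply continuity_2d_pt_filterlim in H1, H2.
assert (H5 : filterlim (fun s => (Re (c s), Im (c s))) (locally t)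
  (locally (T := prod_UniformSpace R_UniformSpace R_UniformSpace) (Re (c t), Im (c t)))).
{ intros P [e He].
  assert (L1 := H3 _ (locally_ball (Re (c t)) e)).
  assert (L2 := H4 _ (locally_ball (Im (c t)) e)).
  unfold filtermap in *.
  apply (filter_imp (F := locally t) (fun s => ball (Re (c t)) e (Re (c s)) /\ ball (Im (c t)) e (Im (c s)))).
  - intros s [A B]; apply He; split; assumption.
  - exact (filter_and _ _ L1 L2). }
assert (E : forall s, (Re (c s), Im (c s)) = c s) by (intros s; destruct (c s); reflexivity).
split.
- assert (K := filterlim_comp _ _ _ _ _ _ _ _ H5 H1); cbn in K.
  unfold continuous; rewrite E in K.
  eapply filterlim_ext; [|exact K]; intros s; cbn; rewrite E; reflexivity.
- assert (K := filterlim_comp _ _ _ _ _ _ _ _ H5 H2); cbn in K.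
  unfold continuous; rewrite E in K.
  eapply filterlim_ext; [|exact K]; intros s; cbn; rewrite E; reflexivity.
Qed.

Definition exC (g : R -> C) (a b : R) : Prop :=
  ex_RInt (fun t => Re (g t)) a b /\ ex_RInt (fun t => Im (g t)) a b.

Definition CInt (g : R -> C) (a b : R) : C :=
  (RInt (fun t => Re (g t)) a b, RInt (fun t => Im (g t)) a b).

Lemma exC_cont (g : R -> C) (a b : R) :
  a <= b -> (forall t, a <= t <= b -> Ccur g t) -> exC g a b.
Proof.
intros Hab H; split; apply (ex_RInt_continuous (V := R_CompleteNormedModule));
  intros t Ht; rewrite Rmin_left, Rmax_right in Ht by lra; apply (H t Ht).
Qed.

Lemma exC_ext (f g : R -> C) (a b : R) :
  a <= b -> (forall t, a < t < b -> f t = g t) -> exC f a b -> exC g a b.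
Proof.
intros Hab H [H1 H2]; split;
 [eapply ex_RInt_ext; [|exact H1]|eapply ex_RInt_ext; [|exact H2]];
 intros t Ht; rewrite Rmin_left, Rmax_right in Ht by lra; cbn; rewrite (H t Ht); reflexivity.
Qed.

Lemma CInt_ext (f g : R -> C) (a b : R) :
  a <= b -> (forall t, a < t < b -> f t = g t) -> CInt f a b = CInt g a b.
Proof.
intros Hab H; unfold CInt; f_equal; apply RInt_ext;
 intros t Ht; rewrite Rmin_left, Rmax_right in Ht by lra; cbn; rewrite (H t Ht); reflexivity.
Qed.

Lemma exC_plus (f g : R -> C) (a b : R) :
  exC f a b -> exC g a b -> exC (fun t => f t + g t)%C a b.
Proof.
intros [H1 H2] [H3 H4]; split;
 [exact (ex_RInt_plus _ _ _ _ H1 H3)|exact (ex_RInt_plus _ _ _ _ H2 H4)].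
Qed.

Lemma CInt_plus (f g : R -> C) (a b : R) :
  exC f a b -> exC g a b -> CInt (fun t => f t + g t)%C a b = (CInt f a b + CInt g a b)%C.
Proof.
intros [H1 H2] [H3 H4]; apply C_ext;
 [exact (RInt_plus _ _ _ _ H1 H3)|exact (RInt_plus _ _ _ _ H2 H4)].
Qed.

Lemma exC_scal (c : C) (f : R -> C) (a b : R) :
  exC f a b -> exC (fun t => c * f t)%C a b.
Proof.
intros [H1 H2]; split; cbn.
- exact (ex_RInt_minus _ _ _ _ (ex_RInt_scal _ _ _ (Re c) H1) (ex_RInt_scal _ _ _ (Im c) H2)).
- exact (ex_RInt_plus _ _ _ _ (ex_RInt_scal _ _ _ (Re c) H2) (ex_RInt_scal _ _ _ (Im c) H1)).
Qed.

Lemma CInt_scal (c : C) (f : R -> C) (a b : R) :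
  exC f a b -> CInt (fun t => c * f t)%C a b = (c * CInt f a b)%C.
Proof.
intros [H1 H2].
apply (RInt_correct (V := R_CompleteNormedModule)) in H1, H2.
apply C_ext.
- apply (is_RInt_unique (V := R_CompleteNormedModule)).
  exact (is_RInt_minus _ _ _ _ _ _ (is_RInt_scal _ _ _ (Re c) _ H1) (is_RInt_scal _ _ _ (Im c) _ H2)).
- apply (is_RInt_unique (V := R_CompleteNormedModule)).
  exact (is_RInt_plus _ _ _ _ _ _ (is_RInt_scal _ _ _ (Re c) _ H2) (is_RInt_scal _ _ _ (Im c) _ H1)).
Qed.

Ltac exc := repeat first [match goal with H : ?A |- ?A => exact H end
  |simple apply exC_plus|simple apply exC_scal].

Lemma CInt_Chasles (f : R -> C) (a b c : R) :
  exC f a b -> exC f b c -> (CInt f a b + CInt f b c)%C = CInt f a c.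
Proof.
intros [H1 H2] [H3 H4]; apply C_ext;
 [exact (RInt_Chasles _ _ _ _ H1 H3)|exact (RInt_Chasles _ _ _ _ H2 H4)].
Qed.

Lemma CInt_FTC (f f' : R -> C) (a b : R) :
  a <= b -> (forall t, a <= t <= b -> cderiv f t (f' t)) ->
  (forall t, a <= t <= b -> Ccur f' t) -> CInt f' a b = (f b - f a)%C.
Proof.
intros Hab H1 H2; apply C_ext; apply (is_RInt_unique (V := R_CompleteNormedModule));
 apply (is_RInt_derive (V := R_CompleteNormedModule)
   (fun t => _ (f t)) (fun t => _ (f' t)));
 intros t Ht; rewrite Rmin_left, Rmax_right in Ht by lra;
 first [apply (H1 t Ht)|apply (H2 t Ht)].
Qed.

(** The factor 2 is the price of bounding the real and imaginary parts separately; no estimate below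
    needs a sharp constant. *)
Lemma CInt_bound (f : R -> C) (m : R -> R) (a b : R) :
  a <= b -> exC f a b -> ex_RInt m a b ->
  (forall t, a < t < b -> Cmod (f t) <= m t) -> Cmod (CInt f a b) <= 2 * RInt m a b.
Proof.
intros Hab [H1 H2] Hm H.
assert (G : forall p : R -> R, ex_RInt p a b ->
  (forall t, a < t < b -> Rabs (p t) <= m t) -> Rabs (RInt p a b) <= RInt m a b).
{ intros p Hp Hle; apply Rabs_le; split.
  - replace (- RInt m a b) with (RInt (fun t => - m t) a b)
      by exact (RInt_opp (V := R_CompleteNormedModule) m a b Hm).
    apply RInt_le; [exact Hab|exact (ex_RInt_opp (V := R_NormedModule) m a b Hm)|exact Hp|].
    intros t Ht; specialize (Hle t Ht); unfold Rabs in Hle;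
    destruct (Rcase_abs _); lra.
  - apply RInt_le; auto; intros t Ht; eapply Rle_trans; [apply Rle_abs|auto]. }
eapply Rle_trans; [apply Cmod_le_Re_Im|].
assert (G1 : Rabs (Re (CInt f a b)) <= RInt m a b).
{ apply (G _ H1); intros t Ht; eapply Rle_trans; [apply re_le_Cmod|auto]. }
assert (G2 : Rabs (Im (CInt f a b)) <= RInt m a b).
{ apply (G _ H2); intros t Ht; eapply Rle_trans; [apply Im_le_Cmod|auto]. }
lra.
Qed.

Lemma CInt_bound_const (f : R -> C) (M a b : R) :
  a <= b -> exC f a b -> (forall t, a < t < b -> Cmod (f t) <= M) ->
  Cmod (CInt f a b) <= 2 * ((b - a) * M).
Proof.
intros Hab He H.
assert (K := CInt_bound f (fun _ => M) a b Hab He (ex_RInt_const _ _ _) H).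
rewrite RInt_const in K; exact K.
Qed.

(** The exceptional points [L] are removed one at a time: continuity glues the two subintervals at
    each of them, and the mean value theorem settles an interval free of them. [L] will hold the
    abscissas of the singular points. *)
Lemma null_derive_const (f : R -> R) (L : list R) : forall a b : R,
  a <= b ->
  (forall t, a <= t <= b -> continuity_pt f t) ->
  (forall t, a < t < b -> ~ In t L -> is_derive f t 0) ->
  f a = f b.
Proof.
induction L as [|x L IH]; intros a b Hab Hc Hd.
- destruct (MVT_gen f a b (fun _ => 0)) as [c [_ Hm]].
  + rewrite Rmin_left, Rmax_right by lra; intros t Ht; apply Hd; auto.
  + rewrite Rmin_left, Rmax_right by lra; auto.
  + lra.
- destruct (Rlt_dec a x) as [H1|H1]; [destruct (Rlt_dec x b) as [H2|H2]|].
  + transitivity (f x).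
    * apply IH; [lra|intros; apply Hc; lra|].
      intros t Ht Hn; apply Hd; [lra|]; intros [E|E]; [lra|auto].
    * apply IH; [lra|intros; apply Hc; lra|].
      intros t Ht Hn; apply Hd; [lra|]; intros [E|E]; [lra|auto].
  + apply IH; auto; intros t Ht Hn; apply Hd; auto; intros [E|E]; [lra|auto].
  + apply IH; auto; intros t Ht Hn; apply Hd; auto; intros [E|E]; [lra|auto].
Qed.

Definition clamp (a b s : R) : R := Rmax a (Rmin b s).

Lemma clamp_bound (a b s : R) : a <= b -> a <= clamp a b s <= b.
Proof.
intros H; unfold clamp; split; [apply Rmax_l|].
apply Rmax_lub; [exact H|apply Rmin_l].
Qed.

Lemma clamp_id (a b s : R) : a <= s <= b -> clamp a b s = s.
Proof. intros H; unfold clamp; rewrite Rmin_right, Rmax_right; lra. Qed.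

Lemma clamp_dist (a b s t : R) : a <= t <= b -> Rabs (clamp a b s - t) <= Rabs (s - t).
Proof.
intros H; unfold clamp, Rmax, Rmin, Rabs;
repeat destruct (Rle_dec _ _); repeat destruct (Rcase_abs _); lra.
Qed.

(* Green's formula when the curl vanishes; [clamp] makes the parameter
   integral continuous up to the edges of the rectangle. *)
Lemma Green_rectangle (P Q D : R -> R -> R) (L : list R) (a b c d : R) :
  a <= b -> c <= d ->
  (forall u v, a <= u <= b -> c <= v <= d -> continuity_2d_pt P u v) ->
  (forall u v, a <= u <= b -> c <= v <= d -> continuity_2d_pt Q u v) ->
  (forall u v, a <= u <= b -> c <= v <= d -> ~ In u L ->
     locally_2d (fun s t => is_derive (fun z => P z t) s (D s t)) u v /\
     is_derive (fun z => Q u z) v (D u v) /\ continuity_2d_pt D u v) ->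
  RInt (P b) c d - RInt (P a) c d = RInt (fun u => Q u d - Q u c) a b.
Proof.
intros Hab Hcd HP HQ HD.
assert (exP : forall u, a <= u <= b -> ex_RInt (P u) c d).
{ intros u Hu; apply (ex_RInt_continuous (V := R_CompleteNormedModule)); intros t Ht.
  rewrite Rmin_left, Rmax_right in Ht by lra.
  intros R [e He]; destruct (HP u t Hu Ht e) as [dl Hdl]; exists dl; intros y Hy; apply He, Hdl.
  - rewrite Rminus_eq_0, Rabs_R0; apply cond_pos.
  - exact Hy. }
assert (Qc : forall v, c <= v <= d -> forall u, a <= u <= b -> continuous (fun z => Q z v) u).
{ intros v Hv u Hu R [e He]; destruct (HQ u v Hu Hv e) as [dl Hdl]; exists dl; intros y Hy; apply He, Hdl.
  - exact Hy.
  - rewrite Rminus_eq_0, Rabs_R0; apply cond_pos. }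
set (q := fun u => Q (clamp a b u) d - Q (clamp a b u) c).
assert (qc : forall u, continuous q u).
{ assert (H : forall v, c <= v <= d -> forall u, continuous (fun z => Q (clamp a b z) v) u).
  { intros v Hv u R [e He].
    assert (Hcu := clamp_bound a b u Hab).
    destruct (Qc v Hv _ Hcu _ (locally_ball (Q (clamp a b u) v) e)) as [dl Hdl].
    exists dl; intros y Hy; apply He, Hdl.
    eapply Rle_lt_trans; [|exact Hy]; unfold abs, minus, plus, opp; cbn.
    fold (clamp a b y - clamp a b u); fold (y - u).
    unfold clamp, Rmax, Rmin, Rabs; repeat destruct (Rle_dec _ _); repeat destruct (Rcase_abs _); lra. }
  intros u; apply (continuous_minus (V := R_NormedModule)); apply H; lra. }
set (V := fun s => RInt (P (clamp a b s)) c d).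
assert (Vc : forall s, a <= s <= b -> continuity_pt V s).
{ intros s Hs; apply continuity_pt_filterlim; intros R [e He].
  assert (H2 : 0 < e / (d - c + 1)) by (apply Rdiv_lt_0_compat; [apply cond_pos|lra]).
  destruct (uniform_continuity_2d_1d' P c d s (fun x Hx => HP s x Hs Hx) (mkposreal _ H2)) as [dl Hdl].
  exists dl; intros y Hy; apply He.
  assert (Hcy := clamp_bound a b y Hab).
  unfold V; rewrite (clamp_id a b s Hs).
  change (Rabs (RInt (P (clamp a b y)) c d - RInt (P s) c d) < e).
  change (RInt (P (clamp a b y)) c d - RInt (P s) c d) with
    (minus (RInt (P (clamp a b y)) c d) (RInt (P s) c d)).
  rewrite <- RInt_minus by auto.
  eapply Rle_lt_trans; [apply (abs_RInt_le_const _ c d (e / (d - c + 1))); [exact Hcd| |]|].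
  - apply (ex_RInt_minus (V := R_NormedModule)); auto.
  - intros t Ht; left; apply (Hdl t s t (clamp a b y)); try lra.
    + assert (H := cond_pos dl); lra.
    + assert (Hy' : Rabs (y - s) < dl) by exact Hy.
      assert (K := clamp_dist a b y s Hs).
      assert (K2 : Rabs (clamp a b y - s) < dl) by lra.
      apply Rabs_lt_between in K2; lra.
    + rewrite Rminus_eq_0, Rabs_R0; apply cond_pos.
  - assert (He' := cond_pos e).
    apply (Rmult_lt_reg_r (d - c + 1)); [lra|].
    replace ((d - c) * (e / (d - c + 1)) * (d - c + 1)) with ((d - c) * e) by (field; lra).
    nra. }
(* Off [L] the derivative of [V] is the integral of [D s], which the fundamental theorem in the
   second variable evaluates to [q s]. So [U] has derivative 0 there, and [U a = U b] is the
   formula. *)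
set (U := fun s => V s - RInt q a s).
assert (qd : forall s, is_derive (fun s => RInt q a s) s (q s)).
{ intros s; apply (is_derive_RInt (V := R_NormedModule) q _ a).
  - apply filter_forall; intros y; apply (RInt_correct (V := R_CompleteNormedModule)).
    apply (ex_RInt_continuous (V := R_CompleteNormedModule)); intros; apply qc.
  - apply qc. }
assert (E : U a = U b).
{ apply (null_derive_const U L); [exact Hab| |].
  - intros t Ht; apply continuity_pt_minus; [apply Vc, Ht|].
    apply continuity_pt_filterlim, (ex_derive_continuous (K := R_AbsRing) (V := R_NormedModule)).
    eexists; apply qd.
  - intros s Hs Hn.
    assert (Hs' : a <= s <= b) by lra.
    replace 0 with (minus (q s) (q s)) by (unfold minus, plus, opp; cbn; ring).
    apply (is_derive_minus (K := R_AbsRing) (V := R_NormedModule) V (fun s => RInt q a s)); [|apply qd].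
    assert (Hloc : locally s (fun y => a < y < b)).
    { assert (Hm : 0 < Rmin (s - a) (b - s)) by (apply Rmin_pos; lra).
      exists (mkposreal _ Hm); intros y Hy; cbn in Hy; change (Rabs (y - s) < Rmin (s - a) (b - s)) in Hy.
      assert (K1 := Rmin_l (s - a) (b - s)); assert (K2 := Rmin_r (s - a) (b - s)).
      apply Rabs_lt_between in Hy; lra. }
    apply (is_derive_ext_loc (fun y => RInt (fun t => P y t) c d)).
    { revert Hloc; apply filter_imp; intros y Hy; unfold V; rewrite clamp_id by lra; reflexivity. }
    assert (HnL : locally s (fun y => ~ In y L)).
    { clear - Hn; induction L as [|x L IH]; [apply filter_forall; auto|].
      assert (H1 : ~ In s L) by (intros H; apply Hn; right; exact H).
      assert (H2 : s <> x) by (intros H; apply Hn; left; auto).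
      apply IH in H1.
      assert (H3 : locally s (fun y => y <> x)) by apply (open_neq x s H2).
      generalize (filter_and _ _ H1 H3); apply filter_imp.
      intros y [A B] [C|C]; [congruence|auto]. }
    assert (Heq : RInt (fun t => Derive (fun u => P u t) s) c d = q s).
    { transitivity (RInt (D s) c d).
      - apply RInt_ext; intros t Ht; rewrite Rmin_left, Rmax_right in Ht by lra.
        apply is_derive_unique.
        destruct (HD s t Hs' (conj (Rlt_le _ _ (proj1 Ht)) (Rlt_le _ _ (proj2 Ht))) Hn) as [H _].
        exact (locally_2d_singleton _ _ _ H).
      - unfold q; rewrite clamp_id by lra.
        apply is_RInt_unique, (is_RInt_derive (V := R_CompleteNormedModule) (fun z => Q s z) (D s));
          intros t Ht; rewrite Rmin_left, Rmax_right in Ht by lra;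
          destruct (HD s t Hs' Ht Hn) as [_ [H1 H2]]; [exact H1|].
        intros R [e He]; destruct (H2 e) as [dl Hdl]; exists dl; intros y Hy; apply He, Hdl.
        + rewrite Rminus_eq_0, Rabs_R0; apply cond_pos.
        + exact Hy. }
    rewrite <- Heq; apply is_derive_RInt_param; rewrite ?Rmin_left, ?Rmax_right by lra.
    + generalize (filter_and _ _ Hloc HnL); apply filter_imp; intros y [Hy Hny] t Ht.
      destruct (HD y t (conj (Rlt_le _ _ (proj1 Hy)) (Rlt_le _ _ (proj2 Hy))) Ht Hny) as [H _].
      eexists; exact (locally_2d_singleton _ _ _ H).
    + intros t Ht; destruct (HD s t Hs' Ht Hn) as [H1 [_ H2]].
      eapply continuity_2d_pt_ext_loc; [|exact H2].
      revert H1; apply locally_2d_impl, locally_2d_forall.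
      intros u v H; symmetry; apply is_derive_unique, H.
    + revert Hloc; apply filter_imp; intros y Hy; apply exP; lra. }
unfold U, V in E; rewrite RInt_point, !clamp_id in E by lra.
replace (RInt (fun u => Q u d - Q u c) a b) with (RInt q a b).
- change (RInt (P a) c d - 0 = RInt (P b) c d - RInt q a b) in E; lra.
- apply RInt_ext; intros t Ht; rewrite Rmin_left, Rmax_right in Ht by lra.
  unfold q; rewrite clamp_id by lra; reflexivity.
Qed.

(** * Cauchy's theorem on rectangles *)

(** The signs orient the boundary counterclockwise. *)
Definition rect (g : C -> C) (a b c d : R) : C :=
  (CInt (fun u => g (u, c)) a b + Ci * CInt (fun v => g (b, v)) c d
   - CInt (fun u => g (u, d)) a b - Ci * CInt (fun v => g (a, v)) c d)%C.

(** Continuity of the derivative is part of the notion, so that Green's formula applies directly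
    instead of an argument of Goursat type; it is immediate for the explicit functions integrated
    here. *)
Definition Hol (g g' : C -> C) (p : C) : Prop :=
  near p (fun w => HD g w (g' w)) /\ Ccont g' p.

Lemma Ccur_horizontal (g : C -> C) (u c : R) : Ccont g (u, c) -> Ccur (fun s => g (s, c)) u.
Proof.
intros H; apply (Ccont_Ccur g (fun s => (s, c))); [exact H|].
exact (cderiv_Ccur _ _ _ (cderiv_horizontal c u)).
Qed.

Lemma Ccur_vertical (g : C -> C) (u c : R) : Ccont g (c, u) -> Ccur (fun s => g (c, s)) u.
Proof.
intros H; apply (Ccont_Ccur g (fun s => (c, s))); [exact H|].
exact (cderiv_Ccur _ _ _ (cderiv_vertical c u)).
Qed.

Lemma exC_horizontal (g : C -> C) (a b c : R) :
  a <= b -> (forall u, a <= u <= b -> Ccont g (u, c)) -> exC (fun u => g (u, c)) a b.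
Proof. intros H1 H2; apply exC_cont; [exact H1|]; intros; apply Ccur_horizontal; auto. Qed.

Lemma exC_vertical (g : C -> C) (a c d : R) :
  c <= d -> (forall v, c <= v <= d -> Ccont g (a, v)) -> exC (fun v => g (a, v)) c d.
Proof. intros H1 H2; apply exC_cont; [exact H1|]; intros; apply Ccur_vertical; auto. Qed.

Lemma rect_ext (f g : C -> C) (a b c d : R) :
  a <= b -> c <= d ->
  (forall u v, a <= u <= b -> c <= v <= d -> u = a \/ u = b \/ v = c \/ v = d ->
     f (u, v) = g (u, v)) ->
  rect f a b c d = rect g a b c d.
Proof.
intros Hab Hcd H; unfold rect.
rewrite (CInt_ext (fun u => f (u, c)) (fun u => g (u, c)) a b)
  by (auto; intros; apply H; auto; lra).
rewrite (CInt_ext (fun u => f (u, d)) (fun u => g (u, d)) a b)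
  by (auto; intros; apply H; auto; lra).
rewrite (CInt_ext (fun v => f (a, v)) (fun v => g (a, v)) c d)
  by (auto; intros; apply H; auto; lra).
rewrite (CInt_ext (fun v => f (b, v)) (fun v => g (b, v)) c d)
  by (auto; intros; apply H; auto; lra).
reflexivity.
Qed.

(** By the Cauchy-Riemann equations the pairs [Re g], [Im g] and [Im g], [- Re g] both satisfy the
    hypotheses of [Green_rectangle], with [D] the real and the imaginary part of [g']. The two
    resulting identities are the imaginary and the real part of the claim. *)
Theorem Cauchy_rectangle (g g' : C -> C) (S : list C) (a b c d : R) :
  a <= b -> c <= d ->
  (forall u v, a <= u <= b -> c <= v <= d -> Ccont g (u, v)) ->
  (forall u v, a <= u <= b -> c <= v <= d -> ~ In (u, v) S -> Hol g g' (u, v)) ->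
  rect g a b c d = 0%C.
Proof.
intros Hab Hcd Hc Hd.
(* Green's formula excludes whole vertical lines, so the exceptional list passed to it consists of
   the abscissas of [S]. *)
assert (HL : forall u v, ~ In u (map fst S) -> ~ In (u, v) S).
{ intros u v H1 H2; apply H1; exact (in_map fst S (u, v) H2). }
assert (Hs : forall u v l, HD g (u, v) l -> cderiv (fun z => g (z, v)) u l).
{ intros u v l H; eapply cderiv_ext_val; [|exact (H _ _ _ (cderiv_horizontal v u) eq_refl)]; ring. }
assert (Ht : forall u v l, HD g (u, v) l -> cderiv (fun z => g (u, z)) v (Ci * l)).
{ intros u v l H; exact (H _ _ _ (cderiv_vertical u v) eq_refl). }
assert (G1 := Green_rectangle (fun u v => Re (g (u, v))) (fun u v => Im (g (u, v)))
  (fun u v => Re (g' (u, v))) (map fst S) a b c d Hab Hcd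
  (fun u v Hu Hv => proj1 (Hc u v Hu Hv)) (fun u v Hu Hv => proj2 (Hc u v Hu Hv))).
assert (G2 := Green_rectangle (fun u v => Im (g (u, v))) (fun u v => - Re (g (u, v)))
  (fun u v => Im (g' (u, v))) (map fst S) a b c d Hab Hcd
  (fun u v Hu Hv => proj2 (Hc u v Hu Hv))
  (fun u v Hu Hv => continuity_2d_pt_opp _ _ _ (proj1 (Hc u v Hu Hv)))).
assert (G1' := G1 ltac:(intros u v Hu Hv Hn; destruct (Hd u v Hu Hv (HL u v Hn)) as [H1 [H2 H3]];
  split; [apply (near_imp _ _ (fun w => cderiv (fun z => g (z, snd w)) (fst w) (g' w))
      (fun w => match w with (x, y) => fun K => Hs x y _ K end)) in H1;
    destruct H1 as [e He]; exists e; intros x y Hx Hy; exact (proj1 (He x y Hx Hy))|];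
  split; [|exact H2]; apply near_self, Ht in H1; destruct H1 as [_ H1];
  replace (Re (g' (u, v))) with (Im (Ci * g' (u, v))%C) by (cbn; unfold Re, Im; ring); exact H1)).
assert (G2' := G2 ltac:(intros u v Hu Hv Hn; destruct (Hd u v Hu Hv (HL u v Hn)) as [H1 [H2 H3]];
  split; [apply (near_imp _ _ (fun w => cderiv (fun z => g (z, snd w)) (fst w) (g' w))
      (fun w => match w with (x, y) => fun K => Hs x y _ K end)) in H1;
    destruct H1 as [e He]; exists e; intros x y Hx Hy; exact (proj2 (He x y Hx Hy))|];
  split; [|exact H3]; apply near_self, Ht in H1; destruct H1 as [H1 _];
  replace (Im (g' (u, v))) with (opp (Re (Ci * g' (u, v))%C)) by (cbn; unfold Re, Im; ring);
  exact (is_derive_opp _ _ _ H1))).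
clear G1 G2 Hs Ht.
assert (X1 := exC_horizontal g a b c Hab (fun u Hu => Hc u c Hu (conj (Rle_refl c) Hcd))).
assert (X2 := exC_horizontal g a b d Hab (fun u Hu => Hc u d Hu (conj Hcd (Rle_refl d)))).
destruct X1 as [A1 A2], X2 as [B1 B2].
assert (M1 : RInt (fun u => Im (g (u, d)) - Im (g (u, c))) a b =
  RInt (fun u => Im (g (u, d))) a b - RInt (fun u => Im (g (u, c))) a b)
  by exact (RInt_minus _ _ _ _ B2 A2).
assert (M2 : RInt (fun u => - Re (g (u, d)) - - Re (g (u, c))) a b =
  - (RInt (fun u => Re (g (u, d))) a b - RInt (fun u => Re (g (u, c))) a b)).
{ transitivity (- RInt (fun u => Re (g (u, d)) - Re (g (u, c))) a b).
  - rewrite <- (RInt_opp (V := R_CompleteNormedModule)).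
    + apply RInt_ext; intros; unfold opp; cbn; ring.
    + exact (ex_RInt_minus _ _ _ _ B1 A1).
  - f_equal; exact (RInt_minus _ _ _ _ B1 A1). }
cbv beta in G1', G2'; rewrite M1 in G1'; rewrite M2 in G2'.
unfold rect, CInt; apply C_ext; unfold Cminus, Cplus, Cmult, Copp, Ci, Re, Im; cbn [fst snd];
 unfold Re, Im in G1', G2'; cbn [fst snd RtoC]; lra.
Qed.

Lemma list_isolated (S : list C) (p : C) : near p (fun w => In w S -> w = p).
Proof.
induction S as [|q S IH]; [apply near_all; intros w []|].
destruct (classic (p = q)) as [->|Hn].
- revert IH; apply near_imp; intros w H [->|K]; auto.
- eapply near_imp; [|exact (near_and _ _ _ IH (near_neq p q Hn))].
  cbn; intros w [H1 H2] [->|K]; [contradiction|auto].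
Qed.

Lemma list_choice {A B : Type} (P : A -> B -> Prop) (b0 : B) (S : list A) :
  (forall x y : A, {x = y} + {x <> y}) ->
  (forall x, In x S -> exists y, P x y) -> exists f : A -> B, forall x, In x S -> P x (f x).
Proof.
intros dec; induction S as [|x S IH]; intros H; [exists (fun _ => b0); intros x []|].
destruct IH as [f Hf]; [intros y Hy; apply H; right; exact Hy|].
destruct (H x (or_introl eq_refl)) as [y Hy].
exists (fun z => if dec z x then y else f z); intros z Hz.
destruct (dec z x) as [->|Hn]; [exact Hy|].
destruct Hz as [->|Hz]; [contradiction|auto].
Qed.

Lemma Hol_near (f g f' : C -> C) (p : C) :
  near p (fun w => f w = g w) -> Hol f f' p -> Hol g f' p.
Proof.
intros H [H1 H2]; split; [|exact H2].
eapply near_imp; [|exact (near_and _ _ _ (near_near _ _ H) H1)].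
cbn; intros w [K1 K2]; exact (HD_near _ _ _ _ K1 K2).
Qed.

(** Since [Cauchy_rectangle] asks only for continuity at the exceptional points, a merely continuous
    local extension [D] is enough to fill each puncture. The points of [S] are interior, so filling
    them leaves the boundary integral unchanged. *)
Theorem Cauchy_removable (g g' : C -> C) (S : list C) (a b c d : R) :
  a <= b -> c <= d ->
  (forall p, In p S -> a < Re p < b /\ c < Im p < d) ->
  (forall u v, a <= u <= b -> c <= v <= d -> ~ In (u, v) S ->
     Ccont g (u, v) /\ Hol g g' (u, v)) ->
  (forall p, In p S -> exists D, Ccont D p /\ near p (fun w => w <> p -> g w = D w)) ->
  rect g a b c d = 0%C.
Proof.
intros Hab Hcd HS Hreg Hrem.
destruct (list_choice (fun p D => Ccont D p /\ near p (fun w => w <> p -> g w = D w))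
  (fun _ => 0%C) S Ceq_dec Hrem) as [D HD'].
set (h := fun w => if in_dec Ceq_dec w S then D w w else g w).
assert (Hout : forall w, ~ In w S -> h w = g w).
{ intros w Hw; unfold h; destruct (in_dec Ceq_dec w S); [contradiction|reflexivity]. }
assert (Hlocal : forall p, ~ In p S -> near p (fun w => g w = h w)).
{ intros p Hp; generalize (list_isolated S p); apply near_imp; intros w Hw.
  symmetry; apply Hout; intros K; apply Hp; rewrite <- (Hw K); exact K. }
assert (E : rect h a b c d = 0%C).
{ apply (Cauchy_rectangle h g' S); auto.
  - intros u v Hu Hv; destruct (in_dec Ceq_dec (u, v) S) as [Hi|Hn].
    + destruct (HD' _ Hi) as [H1 H2]; revert H1; apply Ccont_near.
      generalize (near_and _ _ _ H2 (list_isolated S (u, v))); apply near_imp.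
      cbn; intros w [K1 K2]; unfold h; destruct (in_dec Ceq_dec w S) as [K3|K3].
      * rewrite (K2 K3); reflexivity.
      * symmetry; apply K1; congruence.
    + exact (Ccont_near _ _ _ (Hlocal _ Hn) (proj1 (Hreg u v Hu Hv Hn))).
  - intros u v Hu Hv Hn; exact (Hol_near _ _ _ _ (Hlocal _ Hn) (proj2 (Hreg u v Hu Hv Hn))). }
rewrite <- E; apply rect_ext; auto; intros u v _ _ He.
symmetry; apply Hout; intros Hi; specialize (HS _ Hi); cbn in HS; lra.
Qed.

Definition edgesC (g : C -> C) (a b c d : R) : Prop :=
  exC (fun u => g (u, c)) a b /\ exC (fun v => g (b, v)) c d /\
  exC (fun u => g (u, d)) a b /\ exC (fun v => g (a, v)) c d.

Lemma edgesC_cont (g : C -> C) (a b c d : R) :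
  a <= b -> c <= d ->
  (forall u v, a <= u <= b -> c <= v <= d -> u = a \/ u = b \/ v = c \/ v = d -> Ccont g (u, v)) ->
  edgesC g a b c d.
Proof.
intros Hab Hcd H.
split; [|split; [|split]];
 [apply (exC_horizontal g a b c)|apply (exC_vertical g b c d)
 |apply (exC_horizontal g a b d)|apply (exC_vertical g a c d)];
 auto; intros t Ht; apply H; auto; lra.
Qed.

Lemma edgesC_plus (f g : C -> C) (a b c d : R) :
  edgesC f a b c d -> edgesC g a b c d -> edgesC (fun w => f w + g w)%C a b c d.
Proof.
intros (H1 & H2 & H3 & H4) (K1 & K2 & K3 & K4).
exact (conj (exC_plus _ _ _ _ H1 K1) (conj (exC_plus _ _ _ _ H2 K2)
  (conj (exC_plus _ _ _ _ H3 K3) (exC_plus _ _ _ _ H4 K4)))).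
Qed.

Lemma rect_plus (f g : C -> C) (a b c d : R) :
  edgesC f a b c d -> edgesC g a b c d ->
  rect (fun w => f w + g w)%C a b c d = (rect f a b c d + rect g a b c d)%C.
Proof.
intros (H1 & H2 & H3 & H4) (K1 & K2 & K3 & K4); unfold rect.
rewrite (CInt_plus _ _ _ _ H1 K1), (CInt_plus _ _ _ _ H2 K2),
  (CInt_plus _ _ _ _ H3 K3), (CInt_plus _ _ _ _ H4 K4); ring.
Qed.

Lemma edgesC_scal (k : C) (f : C -> C) (a b c d : R) :
  edgesC f a b c d -> edgesC (fun w => k * f w)%C a b c d.
Proof.
intros (H1 & H2 & H3 & H4).
exact (conj (exC_scal k _ _ _ H1) (conj (exC_scal k _ _ _ H2)
  (conj (exC_scal k _ _ _ H3) (exC_scal k _ _ _ H4)))).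
Qed.

Lemma rect_scal (k : C) (f : C -> C) (a b c d : R) :
  edgesC f a b c d -> rect (fun w => k * f w)%C a b c d = (k * rect f a b c d)%C.
Proof.
intros (H1 & H2 & H3 & H4); unfold rect.
rewrite (CInt_scal _ _ _ _ H1), (CInt_scal _ _ _ _ H2),
  (CInt_scal _ _ _ _ H3), (CInt_scal _ _ _ _ H4); ring.
Qed.

(* Agrees with [Clog] for [0 < Re z]; this form can be differentiated directly. *)
Definition Log1 (z : C) : C := (ln (Re z * Re z + Im z * Im z) / 2, atan (Im z / Re z)).

Lemma cderiv_Log1 (f : R -> C) (t : R) (l : C) :
  0 < Re (f t) -> cderiv f t l -> cderiv (fun s => Log1 (f s)) t (l * / f t)%C.
Proof.
intros H0 [H1 H2].
assert (G : forall a b : R -> R, is_derive a t (Re l) -> is_derive b t (Im l) -> 0 < a t ->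
  cderiv (fun s => Log1 (a s, b s)) t (l * / (a t, b t))%C).
{ clear; intros a b H1 H2 H3.
  assert (D1 : Derive (fun s => a s) t = Re l) by exact (is_derive_unique _ _ _ H1).
  assert (D2 : Derive (fun s => b s) t = Im l) by exact (is_derive_unique _ _ _ H2).
  assert (E1 : ex_derive a t) by (eexists; exact H1).
  assert (E2 : ex_derive b t) by (eexists; exact H2).
  assert (H4 : 0 < a t * a t + b t * b t) by nra.
  apply cderiv_pair; cbn.
  - auto_derive; [tauto|]; rewrite D1, D2; unfold Re, Im; field; nra.
  - auto_derive; [repeat split; auto; lra|]; rewrite D1, D2; unfold Re, Im; field; nra. }
specialize (G _ _ H1 H2 H0); apply (cderiv_eta Log1).
eapply cderiv_ext_val; [|exact G]; cbv beta; destruct (f t); reflexivity.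
Qed.

Lemma Log1_1 : Log1 1 = 0%C.
Proof.
unfold Log1; cbn; replace (0 / 1) with 0 by field.
rewrite atan_0, Rmult_0_r, Rmult_1_r, Rplus_0_r, ln_1; apply C_ext; cbn; lra.
Qed.

(** [Log1] is usable only on the right half plane: the constant [k] rotates the segment into it and
    disappears from the logarithmic derivative. *)
Lemma CInt_inv_segment (k p h : C) (a b : R) :
  a <= b -> k <> 0%C -> (forall t, a <= t <= b -> 0 < Re (k * (p + RtoC t * h))%C) ->
  (h * CInt (fun t => / (p + RtoC t * h)) a b)%C =
  (Log1 (k * (p + RtoC b * h)) - Log1 (k * (p + RtoC a * h)))%C.
Proof.
intros Hab Hk H.
assert (Hne : forall t, a <= t <= b -> (p + RtoC t * h)%C <> 0%C).
{ intros t Ht E; specialize (H t Ht); rewrite E, Cmult_0_r in H; cbn in H; lra. }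
assert (Hi : forall t, a <= t <= b -> Ccur (fun t => / (p + RtoC t * h))%C t).
{ intros t Ht; eapply cderiv_Ccur, (cderiv_inv (fun t => p + RtoC t * h)%C);
    [exact (Hne t Ht)|apply cderiv_line]. }
rewrite <- CInt_scal by (apply exC_cont; assumption).
apply (CInt_FTC (fun t => Log1 (k * (p + RtoC t * h)))); [exact Hab| |].
- intros t Ht; eapply cderiv_ext_val; [|apply (cderiv_Log1 (fun t => k * (p + RtoC t * h))%C);
    [auto|apply (cderiv_mult (fun _ => k)); [apply cderiv_const|apply cderiv_line]]].
  cbv beta; field; auto.
- intros t Ht; eapply cderiv_Ccur, (cderiv_mult (fun _ => h)); [apply cderiv_const|].
  apply (cderiv_inv (fun t => p + RtoC t * h)%C); [exact (Hne t Ht)|apply cderiv_line].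
Qed.

Lemma atan_sum_inv (x y : R) : 0 < x -> 0 < y -> atan (x / y) + atan (y / x) = PI / 2.
Proof.
intros Hx Hy; replace (y / x) with (/ (x / y)) by (field; lra).
rewrite atan_inv by (apply Rdiv_lt_0_compat; assumption); ring.
Qed.

(** Each side is rotated into the right half plane by one of [Ci], [1], [- Ci], [- (1)]. The moduli
    at the four corners cancel, and at each corner the two adjacent angles add up to [PI / 2] by
    [atan_sum_inv], which makes [2 * PI] in total. *)
Lemma rect_inv (W : C) (a b c d : R) :
  a < Re W < b -> c < Im W < d ->
  rect (fun w => / (w - W))%C a b c d = (2 * RtoC PI * Ci)%C.
Proof.
intros H1 H2; destruct W as [p q]; unfold Re, Im in H1, H2; cbn [fst snd] in H1, H2.
assert (Ci0 : forall z : C, Im z <> 0 \/ Re z <> 0 -> z <> 0%C) by (intros z Hz ->; cbn in Hz; lra).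
assert (Seg : forall (k z0 h z1 z2 : C) (f : R -> C) (u v : R), u <= v -> Im k <> 0 \/ Re k <> 0 ->
  (forall t, f t = (/ (z0 + RtoC t * h))%C) ->
  (forall t, u <= t <= v -> 0 < Re (k * (z0 + RtoC t * h))%C) ->
  (k * (z0 + RtoC v * h))%C = z1 -> (k * (z0 + RtoC u * h))%C = z2 ->
  (h * CInt f u v)%C = (Log1 z1 - Log1 z2)%C).
{ intros k z0 h z1 z2 f u v Huv Hk Hf H <- <-.
  rewrite (CInt_ext f (fun t => / (z0 + RtoC t * h))%C) by auto.
  apply CInt_inv_segment; auto. }
assert (P1 : CInt (fun u => / ((u, c) - (p, q)))%C a b =
  (Log1 (q - c, b - p)%R - Log1 (q - c, a - p)%R)%C).
{ rewrite <- (Cmult_1_l (CInt _ _ _)).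
  apply (Seg Ci (- p, c - q)%R); cbn; try lra; intros; try lra; [f_equal|..]; apply C_ext; cbn; ring. }
assert (P2 : (Ci * CInt (fun v => / ((b, v) - (p, q))) c d =
  Log1 (b - p, d - q)%R - Log1 (b - p, c - q)%R)%C).
{ apply (Seg 1 (b - p, - q)%R); cbn; try lra; intros; try lra; [f_equal|..]; apply C_ext; cbn; ring. }
assert (P3 : CInt (fun u => / ((u, d) - (p, q)))%C a b =
  (Log1 (d - q, p - b)%R - Log1 (d - q, p - a)%R)%C).
{ rewrite <- (Cmult_1_l (CInt _ _ _)).
  apply (Seg (- Ci) (- p, d - q)%R)%C; cbn; try lra; intros; try lra; [f_equal|..]; apply C_ext; cbn; ring. }
assert (P4 : (Ci * CInt (fun v => / ((a, v) - (p, q))) c d =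
  Log1 (p - a, q - d)%R - Log1 (p - a, q - c)%R)%C).
{ apply (Seg (- (1)) (a - p, - q)%R)%C; cbn; try lra; intros; try lra; [f_equal|..]; apply C_ext; cbn; ring. }
unfold rect; rewrite P1, P2, P3, P4.
assert (L : forall x y : R, atan (- x / y) = - atan (x / y)).
{ intros x y; rewrite <- atan_opp; f_equal; unfold Rdiv; ring. }
apply C_ext; unfold Log1, Cminus, Cplus, Cmult, Copp, Ci, RtoC, Re, Im; cbn [fst snd].
- replace ((p - a) * (p - a) + (q - d) * (q - d)) with ((d - q) * (d - q) + (p - a) * (p - a)) by ring.
  replace ((p - a) * (p - a) + (q - c) * (q - c)) with ((q - c) * (q - c) + (a - p) * (a - p)) by ring.
  replace ((b - p) * (b - p) + (d - q) * (d - q)) with ((d - q) * (d - q) + (p - b) * (p - b)) by ring.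
  replace ((b - p) * (b - p) + (c - q) * (c - q)) with ((q - c) * (q - c) + (b - p) * (b - p)) by ring.
  ring.
- assert (A1 := atan_sum_inv (b - p) (q - c) ltac:(lra) ltac:(lra)).
  assert (A2 := atan_sum_inv (p - a) (q - c) ltac:(lra) ltac:(lra)).
  assert (A3 := atan_sum_inv (b - p) (d - q) ltac:(lra) ltac:(lra)).
  assert (A4 := atan_sum_inv (p - a) (d - q) ltac:(lra) ltac:(lra)).
  replace (a - p) with (- (p - a)) by ring; replace (c - q) with (- (q - c)) by ring.
  replace (p - b) with (- (b - p)) by ring; replace (q - d) with (- (d - q)) by ring.
  rewrite !L; lra.
Qed.

(** * The equation w + log w = c *)

Lemma ex_derive_continuity_pt (f : R -> R) (x : R) : ex_derive f x -> continuity_pt f x.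
Proof.
intros H; apply continuity_pt_filterlim.
exact (ex_derive_continuous (K := R_AbsRing) (V := R_NormedModule) f x H).
Qed.

Lemma MVT_is_derive (f f' : R -> R) (a b : R) :
  a < b -> (forall t, a <= t <= b -> is_derive f t (f' t)) ->
  exists c, a < c < b /\ f b - f a = f' c * (b - a).
Proof.
intros Hab H; destruct (MVT_cor2 f f' a b Hab) as [c [H1 H2]].
- intros t Ht; apply is_derive_Reals, H, Ht.
- exists c; auto.
Qed.

Lemma Cexp_Log1 (z : C) : 0 < Re z -> Cexp (Log1 z) = z.
Proof.
intros H; destruct z as [a b]; cbn in H.
assert (H2 : 0 < a * a + b * b) by nra.
assert (Hs : exp (ln (a * a + b * b) / 2) = a * sqrt (1 + (b / a)²)).
{ assert (Hq : 0 <= 1 + (b / a)²) by (assert (K := Rle_0_sqr (b / a)); lra).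
  rewrite <- (ln_exp (ln (a * a + b * b) / 2)), exp_ln by apply exp_pos.
  apply Rsqr_inj; [left; apply exp_pos|apply Rmult_le_pos; [lra|apply sqrt_pos]|].
  unfold Rsqr at 1; rewrite <- exp_plus.
  replace (ln (a * a + b * b) / 2 + ln (a * a + b * b) / 2) with (ln (a * a + b * b)) by lra.
  rewrite exp_ln, Rsqr_mult, Rsqr_sqrt by auto.
  unfold Rsqr; field; lra. }
assert (Hp : 0 < sqrt (1 + (b / a)²))
  by (apply sqrt_lt_R0; assert (K := Rle_0_sqr (b / a)); lra).
apply C_ext; unfold Log1, Cexp, Re, Im; cbn [fst snd]; rewrite Hs.
- rewrite cos_atan; field; lra.
- rewrite sin_atan; field; lra.
Qed.

(** Multiplication by [- Ci] rotates the upper half plane onto the right one, where [Log1] inverts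
    [Cexp]; in this form [Clog] can be differentiated. *)
Lemma Clog_upper (z : C) : 0 < Im z -> Clog z = (Log1 (- Ci * z) + RtoC (PI / 2) * Ci)%C.
Proof.
intros H; symmetry; apply Clog_unique.
- rewrite Cexp_plus, Cexp_Log1 by (cbn; unfold Re, Im in *; lra).
  replace (Cexp (RtoC (PI / 2) * Ci)) with Ci.
  + replace (- Ci * z * Ci)%C with (- (Ci * Ci) * z)%C by ring.
    apply C_ext; cbn; unfold Re, Im; ring.
  + apply C_ext; cbn; replace (PI / 2 * 0 - 0 * 1) with 0 by ring;
    replace (PI / 2 * 1 + 0 * 0) with (PI / 2) by ring;
    rewrite exp_0, ?cos_PI2, ?sin_PI2; ring.
- unfold Log1, Cplus, Re, Im; cbn.
  match goal with |- context [atan ?x] => assert (K := atan_bound x) end.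
  assert (P := PI_RGT_0); lra.
Qed.

Lemma cderiv_Clog_upper (f : R -> C) (t : R) (l : C) :
  0 < Im (f t) -> cderiv f t l -> cderiv (fun s => Clog (f s)) t (l * / f t)%C.
Proof.
intros H0 H.
assert (Hf : f t <> 0%C) by (intros E; rewrite E in H0; cbn in H0; lra).
eapply cderiv_ext_loc.
- assert (Hn : near (f t) (fun w => 0 < Im w)).
  { exists (mkposreal _ H0); cbn; intros u v _ Hv; apply Rabs_lt_between in Hv; lra. }
  generalize (cderiv_near f t l _ H Hn); apply filter_imp; intros s Hs; symmetry; apply Clog_upper, Hs.
- eapply cderiv_ext_val; [|apply cderiv_plus;
    [apply (cderiv_Log1 (fun s => - Ci * f s)%C);
      [|apply (cderiv_mult (fun _ => - Ci)%C f); [apply cderiv_const|exact H]]|apply cderiv_const]].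
  + assert (Ci <> 0%C) by (intros E; apply (f_equal Im) in E; cbn in E; lra).
    cbv beta; field; split; auto.
  + cbn; unfold Re, Im in *; lra.
Qed.

Lemma exp_Re_Clog (z : C) : z <> 0%C ->
  Re z = exp (Re (Clog z)) * cos (Im (Clog z)) /\ Im z = exp (Re (Clog z)) * sin (Im (Clog z)).
Proof. intros H; split; rewrite <- (Cexp_Clog z H) at 1; reflexivity. Qed.

Lemma Im_Clog_upper (z : C) : 0 < Im z -> 0 < Im (Clog z) < PI.
Proof.
intros H; assert (Hz : z <> 0%C) by (intros ->; cbn in H; lra).
destruct (exp_Re_Clog z Hz) as [_ E]; assert (B := Im_Clog_bound z Hz).
assert (P := exp_pos (Re (Clog z))).
assert (S : 0 < sin (Im (Clog z))) by (rewrite E in H; nra).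
split.
- destruct (Rlt_dec 0 (Im (Clog z))) as [|N]; auto; exfalso.
  assert (S' : sin (- Im (Clog z)) >= 0) by (apply Rle_ge, sin_ge_0; lra).
  rewrite sin_neg in S'; lra.
- destruct (Rlt_dec (Im (Clog z)) PI) as [|N]; auto.
  replace (Im (Clog z)) with PI in S by lra; rewrite sin_PI in S; lra.
Qed.

Lemma Im_Clog_lower (z : C) : Im z < 0 -> - PI < Im (Clog z) < 0.
Proof.
intros H; assert (Hz : z <> 0%C) by (intros ->; cbn in H; lra).
destruct (exp_Re_Clog z Hz) as [_ E]; assert (B := Im_Clog_bound z Hz).
assert (P := exp_pos (Re (Clog z))).
assert (S : sin (Im (Clog z)) < 0) by (rewrite E in H; nra).
split; [lra|].
destruct (Rlt_dec (Im (Clog z)) 0) as [|N]; auto.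
assert (S' := sin_ge_0 (Im (Clog z))); lra.
Qed.

Lemma Clog_pos (r : R) : 0 < r -> Clog (RtoC r) = RtoC (ln r).
Proof.
intros H; symmetry; apply Clog_unique.
- rewrite Cexp_RtoC, exp_ln by exact H; reflexivity.
- cbn; assert (P := PI_RGT_0); lra.
Qed.

Lemma Clog_neg (r : R) : r < 0 -> Clog (RtoC r) = (ln (- r), PI).
Proof.
intros H; symmetry; apply Clog_unique.
- apply C_ext; cbn; rewrite ?cos_PI, ?sin_PI, exp_ln by lra; ring.
- cbn; assert (P := PI_RGT_0); lra.
Qed.

Lemma Clog_polar (r t : R) : 0 < r -> - PI < t <= PI -> Clog (r * cos t, r * sin t) = (ln r, t).
Proof.
intros H Ht; symmetry; apply Clog_unique; [|exact Ht].
apply C_ext; cbn; rewrite exp_ln by exact H; reflexivity.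
Qed.

Lemma real_eq (z : C) : Im z = 0 -> z = RtoC (Re z).
Proof. intros H; apply C_ext; [reflexivity|exact H]. Qed.

Lemma Clog_real (z : C) : z <> 0%C -> Im z = 0 ->
  (0 < Re z /\ Clog z = (ln (Re z), 0)) \/ (Re z < 0 /\ Clog z = (ln (- Re z), PI)).
Proof.
intros Hz H; destruct (Rtotal_order (Re z) 0) as [K|[K|K]].
- right; split; [exact K|]; rewrite (real_eq z H) at 1; apply Clog_neg, K.
- exfalso; apply Hz, C_ext; assumption.
- left; split; [exact K|]; rewrite (real_eq z H) at 1; apply Clog_pos, K.
Qed.

Lemma Im_Clog_le_PI_real (z : C) : z <> 0%C -> Im (Clog z) = PI -> Im z = 0 /\ Re z < 0.
Proof.
intros H E.
destruct (Rtotal_order (Im z) 0) as [K|[K|K]].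
- apply Im_Clog_lower in K; assert (P := PI_RGT_0); lra.
- destruct (Clog_real z H K) as [[_ L]|[L _]]; [|auto].
  rewrite L in E; cbn in E; assert (P := PI_RGT_0); lra.
- apply Im_Clog_upper in K; lra.
Qed.

Lemma Cexp_conj (w : C) : Cexp (Cconj w) = Cconj (Cexp w).
Proof. apply C_ext; cbn; unfold Re, Im; cbn; rewrite ?cos_neg, ?sin_neg; ring. Qed.

Lemma Clog_conj (z : C) : Im z <> 0 -> Clog (Cconj z) = Cconj (Clog z).
Proof.
intros H; assert (Hz : z <> 0%C) by (intros ->; cbn in H; lra).
symmetry; apply Clog_unique.
- rewrite Cexp_conj, Cexp_Clog by exact Hz; reflexivity.
- assert (B := Im_Clog_bound z Hz); cbn; fold (Im (Clog z)).
  assert (Im (Clog z) <> PI) by (intros E; apply Im_Clog_le_PI_real in E; tauto).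
  change (Arg z) with (Im (Clog z)); lra.
Qed.

(* On the upper half plane the derivative 1 + 1/w of w + log w has negative
   imaginary part, which forces injectivity on a convex set (Noshiro-Warschawski). *)
Lemma w_plus_log_upper_inj (w1 w2 : C) :
  0 < Im w1 -> 0 < Im w2 -> (w1 + Clog w1)%C = (w2 + Clog w2)%C -> w1 = w2.
Proof.
intros H1 H2 E.
destruct (Ceq_dec w1 w2) as [|Hn]; [assumption|exfalso].
set (h := (w1 - w2)%C).
assert (Hh : h <> 0%C).
{ intros K; apply Hn; replace w1 with (h + w2)%C by (unfold h; ring); rewrite K; ring. }
set (g := fun t => (w2 + RtoC t * h)%C).
assert (Hpos : forall t, 0 <= t <= 1 -> 0 < Im (g t)).
{ intros t Ht; replace (Im (g t)) with ((1 - t) * Im w2 + t * Im w1)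
    by (unfold g, h; cbn; unfold Re, Im; ring).
  destruct (Rle_dec t (1 / 2)); nra. }
(* Multiplying by the conjugate of [h] turns the derivative along the segment into
   [|h|^2 (1 + 1/z)], whose imaginary part is negative at every point. The mean value theorem for
   the imaginary part then contradicts the equality of the end values. *)
assert (Hd : forall t, 0 <= t <= 1 ->
  cderiv (fun t => Cconj h * (g t + Clog (g t)))%C t (Cconj h * (h * (1 + / g t)))%C).
{ intros t Ht.
  eapply cderiv_ext_val; [|apply (cderiv_mult (fun _ => Cconj h));
    [apply cderiv_const|apply cderiv_plus; [apply cderiv_line|
      apply cderiv_Clog_upper; [auto|apply cderiv_line]]]].
  ring. }
destruct (MVT_is_derive (fun t => Im (Cconj h * (g t + Clog (g t)))%C)
  (fun t => Im (Cconj h * (h * (1 + / g t)))%C) 0 1) as [c [Hc Hm]].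
- lra.
- intros t Ht; apply Hd, Ht.
- replace (g 1) with w1 in Hm by (unfold g, h; ring).
  replace (g 0) with w2 in Hm by (unfold g, h; ring).
  rewrite E, Rminus_eq_0 in Hm.
  specialize (Hpos c ltac:(lra)); set (z := g c) in *.
  replace (Cconj h * (h * (1 + / z)))%C with (RtoC (Cmod h ^ 2) * (1 + / z))%C in Hm
    by (rewrite Cmod2_conj; ring).
  assert (Hz : z <> 0%C) by (intros K; rewrite K in Hpos; cbn in Hpos; lra).
  assert (Hq := C_neq_0_sqr z Hz).
  assert (Ei : Im (RtoC (Cmod h ^ 2) * (1 + / z))%C = - (Cmod h ^ 2 * (Im z / (Re z * Re z + Im z * Im z)))).
  { transitivity (Cmod h ^ 2 * Im (/ z)%C); [cbn; unfold Re, Im; ring|].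
    rewrite Im_inv; unfold Rdiv; ring. }
  rewrite Ei in Hm.
  assert (0 < Cmod h ^ 2) by (apply pow_lt, Cmod_gt_0, Hh).
  assert (0 < Im z / (Re z * Re z + Im z * Im z)) by (apply Rdiv_lt_0_compat; nra).
  nra.
Qed.

Lemma ln_le_sub1 (y : R) : 0 < y -> ln y <= y - 1.
Proof.
intros H; assert (K := exp_ineq1_le (ln y)); rewrite exp_ln in K by exact H; lra.
Qed.

(* A solution in the upper half plane is sought as [w = r e^{it}] with
   [Im w = r sin t = b - t], so that [Re w + ln |w| = r cos t + ln r]. *)
Definition polar_radius (b t : R) : R := (b - t) / sin t.

(** As [t] tends to 0 the radius tends to infinity while [cos t >= 0], so the logarithm alone
    eventually exceeds [a]. The bound [t0] allows [t] to be placed to the left of the point given by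
    [polar_value_low]. *)
Lemma polar_value_high (a b t0 : R) : 0 < b -> 0 < t0 ->
  exists t, 0 < t < t0 /\ t < PI /\ t < b /\
    a < polar_radius b t * cos t + ln (polar_radius b t).
Proof.
intros Hb Ht0; assert (P := PI_RGT_0); assert (He := exp_pos (- a - 1)).
(* The four terms ensure, in this order, [t < t0], [cos t >= 0], [t < b], and a radius of at least
   [exp (a + 1)]. *)
set (t := Rmin (Rmin (t0 / 2) (PI / 2)) (Rmin (b / 2) (b / 2 * exp (- a - 1)))).
assert (B1 : t <= t0 / 2) by (eapply Rle_trans; [apply Rmin_l|apply Rmin_l]).
assert (B2 : t <= PI / 2) by (eapply Rle_trans; [apply Rmin_l|apply Rmin_r]).
assert (B3 : t <= b / 2) by (eapply Rle_trans; [apply Rmin_r|apply Rmin_l]).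
assert (B4 : t <= b / 2 * exp (- a - 1)) by (eapply Rle_trans; [apply Rmin_r|apply Rmin_r]).
assert (B0 : 0 < t) by (repeat apply Rmin_pos; try lra; apply Rmult_lt_0_compat; lra).
exists t; repeat split; try lra.
assert (Hs : 0 < sin t) by (apply sin_gt_0; lra).
assert (Hs2 : sin t < t) by (apply sin_lt_x; exact B0).
assert (Hr : exp (a + 1) <= polar_radius b t).
{ apply Rle_div_r; [exact Hs|].
  assert (Ee : exp (a + 1) * exp (- a - 1) = 1)
    by (rewrite <- exp_plus; replace (a + 1 + (- a - 1)) with 0 by ring; apply exp_0).
  assert (Hp := exp_pos (a + 1)).
  assert (exp (a + 1) * t <= b / 2).
  { apply Rle_trans with (exp (a + 1) * (b / 2 * exp (- a - 1))); [apply Rmult_le_compat_l; lra|].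
    replace (exp (a + 1) * (b / 2 * exp (- a - 1))) with (b / 2 * (exp (a + 1) * exp (- a - 1))) by ring.
    rewrite Ee; lra. }
  nra. }
assert (Hp := exp_pos (a + 1)).
assert (Hl : a + 1 <= ln (polar_radius b t)).
{ rewrite <- (ln_exp (a + 1)); apply ln_le; [exact Hp|exact Hr]. }
assert (Hc : 0 <= cos t) by (apply cos_ge_0; lra).
nra.
Qed.

(** What happens at the right end of the admissible range depends on [b]. At [b = PI] the radius
    tends to 1 and the value to -1, so [-1 < a] is what lets the value drop below [a]. *)
Lemma polar_value_low (a b : R) : 0 < b -> (b = PI -> -1 < a) ->
  exists t, 0 < t < PI /\ t < b /\
    polar_radius b t * cos t + ln (polar_radius b t) < a.
Proof.
intros Hb Hbp; assert (P := PI_RGT_0).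
destruct (Rtotal_order b PI) as [Hlt|[Heq|Hgt]].
- (* r -> 0 as t -> b *)
  assert (Hs : 0 < sin b) by (apply sin_gt_0; lra).
  assert (Hc : continuity_pt sin b) by apply derivable_continuous_pt, derivable_pt_sin.
  destruct (Hc (sin b / 2) ltac:(lra)) as [dl [Hdl Hd]].
  set (e := Rmin 1 (exp (a - 2))).
  assert (He : 0 < e) by (apply Rmin_pos; [lra|apply exp_pos]).
  set (v := Rmin (b / 2) (Rmin (dl / 2) (e * (sin b / 2)))).
  assert (V1 : v <= b / 2) by apply Rmin_l.
  assert (V2 : v <= dl / 2) by (eapply Rle_trans; [apply Rmin_r|apply Rmin_l]).
  assert (V3 : v <= e * (sin b / 2)) by (eapply Rle_trans; [apply Rmin_r|apply Rmin_r]).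
  assert (V0 : 0 < v) by (repeat apply Rmin_pos; try lra; apply Rmult_lt_0_compat; lra).
  exists (b - v); repeat split; try lra.
  assert (Hsv : sin b / 2 < sin (b - v)).
  { assert (K : Rabs (sin (b - v) - sin b) < sin b / 2).
    { apply (Hd (b - v)); split; [split; [exact I|lra]|].
      change (Rabs (b - v - b) < dl); replace (b - v - b) with (- v) by ring.
      rewrite Rabs_Ropp, Rabs_pos_eq; lra. }
    apply Rabs_lt_between in K; lra. }
  unfold polar_radius; replace (b - (b - v)) with v by ring.
  set (r := v / sin (b - v)).
  assert (R0 : 0 < r) by (apply Rdiv_lt_0_compat; lra).
  assert (R1 : r <= e).
  { apply Rle_div_l; [lra|nra]. }
  assert (E1 : e <= 1) by apply Rmin_l.
  assert (E2 : e <= exp (a - 2)) by apply Rmin_r.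
  assert (L : ln r <= a - 2).
  { rewrite <- (ln_exp (a - 2)); apply ln_le; lra. }
  assert (Cb := COS_bound (b - v)); nra.
- (* r -> 1 as t -> PI *)
  specialize (Hbp Heq); subst b.
  set (v := Rmin 1 ((1 + a) / 4)).
  assert (V1 : v <= 1) by apply Rmin_l.
  assert (V2 : v <= (1 + a) / 4) by apply Rmin_r.
  assert (V0 : 0 < v) by (apply Rmin_pos; lra).
  assert (P3 := PI2_3_2); assert (P4 := PI2_1); unfold PI2 in *.
  exists (PI - v); repeat split; try lra.
  unfold polar_radius; replace (PI - (PI - v)) with v by ring.
  replace (cos (PI - v)) with (- cos v)
    by (rewrite cos_minus, cos_PI, sin_PI; ring).
  rewrite sin_PI_x.
  assert (Hs : v / 2 <= sin v).
  { destruct (MVT_is_derive sin cos 0 v V0) as [c [Hc E]].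
    - intros; apply is_derive_sin.
    - rewrite sin_0 in E; assert (1 / 2 <= cos c) by (rewrite <- cos_PI3; apply cos_decr_1; lra); nra. }
  assert (Hc : 1 - cos v <= v * v / 2).
  { replace (cos v) with (cos (2 * (v / 2))) by (f_equal; field).
    rewrite cos_2a_sin.
    assert (S1 : 0 <= sin (v / 2)) by (apply sin_ge_0; lra).
    assert (S2 : sin (v / 2) < v / 2) by (apply sin_lt_x; lra).
    nra. }
  set (r := v / sin v).
  assert (R0 : 0 < r) by (apply Rdiv_lt_0_compat; lra).
  assert (R2 : r <= 2).
  { apply Rle_div_l; lra. }
  assert (L := ln_le_sub1 r R0).
  assert (Cb := COS_bound v).
  assert (r * (1 - cos v) <= 2 * (v * v / 2)) by (apply Rmult_le_compat; lra).
  nra.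
- (* r -> +oo and cos t -> -1 as t -> PI *)
  set (be := b - PI).
  set (M := 4 * (Rabs a + 4)).
  assert (HM : 0 < M) by (assert (K := Rabs_pos a); unfold M; lra).
  set (v := Rmin (PI / 3) (be / M)).
  assert (V1 : v <= PI / 3) by apply Rmin_l.
  assert (V2 : v <= be / M) by apply Rmin_r.
  assert (V0 : 0 < v) by (apply Rmin_pos; [lra|apply Rdiv_lt_0_compat; unfold be; lra]).
  exists (PI - v); repeat split; try lra.
  unfold polar_radius; replace (b - (PI - v)) with (be + v) by (unfold be; ring).
  replace (cos (PI - v)) with (- cos v)
    by (rewrite cos_minus, cos_PI, sin_PI; ring).
  rewrite sin_PI_x.
  assert (Hs : 0 < sin v) by (apply sin_gt_0; lra).
  assert (Hs2 : sin v < v) by (apply sin_lt_x; lra).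
  assert (Hc : 1 / 2 <= cos v).
  { rewrite <- cos_PI3; apply cos_decr_1; lra. }
  set (r := (be + v) / sin v).
  assert (R1 : M <= r).
  { apply (Rle_div_r M (be + v) (sin v)); [exact Hs|]; apply Rle_div_r in V2; [nra|exact HM]. }
  assert (L := ln_le_sub1 (r / 4) ltac:(lra)).
  assert (L4 : ln r = ln (r / 4) + ln 4) by (rewrite <- ln_mult by lra; f_equal; field).
  assert (L5 := ln_le_sub1 4 ltac:(lra)).
  assert (Ha := Rle_abs (- a)); rewrite Rabs_Ropp in Ha.
  assert (r * (1 / 2) <= r * cos v) by (apply Rmult_le_compat_l; lra).
  unfold M in R1; lra.
Qed.

Lemma w_plus_log_upper_exists (a b : R) : 0 < b -> (b = PI -> -1 < a) ->
  exists w : C, 0 < Im w /\ (w + Clog w)%C = (a, b).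
Proof.
intros Hb Hbp.
destruct (polar_value_low a b Hb Hbp) as (t2 & H1 & H2 & H3).
destruct (polar_value_high a b t2 Hb (proj1 H1)) as (t1 & K1 & K2 & K3 & K4).
destruct (Ranalysis5.IVT_interv
  (fun t => a - (polar_radius b t * cos t + ln (polar_radius b t))) t1 t2) as [t [Ht E]]; try lra.
- intros t Ht.
  assert (Hs : 0 < sin t) by (apply sin_gt_0; lra).
  apply ex_derive_continuity_pt.
  unfold polar_radius; auto_derive; repeat split; try lra.
  apply Rdiv_lt_0_compat; lra.
- assert (Hs : 0 < sin t) by (apply sin_gt_0; lra).
  assert (P := PI_RGT_0).
  assert (Hr : 0 < polar_radius b t) by (apply Rdiv_lt_0_compat; lra).
  assert (Hm : polar_radius b t * sin t = b - t) by (unfold polar_radius; field; lra).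
  exists (polar_radius b t * cos t, polar_radius b t * sin t); split; [cbn; lra|].
  rewrite Clog_polar by lra; apply C_ext; cbn; lra.
Qed.

Lemma w_plus_log_real_exists (a : R) : exists u, 0 < u /\ u + ln u = a.
Proof.
set (u1 := Rmin 1 (exp (a - 2))); set (u2 := Rmax 2 (a + 2)).
assert (P := exp_pos (a - 2)).
assert (A1 : u1 <= 1) by apply Rmin_l; assert (A2 : u1 <= exp (a - 2)) by apply Rmin_r.
assert (A0 : 0 < u1) by (apply Rmin_pos; lra).
assert (B1 : 2 <= u2) by apply Rmax_l; assert (B2 : a + 2 <= u2) by apply Rmax_r.
destruct (Ranalysis5.IVT_interv (fun u => u + ln u - a) u1 u2) as [u [Hu E]].
- intros u Hu.
  apply ex_derive_continuity_pt.
  auto_derive; lra.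
- lra.
- assert (ln u1 <= a - 2) by (rewrite <- (ln_exp (a - 2)); apply ln_le; lra); lra.
- assert (0 < ln u2) by (rewrite <- ln_1; apply ln_increasing; lra); lra.
- exists u; split; lra.
Qed.

(** A negative real [w] of modulus [r] yields imaginary part [PI] and real part [ln r - r <= -1];
    the hypothesis rules this out. The sign of [b] then determines the sign of [Im w]: [b > 0] is
    the case of the upper half plane, [b < 0] reduces to it by conjugation, and [b = 0] leaves the
    increasing function [u + ln u] on the positive reals. *)
Theorem w_plus_log_exists_unique (a b : R) : (Rabs b = PI -> -1 < a) ->
  exists w : C, (w <> 0%C /\ (w + Clog w)%C = (a, b)) /\
    forall w' : C, w' <> 0%C -> (w' + Clog w')%C = (a, b) -> w' = w.
Proof.
assert (P := PI_RGT_0).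
assert (Sign : forall w : C, w <> 0%C -> forall a b, (w + Clog w)%C = (a, b) ->
  (b = PI -> -1 < a) -> 0 < b -> 0 < Im w).
{ clear; intros w Hw a b E Hbp Hb.
  assert (Ei := f_equal Im E); assert (Er := f_equal Re E).
  change (Im w + Im (Clog w) = b) in Ei; change (Re w + Re (Clog w) = a) in Er.
  destruct (Rtotal_order (Im w) 0) as [K|[K|K]]; [|exfalso|exact K].
  - apply Im_Clog_lower in K as K'; lra.
  - destruct (Clog_real w Hw K) as [[Hp L]|[Hp L]]; rewrite L in Ei, Er.
    + change (Im w + 0 = b) in Ei; lra.
    + change (Im w + PI = b) in Ei; change (Re w + ln (- Re w) = a) in Er.
      assert (L1 := ln_le_sub1 (- Re w) ltac:(lra)); specialize (Hbp ltac:(lra)); lra. }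
assert (Up : forall a b, 0 < b -> (b = PI -> -1 < a) ->
  exists w : C, (w <> 0%C /\ 0 < Im w /\ (w + Clog w)%C = (a, b)) /\
    forall w' : C, w' <> 0%C -> (w' + Clog w')%C = (a, b) -> w' = w).
{ clear - Sign; intros a b Hb Hbp; destruct (w_plus_log_upper_exists a b Hb Hbp) as [w [H1 H2]].
  exists w; split; [split; [intros ->; cbn in H1; lra|auto]|].
  intros w' H3 H4; apply w_plus_log_upper_inj; [|exact H1|congruence].
  exact (Sign w' H3 a b H4 Hbp Hb). }
assert (Cj : forall w : C, Cconj (Cconj w) = w).
{ intros w; apply C_ext; cbn; unfold Re, Im; cbn; ring. }
assert (Cj0 : forall w : C, w <> 0%C -> Cconj w <> 0%C).
{ intros w H E; apply H; rewrite <- (Cj w), E; apply C_ext; cbn; lra. }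
assert (Cje : forall (w : C) a b, Im w <> 0 -> (w + Clog w)%C = (a, b) -> (Cconj w + Clog (Cconj w))%C = (a, - b)).
{ intros w x y Hw E; rewrite Clog_conj by exact Hw.
  assert (Ei := f_equal Im E); assert (Er := f_equal Re E).
  apply C_ext; cbn in *; lra. }
intros Hab; destruct (Rtotal_order b 0) as [Hb|[Hb|Hb]].
- destruct (Up a (- b)) as [w [[H1 [H2 H3]] H4]]; [lra| |].
  { intros E; apply Hab; rewrite Rabs_left; lra. }
  exists (Cconj w); split; [split; [auto|]|].
  + rewrite (Cje w a (- b)); [f_equal; ring|lra|exact H3].
  + intros w' K1 K2.
    assert (Im w' < 0).
    { assert (Ei := f_equal Im K2); change (Im w' + Im (Clog w') = b) in Ei.
      destruct (Rtotal_order (Im w') 0) as [K|[K|K]]; [exact K|exfalso|exfalso].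
      - destruct (Clog_real w' K1 K) as [[_ L]|[_ L]]; rewrite L in Ei;
          [change (Im w' + 0 = b) in Ei|change (Im w' + PI = b) in Ei]; lra.
      - apply Im_Clog_upper in K as K'; lra. }
    rewrite <- (Cj w'); f_equal; apply H4; [auto|].
    apply Cje; [lra|exact K2].
- subst b; destruct (w_plus_log_real_exists a) as [u [Hu E]].
  exists (RtoC u); split; [split|].
  + intros K; apply (f_equal Re) in K; cbn in K; lra.
  + rewrite Clog_pos by exact Hu; apply C_ext; cbn; lra.
  + intros w' K1 K2.
    assert (Ei := f_equal Im K2); assert (Er := f_equal Re K2).
    change (Im w' + Im (Clog w') = 0) in Ei; change (Re w' + Re (Clog w') = a) in Er.
    destruct (Rtotal_order (Im w') 0) as [K|[K|K]].
    * apply Im_Clog_lower in K as K'; lra.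
    * rewrite (real_eq w' K); f_equal.
      destruct (Clog_real w' K1 K) as [[Hp L]|[_ L]]; rewrite L in Ei, Er.
      -- change (Re w' + ln (Re w') = a) in Er.
         clear L; destruct (Rtotal_order (Re w') u) as [L|[L|L]]; [|exact L|].
         ++ assert (L2 := ln_increasing _ _ Hp L); lra.
         ++ assert (L2 := ln_increasing _ _ Hu L); lra.
      -- change (Im w' + PI = 0) in Ei; lra.
    * apply Im_Clog_upper in K as K'; lra.
- destruct (Up a b Hb) as [w [[H1 [H2 H3]] H4]].
  + intros E; apply Hab; rewrite Rabs_pos_eq; lra.
  + exists w; auto.
Qed.

(** * The branches of the Lambert function *)

Lemma xexp_increasing (u v : R) : -1 <= u -> u < v -> u * exp u < v * exp v.
Proof.
intros Hu Huv; replace v with (u + (v - u)) at 2 by ring; rewrite exp_plus.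
set (d := v - u); assert (P := exp_pos u).
assert (K : u < v * exp d); [|nra].
assert (D := exp_ineq1_le d); assert (Hd : 0 < d) by (unfold d; lra).
destruct (Rle_dec 0 v) as [Hv|Hv]; [nra|].
assert (D' := exp_ineq1 (- d) ltac:(lra)); rewrite exp_Ropp in D'.
assert (Pd := exp_pos d).
assert (E : (1 + - d) * exp d < 1).
{ apply (Rmult_lt_compat_r (exp d)) in D'; [|exact Pd]; rewrite Rinv_l in D' by lra; exact D'. }
unfold d in *; nra.
Qed.

Lemma xexp_decreasing (u v : R) : v <= -1 -> u < v -> v * exp v < u * exp u.
Proof.
intros Hu Huv; replace v with (u + (v - u)) at 2 by ring; rewrite exp_plus.
set (d := v - u); assert (P := exp_pos u).
assert (D := exp_ineq1 d ltac:(unfold d; lra)).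
assert (K : v * exp d < u); [|nra].
unfold d in *; nra.
Qed.

Lemma xexp_continuity (y : R) : continuity (fun u => u * exp u - y).
Proof.
intros u; apply ex_derive_continuity_pt; auto_derive; auto.
Qed.

Lemma xexp_branches (y : R) : - / exp 1 <= y < 0 ->
  (exists u, u <= -1 /\ u * exp u = y) /\ (exists u, -1 <= u < 0 /\ u * exp u = y).
Proof.
intros [H1 H2].
assert (Em : -1 * exp (-1) <= y).
{ replace (-1 * exp (-1)) with (- / exp 1); [exact H1|].
  rewrite <- exp_Ropp; replace (- (1)) with (-1) by ring; ring. }
split.
(* With [y = - e^(-L)], the left end [-2 L] of the interval works because [2 L <= e^L] makes
   [-2 L e^(-2 L)] at least [- e^(-L)]. *)
- set (L := - ln (- y)).
  assert (Ey : exp (- L) = - y) by (unfold L; rewrite Ropp_involutive, exp_ln; lra).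
  assert (HL : 1 <= L).
  { apply Rnot_lt_le; intros K; assert (K2 := exp_increasing (-1) (- L) ltac:(lra)); lra. }
  assert (E2 : 2 * L <= exp L).
  { assert (K := exp_ineq1_le (L - 1)); assert (K1 := exp_ineq1_le 1).
    replace L with (1 + (L - 1)) at 2 by ring; rewrite exp_plus; nra. }
  destruct (IVT_cor (fun u => u * exp u - y) (-2 * L) (-1) (xexp_continuity y)) as [u [Hu E]].
  + lra.
  + assert (K : 0 <= -2 * L * exp (-2 * L) - y); [|nra].
    replace (-2 * L) with (- L + - L) at 2 by ring; rewrite exp_plus.
    assert (exp L * exp (- L) = 1) by (rewrite <- exp_plus, Rplus_opp_r; apply exp_0).
    assert (P := exp_pos (- L)).
    assert (2 * L * exp (- L) <= 1) by nra.
    nra.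
  + exists u; split; lra.
- destruct (IVT_cor (fun u => u * exp u - y) (-1) 0 (xexp_continuity y)) as [u [Hu E]].
  + lra.
  + rewrite Rmult_0_l; nra.
  + exists u; split; [|lra]; split; [lra|].
    destruct (Req_dec u 0) as [->|]; [rewrite Rmult_0_l in E|]; lra.
Qed.

Lemma IZR_2PI_small (k : Z) (t : R) : -2 * PI < t < 2 * PI -> t = 2 * IZR k * PI -> k = 0%Z.
Proof.
intros H E; assert (P := PI_RGT_0).
assert (H1 : -1 < IZR k < 1) by (split; apply (Rmult_lt_reg_r (2 * PI)); nra).
destruct H1 as [H1 H2]; apply lt_IZR in H1, H2; lia.
Qed.

Lemma Cexp_2PI (k : Z) : Cexp (2 * RtoC (IZR k) * RtoC PI * Ci) = 1%C.
Proof.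
assert (G : forall n : nat, cos (2 * INR n * PI) = 1 /\ sin (2 * INR n * PI) = 0).
{ intros n; split.
  - rewrite <- (Rplus_0_l (2 * INR n * PI)), cos_period; apply cos_0.
  - rewrite <- (Rplus_0_l (2 * INR n * PI)), sin_period; apply sin_0. }
replace (2 * RtoC (IZR k) * RtoC PI * Ci)%C with (0, 2 * IZR k * PI) by (apply C_ext; cbn; ring).
unfold Cexp, Re, Im; cbn [fst snd]; rewrite exp_0, !Rmult_1_l.
destruct (Z_le_gt_dec 0 k) as [Hk|Hk].
- rewrite <- (Z2Nat.id k Hk), <- INR_IZR_INZ; destruct (G (Z.to_nat k)) as [-> ->]; reflexivity.
- replace (2 * IZR k * PI) with (- (2 * INR (Z.to_nat (- k)) * PI)).
  + destruct (G (Z.to_nat (- k))) as [E1 E2]; rewrite cos_neg, sin_neg, E1, E2, Ropp_0; reflexivity.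
  + rewrite INR_IZR_INZ, Z2Nat.id, opp_IZR by lia; ring.
Qed.

Lemma slit_Clog (z : C) : slit z -> Re (Clog z) <= -1 /\ Im (Clog z) = PI.
Proof.
intros [H1 H2]; rewrite (real_eq z H1), Clog_neg by lra; cbn; split; [|reflexivity].
fold (Re z); rewrite <- (ln_exp (-1)); apply ln_le; [lra|].
rewrite <- (exp_Ropp 1) in H2; replace (-1) with (- (1)) by ring; lra.
Qed.

Lemma Clog_slit (z : C) : z <> 0%C -> Im (Clog z) = PI -> Re (Clog z) <= -1 -> slit z.
Proof.
intros H0 H1 H2; apply Im_Clog_le_PI_real in H1; [|exact H0].
destruct H1 as [H1 H3]; split; [exact H1|]; split; [|exact H3].
rewrite (real_eq z H1), Clog_neg in H2 by exact H3; cbn in H2; fold (Re z) in H2.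
assert (K : exp (ln (- Re z)) <= exp (-1)).
{ destruct H2 as [H2|H2]; [left; apply exp_increasing, H2|rewrite H2; right; reflexivity]. }
rewrite exp_ln in K by lra; rewrite <- exp_Ropp; replace (- (1)) with (-1) by ring; lra.
Qed.

Lemma slit_branch (x : R) (w : C) : Im w = 0 -> (w * Cexp w)%C = RtoC x -> Re w * exp (Re w) = x.
Proof.
intros H E; rewrite (real_eq w H), Cexp_RtoC in E; apply (f_equal Re) in E; cbn in E; lra.
Qed.

Lemma is_LambertW_log (k : Z) (z w : C) :
  ~ slit z \/ (k <> 0%Z /\ k <> (-1)%Z) -> w <> 0%C ->
  (w + Clog w)%C = (Clog z + 2 * RtoC (IZR k) * RtoC PI * Ci)%C -> is_LambertW k z w.
Proof.
intros H Hw E; split; [auto|]; split; intros; exfalso; destruct H as [|[]]; congruence.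
Qed.

Lemma is_LambertW_0 (z w : C) : slit z ->
  Im w = 0 -> (w * Cexp w)%C = z -> -1 <= Re w -> is_LambertW 0 z w.
Proof. intros S; split; [intros [|[]]; [contradiction|congruence]|split; [congruence|auto]]. Qed.

Lemma is_LambertW_minus_1 (z w : C) : slit z ->
  Im w = 0 -> (w * Cexp w)%C = z -> Re w <= -1 -> is_LambertW (-1) z w.
Proof. intros S; split; [intros [|[]]; [contradiction|congruence]|split; [auto|congruence]]. Qed.

Lemma Im_branch (k : Z) (c w : C) : (w + Clog w)%C = (c + 2 * RtoC (IZR k) * RtoC PI * Ci)%C ->
  Im w + Im (Clog w) = Im c + 2 * IZR k * PI.
Proof.
intros E; change (Im (w + Clog w)%C = Im c + 2 * IZR k * PI); rewrite E; cbn; unfold Re, Im; ring.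
Qed.

(** Since [Im (Clog z)] lies in []-PI, PI]], the right-hand side can have imaginary part [PI] or
    [- PI] only for [k = 0] or [k = -1]; so the exceptional case of [w_plus_log_exists_unique] is
    exactly the slit with these two indices. There the monotonicity of [u e^u] on either side of -1
    takes over. *)
Theorem is_LambertW_exists_unique (k : Z) (z : C) : z <> 0%C ->
  exists w, is_LambertW k z w /\ forall w', is_LambertW k z w' -> w' = w.
Proof.
intros Hz; assert (P := PI_RGT_0).
destruct (classic (~ slit z \/ (k <> 0%Z /\ k <> (-1)%Z))) as [Hc|Hc].
- destruct (w_plus_log_exists_unique (Re (Clog z)) (Im (Clog z) + 2 * IZR k * PI)) as [w [[H1 H2] H3]].
  + intros E; apply Rnot_le_lt; intros K.
    assert (B := Im_Clog_bound z Hz).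
    assert (E' : Im (Clog z) = PI /\ (k = 0%Z \/ k = (-1)%Z)).
    { unfold Rabs in E; destruct (Rcase_abs _) as [R|R].
      - assert (Hk : (k + 1)%Z = 0%Z).
        { apply (IZR_2PI_small _ (PI - Im (Clog z))); [lra|rewrite plus_IZR; lra]. }
        assert (Hk' : k = (-1)%Z) by lia; subst k; split; [lra|auto].
      - assert (Hk : k = 0%Z).
        { apply (IZR_2PI_small _ (PI - Im (Clog z))); lra. }
        subst k; split; [lra|auto]. }
    destruct E' as [E1 E2]; assert (S := Clog_slit z Hz E1 K); destruct E2; tauto.
  + assert (Eq : (Re (Clog z), Im (Clog z) + 2 * IZR k * PI) =
      (Clog z + 2 * RtoC (IZR k) * RtoC PI * Ci)%C).
    { apply C_ext; cbn; ring. }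
    exists w; split.
    * apply is_LambertW_log; [exact Hc|exact H1|rewrite H2; exact Eq].
    * intros w' [K _]; destruct (K Hc) as [K1 K2]; apply H3; [exact K1|].
      rewrite K2; symmetry; exact Eq.
- apply not_or_and in Hc; destruct Hc as [S Hk]; apply NNPP in S.
  assert (S' := S); destruct S' as [S1 S2].
  assert (Ez := real_eq z S1).
  destruct (xexp_branches (Re z) S2) as [[u [U1 U2]] [v [V1 V2]]].
  assert (Hr : forall t, t * exp t = Re z -> (RtoC t * Cexp (RtoC t))%C = z).
  { intros t Ht; rewrite Cexp_RtoC, Ez, <- Ht; apply C_ext; cbn; ring. }
  apply not_and_or in Hk; destruct Hk as [Hk|Hk]; apply NNPP in Hk; subst k.
  + exists (RtoC v); split.
    * apply is_LambertW_0; [exact S|reflexivity|apply Hr, V2|apply V1].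
    * intros w' (_ & _ & K); destruct (K S eq_refl) as (K1 & K2 & K3).
      rewrite Ez in K2; apply slit_branch in K2; [|exact K1].
      rewrite (real_eq w' K1); f_equal.
      destruct (Rtotal_order (Re w') v) as [L|[L|L]]; [exfalso|exact L|exfalso].
      -- apply xexp_increasing in L; [lra|exact K3].
      -- apply xexp_increasing in L; lra.
  + exists (RtoC u); split.
    * apply is_LambertW_minus_1; [exact S|reflexivity|apply Hr, U2|exact U1].
    * intros w' (_ & K & _); destruct (K S eq_refl) as (K1 & K2 & K3).
      rewrite Ez in K2; apply slit_branch in K2; [|exact K1].
      rewrite (real_eq w' K1); f_equal.
      destruct (Rtotal_order (Re w') u) as [L|[L|L]]; [exfalso|exact L|exfalso].
      -- apply xexp_decreasing in L; lra.
      -- apply xexp_decreasing in L; lra.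
Qed.

Lemma LambertW_spec (k : Z) (z : C) : z <> 0%C -> is_LambertW k z (LambertW k z).
Proof.
intros H; destruct (is_LambertW_exists_unique k z H) as [w [H1 H2]].
rewrite (LambertW_unique k z w H1 H2); exact H1.
Qed.

Lemma LambertW_eq (k : Z) (z w : C) : z <> 0%C -> is_LambertW k z w -> w = LambertW k z.
Proof.
intros H Hw; destruct (is_LambertW_exists_unique k z H) as [w' [H1 H2]].
rewrite (LambertW_unique k z w' H1 H2); apply H2, Hw.
Qed.

Lemma LambertW_cases (k : Z) (z : C) : z <> 0%C -> let w := LambertW k z in
  (w <> 0%C /\ (w + Clog w)%C = (Clog z + 2 * RtoC (IZR k) * RtoC PI * Ci)%C) \/
  (slit z /\ Im w = 0 /\ Re w < 0 /\ (w * Cexp w)%C = z /\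
    ((k = 0%Z /\ -1 <= Re w) \/ (k = (-1)%Z /\ Re w <= -1))).
Proof.
intros Hz w; assert (H := LambertW_spec k z Hz); fold w in H; destruct H as (H1 & H2 & H3).
destruct (classic (~ slit z \/ (k <> 0%Z /\ k <> (-1)%Z))) as [Hc|Hc]; [left; auto|right].
apply not_or_and in Hc; destruct Hc as [S Hk]; apply NNPP in S.
assert (Hn : Im w = 0 -> (w * Cexp w)%C = z -> Re w < 0).
{ intros K1 K2; destruct S as [S1 S2]; rewrite (real_eq z S1) in K2.
  apply slit_branch in K2; [|exact K1]; assert (P := exp_pos (Re w)); nra. }
apply not_and_or in Hk; destruct Hk as [Hk|Hk]; apply NNPP in Hk.
- destruct (H3 S Hk) as (K1 & K2 & K3); auto 10.
- destruct (H2 S Hk) as (K1 & K2 & K3); auto 10.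
Qed.

Lemma LambertW_root (k : Z) (z : C) : z <> 0%C ->
  (LambertW k z * Cexp (LambertW k z))%C = z.
Proof.
intros Hz; destruct (LambertW_cases k z Hz) as [[H1 H2]|(_ & _ & _ & H & _)]; [|exact H].
set (w := LambertW k z) in *.
rewrite <- (Cexp_Clog w H1) at 1; rewrite <- Cexp_plus.
replace (Clog w + w)%C with (w + Clog w)%C by ring.
rewrite H2, Cexp_plus, Cexp_2PI, Cexp_Clog by exact Hz; ring.
Qed.

Lemma vcosv_lt_sin (v : R) : 0 < v < PI -> v * cos v < sin v.
Proof.
intros H; destruct (MVT_is_derive (fun v => sin v - v * cos v) (fun v => v * sin v) 0 v) as [c [Hc E]].
- lra.
- intros t _; auto_derive; [auto|ring].
- rewrite sin_0 in E; assert (S := sin_gt_0 c ltac:(lra) ltac:(lra)).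
  assert (0 < c * sin c * (v - 0)) by (repeat apply Rmult_lt_0_compat; lra); lra.
Qed.

(** Serves to show that over the slit a root whose logarithmic index is 0 or -1 must be real; the
    lower half plane is covered by conjugation. *)
Lemma w_plus_log_upper_PI (w : C) : 0 < Im w -> Im (w + Clog w) = PI -> -1 < Re (w + Clog w).
Proof.
intros H E.
assert (Hw : w <> 0%C) by (intros ->; cbn in H; lra).
assert (B := Im_Clog_upper w H).
destruct (exp_Re_Clog w Hw) as [E1 E2].
change (Im w + Im (Clog w) = PI) in E; change (-1 < Re w + Re (Clog w)).
set (v := Im w) in *; set (l := Re (Clog w)) in *.
replace (Im (Clog w)) with (PI - v) in * by lra.
replace (cos (PI - v)) with (- cos v) in E1 by (rewrite cos_minus, cos_PI, sin_PI; ring).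
rewrite sin_PI_x in E2.
assert (Hv : 0 < v < PI) by lra.
assert (S1 := sin_lt_x v H); assert (S2 := vcosv_lt_sin v Hv).
assert (S0 : 0 < sin v) by (apply sin_gt_0; lra).
(* l >= 1 - e^{-l} with e^{-l} = sin v / v < 1, and e^l cos v = v cot v < 1 *)
assert (P := exp_pos l); assert (K := exp_ineq1_le (- l)).
assert (Pl : exp l * exp (- l) = 1) by (rewrite <- exp_plus, Rplus_opp_r; apply exp_0).
assert (A1 : exp l * cos v < 1).
{ apply (Rmult_lt_reg_r (sin v)); [exact S0|].
  replace (exp l * cos v * sin v) with ((exp l * sin v) * cos v) by ring; rewrite <- E2; lra. }
assert (A2 : exp (- l) < 1).
{ apply (Rmult_lt_reg_l (exp l)); [exact P|]; rewrite Pl, Rmult_1_r.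
  apply Rnot_le_lt; intros L; nra. }
lra.
Qed.

(** Rounding the imaginary part of [w + Clog w] determines an index [k], and outside the exceptional
    case this is the branch. Over the slit with [k] equal to 0 or -1, [w] is real by
    [w_plus_log_upper_PI], and the branch is read off from its position relative to -1, not from
    [k]. *)
Theorem LambertW_surj (z w : C) : z <> 0%C -> (w * Cexp w)%C = z -> exists k, w = LambertW k z.
Proof.
intros Hz E; assert (P := PI_RGT_0).
assert (Hw : w <> 0%C) by (intros ->; apply Hz; rewrite <- E; ring).
(* [Im (w + Clog w) - 2 k PI] equals [PI - 2 PI (r + 1 - up r)], and [r + 1 - up r] lies in [[0,
   1[]; so this [k] lands in []-PI, PI]], with the correct end closed. *)
set (r := (PI - Im (w + Clog w)%C) / (2 * PI)).
set (k := (1 - up r)%Z).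
assert (A := archimed r).
assert (Er : Im (w + Clog w)%C = PI - r * (2 * PI)) by (unfold r; field; lra).
assert (Hk : (w + Clog w)%C = (Clog z + 2 * RtoC (IZR k) * RtoC PI * Ci)%C).
{ assert (C1 : (w + Clog w - 2 * RtoC (IZR k) * RtoC PI * Ci)%C = Clog z).
  { apply Clog_unique.
    - replace (w + Clog w - 2 * RtoC (IZR k) * RtoC PI * Ci)%C
        with (Clog w + w + 2 * RtoC (IZR (- k)) * RtoC PI * Ci)%C
        by (rewrite opp_IZR, RtoC_opp; ring).
      rewrite Cexp_plus, Cexp_2PI, Cexp_plus, Cexp_Clog by exact Hw; rewrite E; ring.
    - replace (Im (w + Clog w - 2 * RtoC (IZR k) * RtoC PI * Ci)%C)
        with (Im (w + Clog w)%C - 2 * IZR k * PI) by (cbn; unfold Re, Im; ring).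
      rewrite Er; unfold k; rewrite minus_IZR; nra. }
  rewrite <- C1; ring. }
destruct (classic (~ slit z \/ (k <> 0%Z /\ k <> (-1)%Z))) as [Hc|Hc].
{ exists k; apply LambertW_eq; [exact Hz|apply is_LambertW_log; assumption]. }
apply not_or_and in Hc; destruct Hc as [S Hk']; apply NNPP in S.
destruct (slit_Clog z S) as [L1 L2].
assert (R0 : Im w = 0).
{ assert (Ei := Im_branch _ _ _ Hk); rewrite L2 in Ei.
  assert (Ere : Re (w + Clog w)%C = Re (Clog z)) by (rewrite Hk; cbn; unfold Re, Im; ring).
  destruct (Rtotal_order (Im w) 0) as [K|[K|K]]; [exfalso|exact K|exfalso].
  - assert (B := Im_Clog_lower w K).
    assert (K' : 0 < Im (Cconj w)) by (cbn; unfold Im in K; lra).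
    assert (W := w_plus_log_upper_PI (Cconj w) K').
    rewrite Clog_conj in W by lra.
    replace (Cconj w + Cconj (Clog w))%C with (Cconj (w + Clog w)) in W
      by (apply C_ext; cbn; unfold Re, Im; cbn; ring).
    change (- Im (w + Clog w)%C = PI -> -1 < Re (w + Clog w)%C) in W.
    apply not_and_or in Hk'; destruct Hk' as [Hk'|Hk']; apply NNPP in Hk';
      rewrite Hk' in Ei.
    + lra.
    + change (- (Im w + Im (Clog w)) = PI -> -1 < Re (w + Clog w)%C) in W; specialize (W ltac:(lra)); lra.
  - assert (B := Im_Clog_upper w K).
    assert (W := w_plus_log_upper_PI w K).
    apply not_and_or in Hk'; destruct Hk' as [Hk'|Hk']; apply NNPP in Hk';
      rewrite Hk' in Ei.
    + change (Im w + Im (Clog w) = PI -> -1 < Re (w + Clog w)%C) in W; specialize (W ltac:(lra)); lra.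
    + lra. }
destruct (Rle_dec (-1) (Re w)) as [Hr|Hr].
- exists 0%Z; apply LambertW_eq; [exact Hz|apply is_LambertW_0; assumption].
- exists (-1)%Z; apply LambertW_eq; [exact Hz|apply is_LambertW_minus_1; auto; lra].
Qed.

Lemma LambertW_inj (j k : Z) (z : C) : z <> 0%C -> LambertW j z = LambertW k z ->
  j = k \/ LambertW j z = RtoC (-1).
Proof.
intros Hz E; assert (P := PI_RGT_0).
(* Over the slit, a negative real solution of the logarithmic equation has imaginary part [PI] on
   the left and [PI + 2 j PI] on the right, which forces [j = 0]. *)
assert (X : forall j k, LambertW j z = LambertW k z ->
  (LambertW j z <> 0%C /\ (LambertW j z + Clog (LambertW j z))%C = (Clog z + 2 * RtoC (IZR j) * RtoC PI * Ci)%C) ->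
  slit z -> Im (LambertW j z) = 0 -> Re (LambertW j z) < 0 -> j = 0%Z).
{ clear - P; intros j k E [H1 H2] S H3 H4.
  destruct (slit_Clog z S) as [L1 L2].
  apply Im_branch in H2; rewrite L2, H3 in H2.
  destruct (Clog_real _ H1 H3) as [[K _]|[_ K]]; [lra|].
  rewrite K in H2; change (0 + PI = PI + 2 * IZR j * PI) in H2.
  apply (IZR_2PI_small j 0); lra. }
assert (Sp : forall k, slit z -> Im (LambertW k z) = 0 -> Re (LambertW k z) < 0 ->
  (k = 0%Z /\ -1 <= Re (LambertW k z)) \/ (k = (-1)%Z /\ Re (LambertW k z) <= -1)).
{ clear - Hz X; intros k S H1 H2.
  destruct (LambertW_spec k z Hz) as (K1 & K2 & K3).
  destruct (classic (k = 0%Z)) as [->|N0]; [left; split; [reflexivity|apply K3; auto]|].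
  destruct (classic (k = (-1)%Z)) as [->|N1]; [right; split; [reflexivity|apply K2; auto]|].
  exfalso; apply N0, (X k k); auto. }
destruct (LambertW_cases j z Hz) as [[H1 H2]|(S & H1 & H2 & H3 & H4)].
- destruct (LambertW_cases k z Hz) as [[K1 K2]|(S & K1 & K2 & K3 & K4)].
  + left; rewrite E in H2; rewrite H2 in K2; apply (f_equal Im) in K2.
    assert (K : (j - k)%Z = 0%Z).
    { apply (IZR_2PI_small _ 0); [lra|]; rewrite minus_IZR; cbn in K2; lra. }
    lia.
  + rewrite <- E in K1, K2, K4.
    destruct (Sp j S K1 K2) as [[S1 S2]|[S1 S2]]; destruct K4 as [[K4 K5]|[K4 K5]];
      subst; auto; right; rewrite (real_eq _ K1); f_equal; lra.
- destruct (Sp k S ltac:(congruence) ltac:(congruence)) as [[S1 S2]|[S1 S2]];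
    rewrite <- E in S2; destruct H4 as [[K4 K5]|[K4 K5]];
    subst; auto; right; rewrite (real_eq _ H1); f_equal; lra.
Qed.

(** For [x = -1/e] the point -1 is a double zero of [w e^w - x]; that it is taken by exactly two
    indices matches this multiplicity. *)
Lemma LambertW_minus_1 (j : Z) (z : C) : z <> 0%C -> LambertW j z = RtoC (-1) ->
  (j = 0%Z \/ j = (-1)%Z) /\ LambertW 0 z = RtoC (-1) /\ LambertW (-1) z = RtoC (-1).
Proof.
intros Hz E; assert (P := PI_RGT_0).
assert (R := LambertW_root j z Hz); rewrite E in R.
assert (Ez : z = RtoC (- / exp 1)).
{ rewrite <- R, Cexp_RtoC, <- RtoC_mult; f_equal.
  rewrite <- exp_Ropp; replace (- (1)) with (-1) by ring; ring. }
assert (S : slit z).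
{ rewrite Ez; split; [reflexivity|]; cbn; assert (H := Rinv_0_lt_compat _ (exp_pos 1)); lra. }
assert (W0 : LambertW 0 z = RtoC (-1)).
{ symmetry; apply LambertW_eq; [exact Hz|].
  apply is_LambertW_0; [exact S|reflexivity|exact R|cbn; lra]. }
assert (W1 : LambertW (-1) z = RtoC (-1)).
{ symmetry; apply LambertW_eq; [exact Hz|].
  apply is_LambertW_minus_1; [exact S|reflexivity|exact R|cbn; lra]. }
split; [|auto].
destruct (LambertW_cases j z Hz) as [[H1 H2]|(_ & _ & _ & _ & [[H _]|[H _]])]; auto.
left; apply Im_branch in H2; rewrite E, Clog_neg in H2 by lra.
destruct (slit_Clog z S) as [_ L].
rewrite L in H2; cbn in H2; apply (IZR_2PI_small j 0); lra.
Qed.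

(** * The sum over the branches as a contour integral *)

Lemma cderiv_increment_bound (g g' : R -> C) (M : R) :
  (forall t, 0 <= t <= 1 -> cderiv g t (g' t)) ->
  (forall t, 0 <= t <= 1 -> Cmod (g' t) <= M) -> Cmod (g 1 - g 0) <= 2 * M.
Proof.
intros Hd Hb.
assert (G : forall p p' : R -> R, (forall t, 0 <= t <= 1 -> is_derive p t (p' t)) ->
  (forall t, 0 <= t <= 1 -> Rabs (p' t) <= M) -> Rabs (p 1 - p 0) <= M).
{ intros p p' H1 H2; destruct (MVT_is_derive p p' 0 1 Rlt_0_1 H1) as [c [Hc E]].
  rewrite E, Rminus_0_r, Rmult_1_r; apply H2; lra. }
assert (G1 : Rabs (Re (g 1 - g 0)%C) <= M).
{ apply (G (fun t => Re (g t)) (fun t => Re (g' t))); [apply Hd|].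
  intros t Ht; eapply Rle_trans; [apply re_le_Cmod|auto]. }
assert (G2 : Rabs (Im (g 1 - g 0)%C) <= M).
{ apply (G (fun t => Im (g t)) (fun t => Im (g' t))); [apply Hd|].
  intros t Ht; eapply Rle_trans; [apply Im_le_Cmod|auto]. }
eapply Rle_trans; [apply Cmod_le_Re_Im|lra].
Qed.

(** Integrating the derivative along the ray from 0 gains one power of [Cmod p]; iterated, this
    gives the Taylor remainders of the exponential without power series. The factor 2 comes from
    [cderiv_increment_bound]. *)
Lemma HD_growth (f f' : C -> C) (M : R) (n : nat) :
  (forall p, HD f p (f' p)) -> f 0%C = 0%C -> 0 <= M ->
  (forall p, Cmod p <= 1 -> Cmod (f' p) <= M * Cmod p ^ n) ->
  forall p, Cmod p <= 1 -> Cmod (f p) <= 2 * M * Cmod p ^ (S n).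
Proof.
intros Hd H0 HM Hb p Hp.
assert (P := Cmod_ge_0 p).
assert (K := cderiv_increment_bound (fun t => f (0 + RtoC t * p))%C
  (fun t => p * f' (0 + RtoC t * p))%C (M * Cmod p ^ (S n))).
replace (f p) with (f (0 + RtoC 1 * p) - f (0 + RtoC 0 * p))%C.
- eapply Rle_trans; [apply K|right; ring].
  + intros t Ht; apply Hd; [apply cderiv_line|reflexivity].
  + intros t Ht; rewrite Cmod_mult.
    assert (Hm : Cmod (0 + RtoC t * p) = t * Cmod p).
    { rewrite Cplus_0_l, Cmod_mult, Cmod_R, Rabs_pos_eq; lra. }
    assert (Hle : t * Cmod p <= Cmod p) by nra.
    apply Rle_trans with (Cmod p * (M * Cmod p ^ n)); [|right; simpl; ring].
    apply Rmult_le_compat_l; [exact P|].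
    eapply Rle_trans; [apply Hb; rewrite Hm; lra|].
    apply Rmult_le_compat_l; [exact HM|]; apply pow_incr; rewrite Hm; nra.
- replace (0 + RtoC 0 * p)%C with (RtoC 0) by ring; rewrite H0.
  replace (0 + RtoC 1 * p)%C with p by ring; ring.
Qed.

Lemma HD_ext (f g : C -> C) (p l : C) : (forall w, f w = g w) -> HD f p l -> HD g p l.
Proof. intros H; apply HD_near, near_all, H. Qed.

Lemma RtoC_neq_0 (r : R) : r <> 0 -> RtoC r <> 0%C.
Proof. intros H E; apply H; exact (f_equal Re E). Qed.

(** * Taylor quotients of the exponential and the poles of the integrand *)

Definition exp_cubic (a b c d w : C) : C := (Cexp w + (a + w * (b + w * (c + w * d))))%C.

(** The family is closed under differentiation, so one rule treats all Taylor remainders. *)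
Lemma HD_exp_cubic (a b c d p : C) :
  HD (exp_cubic a b c d) p (exp_cubic b (2 * c) (3 * d) 0 p).
Proof.
intros f t f' H <-.
eapply cderiv_ext_val; [|apply cderiv_plus; [apply cderiv_Cexp, H|apply cderiv_plus; [apply cderiv_const|
  apply (cderiv_mult f); [exact H|apply cderiv_plus; [apply cderiv_const|
  apply (cderiv_mult f); [exact H|apply cderiv_plus; [apply cderiv_const|
  apply (cderiv_mult f); [exact H|apply cderiv_const]]]]]]]].
unfold exp_cubic; ring.
Qed.

Definition exp_rem1 : C -> C := exp_cubic (- (1)) (- (1)) 0 0.
Definition exp_rem2 : C -> C := exp_cubic (- (1)) (- (1)) (- / 2) 0.
Definition exp_rem3 : C -> C := exp_cubic (- (1)) (- (1)) (- / 2) (- / 6).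

(** Starting from [|exp| <= 3] on the unit disc, each application of [HD_growth] doubles the
    constant: 6 for [exp - 1], then 12, 24 and 48. *)
Lemma exp_rem_bounds (h : C) : Cmod h <= 1 ->
  Cmod (exp_rem1 h) <= 12 * Cmod h ^ 2 /\ Cmod (exp_rem2 h) <= 24 * Cmod h ^ 3 /\
  Cmod (exp_rem3 h) <= 48 * Cmod h ^ 4.
Proof.
assert (N2 := RtoC_neq_0 2 ltac:(lra)); assert (N3 := RtoC_neq_0 3 ltac:(lra)).
assert (Step : forall (b c d b' c' d' : C) M n,
  b = (- (1))%C -> (2 * c)%C = b' -> (3 * d)%C = c' -> RtoC 0 = d' -> 0 <= M ->
  (forall p, Cmod p <= 1 -> Cmod (exp_cubic b b' c' d' p) <= M * Cmod p ^ n) ->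
  forall p, Cmod p <= 1 -> Cmod (exp_cubic (- (1)) b c d p) <= 2 * M * Cmod p ^ S n).
{ intros b c d b' c' d' M n _ <- <- <- HM Hb; apply (HD_growth _ _ M n (HD_exp_cubic _ b c d)); auto.
  unfold exp_cubic; rewrite Cexp_0; ring. }
assert (B0 : forall p, Cmod p <= 1 -> Cmod (exp_cubic (- (1)) 0 0 0 p) <= 2 * 3 * Cmod p ^ 1).
{ apply (HD_growth _ _ 3 0 (HD_exp_cubic _ 0 0 0)); [|lra|].
  - unfold exp_cubic; rewrite Cexp_0; ring.
  - intros p Hp; replace (exp_cubic 0 (2 * 0) (3 * 0) 0 p) with (Cexp p) by (unfold exp_cubic; ring).
    rewrite Cmod_Cexp; simpl; rewrite Rmult_1_r.
    apply Rle_trans with (exp 1); [|apply exp_le_3].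
    assert (K := Rle_trans _ _ _ (Rle_trans _ _ _ (Rle_abs _) (re_le_Cmod p)) Hp).
    destruct K as [K| ->]; [left; apply exp_increasing, K|right; reflexivity]. }
assert (E2 : (2 * - / 2 = - (1))%C) by (field; auto).
assert (E3 : (3 * - / 6 = - / 2)%C).
{ replace (RtoC 6) with (3 * 2)%C by (rewrite <- RtoC_mult; f_equal; ring); field; auto. }
assert (B1 := Step _ 0%C 0%C _ _ _ (2 * 3) 1%nat eq_refl (Cmult_0_r _) (Cmult_0_r _) eq_refl ltac:(lra) B0).
assert (B2 := Step _ (- / 2)%C 0%C _ _ _ (2 * (2 * 3)) 2%nat eq_refl E2 (Cmult_0_r _) eq_refl ltac:(lra) B1).
assert (B3 := Step _ (- / 2)%C (- / 6)%C _ _ _ (2 * (2 * (2 * 3))) 3%nat eq_refl E2 E3 eq_refl ltac:(lra) B2).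
intros Hh; specialize (B1 h Hh); specialize (B2 h Hh); specialize (B3 h Hh).
repeat split; eapply Rle_trans; [exact B1| |exact B2| |exact B3|]; lra.
Qed.

(** Taylor quotients with their limits 1, 1/2, 1/3 filled in at 0. Near a zero [W],
    [root_fun x (W + h)] is [e^W h (W quot1 h + e^h)]; at the double zero -1 it is
    [e^(-1) h^2 quot2 h], and [quot3 / quot2] is what remains of the logarithmic derivative there
    after removal of [2/h]. *)
Definition quot1 (h : C) : C := if Ceq_dec h 0 then 1%C else ((Cexp h - 1) / h)%C.
Definition quot2 (h : C) : C := if Ceq_dec h 0 then (/ 2)%C else (((h - 1) * Cexp h + 1) / (h * h))%C.
Definition quot3 (h : C) : C := if Ceq_dec h 0 then (/ 3)%C else ((Cexp h - 2 * quot2 h) / h)%C.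

Lemma quot_Lipschitz (h : C) : Cmod h <= 1 ->
  Cmod (quot1 h - 1) <= 200 * Cmod h /\ Cmod (quot2 h - / 2) <= 200 * Cmod h /\
  Cmod (quot3 h - / 3) <= 300 * Cmod h.
Proof.
intros Hh.
assert (N2 := RtoC_neq_0 2 ltac:(lra)); assert (N6 := RtoC_neq_0 6 ltac:(lra)).
assert (N3 := RtoC_neq_0 3 ltac:(lra)).
destruct (exp_rem_bounds h Hh) as (B1 & B2 & B3).
unfold quot3, quot1, quot2; destruct (Ceq_dec h 0) as [E|Hn].
{ subst h; unfold Cminus; rewrite !Cplus_opp_r, Cmod_0; lra. }
assert (P : 0 < Cmod h) by (apply Cmod_gt_0, Hn).
assert (Hq : forall (z : C) M k, Cmod z <= M * Cmod h ^ (S (S k)) -> Cmod (z / (h * h))%C <= M * Cmod h ^ k).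
{ intros z M k H; rewrite Cmod_div, Cmod_mult by (apply Cmult_neq_0; exact Hn).
  apply Rle_div_l; [nra|].
  eapply Rle_trans; [exact H|right; simpl; ring]. }
assert (Hq1 : forall (z : C) M k, Cmod z <= M * Cmod h ^ (S k) -> Cmod (z / h)%C <= M * Cmod h ^ k).
{ intros z M k H; rewrite Cmod_div by exact Hn.
  apply Rle_div_l; [exact P|].
  eapply Rle_trans; [exact H|right; simpl; ring]. }
assert (Hh1 : Cmod (h - 1) <= 2).
{ eapply Rle_trans; [apply Cmod_triangle|]; rewrite Cmod_opp, Cmod_1; lra. }
assert (D1 := Hq1 _ 12 1%nat B1); assert (D2 := Hq _ 24 1%nat B2); assert (D3 := Hq _ 48 2%nat B3).
assert (Q2 : Cmod h ^ 2 <= Cmod h) by (simpl; nra).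
rewrite pow_1 in D1, D2.
split; [|split].
- replace ((Cexp h - 1) / h - 1)%C with (exp_rem1 h / h)%C by (unfold exp_rem1, exp_cubic; field; exact Hn).
  lra.
- replace (((h - 1) * Cexp h + 1) / (h * h) - / 2)%C
    with (h / 2 + (h - 1) * (exp_rem2 h / (h * h)))%C by (unfold exp_rem2, exp_cubic; field; auto).
  eapply Rle_trans; [apply Cmod_triangle|].
  rewrite Cmod_mult, Cmod_div by exact N2; rewrite Cmod_R, Rabs_pos_eq by lra.
  assert (G := Cmod_ge_0 (exp_rem2 h / (h * h))%C).
  assert (Cmod (h - 1) * Cmod (exp_rem2 h / (h * h))%C <= 2 * (24 * Cmod h)).
  { apply Rmult_le_compat; auto; apply Cmod_ge_0. }
  lra.
- replace ((Cexp h - 2 * (((h - 1) * Cexp h + 1) / (h * h))) / h - / 3)%C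
    with (exp_rem1 h / h - h / 3 - 2 * (h - 1) * ((exp_rem3 h / (h * h)) / h))%C
    by (unfold exp_rem1, exp_rem3, exp_cubic;
        replace (RtoC 6) with (3 * 2)%C by (rewrite <- RtoC_mult; f_equal; ring);
        field; repeat split; assumption).
  assert (D4 := Hq1 _ 48 1%nat D3); rewrite pow_1 in D4.
  unfold Cminus at 1; eapply Rle_trans; [apply Cmod_triangle|].
  rewrite Cmod_opp, !Cmod_mult.
  assert (X1 : Cmod (exp_rem1 h / h - h / 3)%C <= 13 * Cmod h).
  { eapply Rle_trans; [apply Cmod_triangle|].
    rewrite Cmod_opp, (Cmod_div h 3) by exact N3; rewrite Cmod_R, Rabs_pos_eq by lra; lra. }
  assert (G := Cmod_ge_0 (exp_rem3 h / (h * h) / h)%C).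
  rewrite Cmod_R, Rabs_pos_eq by lra.
  assert (Cmod (h - 1) * Cmod (exp_rem3 h / (h * h) / h)%C <= 2 * (48 * Cmod h)).
  { apply Rmult_le_compat; auto; apply Cmod_ge_0. }
  lra.
Qed.

Lemma Ccont_quot (W : C) :
  Ccont (fun w => quot1 (w - W)) W /\ Ccont (fun w => quot2 (w - W)) W /\
  Ccont (fun w => quot3 (w - W)) W.
Proof.
assert (E : (W - W)%C = 0%C) by ring.
assert (E1 : quot1 0 = 1%C) by (unfold quot1; destruct (Ceq_dec 0 0); congruence).
assert (E2 : quot2 0 = (/ 2)%C) by (unfold quot2; destruct (Ceq_dec 0 0); congruence).
assert (E3 : quot3 0 = (/ 3)%C) by (unfold quot3; destruct (Ceq_dec 0 0); congruence).
split; [|split].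
- apply (Ccont_Lipschitz _ _ 1 200); [lra|]; intros w Hw; rewrite E, E1; apply quot_Lipschitz; lra.
- apply (Ccont_Lipschitz _ _ 1 200); [lra|]; intros w Hw; rewrite E, E2; apply quot_Lipschitz; lra.
- apply (Ccont_Lipschitz _ _ 1 300); [lra|]; intros w Hw; rewrite E, E3; apply quot_Lipschitz; lra.
Qed.

Definition root_fun (x w : C) : C := (w * Cexp w + - x)%C.

(* [w] times the logarithmic derivative of [root_fun x]. *)
Definition weighted (x w : C) : C := (w * ((1 + w) * Cexp w) * / root_fun x w)%C.

Lemma weighted_simple_pole (x W : C) : (W * Cexp W)%C = x -> W <> RtoC (-1) ->
  exists D, Ccont D W /\
    near W (fun w => w <> W -> weighted x w = (1 * (W * / (w + - W)) + D w)%C).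
Proof.
intros Hx Hn.
destruct (Ccont_quot W) as (C1 & C2 & C3).
assert (Ce : Ccont (fun w => Cexp (w - W)) W)
  by (unfold Cminus; ccont).
assert (Cd : Ccont (fun w => W * quot1 (w - W) + Cexp (w - W))%C W)
  by ccont.
assert (D0 : (W * quot1 (W - W) + Cexp (W - W))%C <> 0%C).
{ replace (W - W)%C with (RtoC 0) by ring; rewrite Cexp_0.
  unfold quot1; destruct (Ceq_dec 0 0) as [_|]; [|congruence].
  intros E; apply Hn; apply (f_equal (fun z => z + - (1))%C) in E.
  transitivity (W * 1 + 1 + - (1))%C; [ring|]; rewrite E; apply C_ext; cbn; lra. }
(* With [F] for [root_fun x] and [h = w - W], the difference [F' / F - 1/h] equals
   [(W quot2 h + e^h) / (W quot1 h + e^h)]; the leading 1 comes from [w / h = W / h + 1]. The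
   denominator is [W + 1] at [h = 0], nonzero by hypothesis. *)
exists (fun w => 1 + w * ((W * quot2 (w - W) + Cexp (w - W)) * / (W * quot1 (w - W) + Cexp (w - W))))%C; split.
- assert (I := Ccont_inv (fun w => W * quot1 (w - W) + Cexp (w - W))%C W D0 Cd); ccont.
- generalize (near_neq_0 _ _ Cd D0); apply near_imp; intros w Hd Hw.
  set (h := (w - W)%C) in *.
  assert (Hh : h <> 0%C).
  { intros E; apply Hw; replace w with (h + W)%C by (unfold h; ring); rewrite E; ring. }
  replace w with (W + h)%C by (unfold h; ring).
  replace (W + h + - W)%C with h by ring.
  assert (HP := Cexp_neq_0 W).
  unfold weighted, root_fun; rewrite <- Hx, Cexp_plus.
  unfold quot1, quot2 in *; destruct (Ceq_dec h 0) as [|_]; [contradiction|].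
  set (E := Cexp h) in *; set (P := Cexp W) in *.
  assert (Hd' : (W * (E - 1) + h * E)%C <> 0%C).
  { intros K; apply Hd; transitivity ((W * (E - 1) + h * E) / h)%C; [field; exact Hh|].
    rewrite K; field; exact Hh. }
  field; repeat split; auto.
  + intros K; apply Hd'; rewrite <- K; ring.
  + intros K; apply Hd'.
    transitivity (((W + h) * (P * E) + - (W * P)) / P)%C; [field; exact HP|].
    rewrite K; field; exact HP.
Qed.

Lemma weighted_double_pole (x W : C) : (W * Cexp W)%C = x -> W = RtoC (-1) ->
  exists D, Ccont D W /\
    near W (fun w => w <> W -> weighted x w = ((1 + 1) * (W * / (w + - W)) + D w)%C).
Proof.
intros Hx HW.
destruct (Ccont_quot W) as (C1 & C2 & C3).
assert (N2 := RtoC_neq_0 2 ltac:(lra)).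
assert (D0 : quot2 (W - W) <> 0%C).
{ replace (W - W)%C with (RtoC 0) by ring.
  unfold quot2; destruct (Ceq_dec 0 0) as [_|]; [|congruence].
  intros E; apply (f_equal (fun z => z * 2)%C) in E; rewrite Cinv_l, Cmult_0_l in E by exact N2.
  apply (f_equal Re) in E; cbn in E; lra. }
(* Here [F' / F - 2/h] equals [quot3 h / quot2 h], and [2 w / h = 2 W / h + 2]. *)
exists (fun w => 2 + w * (quot3 (w - W) * / quot2 (w - W)))%C; split.
- assert (I := Ccont_inv (fun w => quot2 (w - W)) W D0 C2); ccont.
- generalize (near_neq_0 _ _ C2 D0); apply near_imp; intros w Hd Hw.
  set (h := (w - W)%C) in *.
  assert (Hh : h <> 0%C).
  { intros E; apply Hw; replace w with (h + W)%C by (unfold h; ring); rewrite E; ring. }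
  replace w with (W + h)%C by (unfold h; ring).
  replace (W + h + - W)%C with h by ring.
  assert (HP := Cexp_neq_0 W).
  unfold weighted, root_fun; rewrite <- Hx, Cexp_plus.
  unfold quot3, quot2 in *; destruct (Ceq_dec h 0) as [|_]; [contradiction|].
  set (E := Cexp h) in *; set (P := Cexp W) in *.
  replace W with (RtoC (-1)) in * by (symmetry; exact HW).
  assert (Hd' : ((h - 1) * E + 1)%C <> 0%C).
  { intros K; apply Hd; rewrite K; field; exact Hh. }
  field; repeat split; auto.
  intros K; apply Hd'.
  transitivity (((-1 + h) * (P * E) + - (-1 * P)) / P)%C; [field; exact HP|].
  rewrite K; field; exact HP.
Qed.

(** * Finite sums and the residue computation *)

Definition Csum (f : nat -> C) (n : nat) : C := sum_n (G := C_AbelianMonoid) f n.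

Lemma Csum_0 (f : nat -> C) : Csum f 0 = f 0%nat.
Proof. exact (sum_O (G := C_AbelianMonoid) f). Qed.

Lemma Csum_S (f : nat -> C) (n : nat) : Csum f (S n) = (Csum f n + f (S n))%C.
Proof. exact (sum_Sn (G := C_AbelianMonoid) f n). Qed.

Lemma Csum_ext (f g : nat -> C) (n : nat) :
  (forall j, (j <= n)%nat -> f j = g j) -> Csum f n = Csum g n.
Proof.
induction n as [|n IH]; intros H; [rewrite !Csum_0; auto|].
rewrite !Csum_S, IH, H; auto.
Qed.

Lemma Csum_scal (k : C) (f : nat -> C) (n : nat) : Csum (fun j => k * f j)%C n = (k * Csum f n)%C.
Proof.
induction n as [|n IH]; [rewrite !Csum_0; auto|]; rewrite !Csum_S, IH; ring.
Qed.

Lemma Csum_plus (f g : nat -> C) (n : nat) :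
  Csum (fun j => f j + g j)%C n = (Csum f n + Csum g n)%C.
Proof.
induction n as [|n IH]; [rewrite !Csum_0; auto|]; rewrite !Csum_S, IH; ring.
Qed.

Lemma Csum_delta (n j0 : nat) : (j0 <= n)%nat ->
  Csum (fun j => if Nat.eq_dec j j0 then 1%C else 0%C) n = 1%C.
Proof.
assert (Z : forall n, (n < j0)%nat -> Csum (fun j => if Nat.eq_dec j j0 then 1%C else 0%C) n = 0%C).
{ induction n0 as [|m IH]; intros H; [rewrite Csum_0|rewrite Csum_S, IH by lia];
  destruct (Nat.eq_dec _ _); try lia; ring. }
induction n as [|n IH]; intros H.
- rewrite Csum_0; destruct (Nat.eq_dec _ _); [reflexivity|lia].
- rewrite Csum_S; destruct (Nat.eq_dec (S n) j0) as [E|E].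
  + rewrite Z by lia; ring.
  + rewrite IH by lia; ring.
Qed.

Lemma Ccont_Csum (f : nat -> C -> C) (p : C) (n : nat) :
  (forall j, (j <= n)%nat -> Ccont (f j) p) -> Ccont (fun w => Csum (fun j => f j w) n) p.
Proof.
induction n as [|n IH]; intros H.
- apply (Ccont_near p (f 0%nat)); [apply near_all; intros w; rewrite Csum_0; reflexivity|auto].
- apply (Ccont_near p (fun w => Csum (fun j => f j w) n + f (S n) w)%C);
    [apply near_all; intros w; rewrite Csum_S; reflexivity|].
  apply Ccont_plus; auto.
Qed.

Lemma HD_Csum (f : nat -> C -> C) (l : nat -> C) (p : C) (n : nat) :
  (forall j, (j <= n)%nat -> HD (f j) p (l j)) -> HD (fun w => Csum (fun j => f j w) n) p (Csum l n).
Proof.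
induction n as [|n IH]; intros H.
- rewrite Csum_0; apply (HD_ext (f 0%nat)); [intros w; rewrite Csum_0; reflexivity|auto].
- rewrite Csum_S; apply (HD_ext (fun w => Csum (fun j => f j w) n + f (S n) w)%C);
    [intros w; rewrite Csum_S; reflexivity|].
  apply HD_plus; auto.
Qed.

Lemma rect_Csum (f : nat -> C -> C) (n : nat) (a b c d : R) :
  a <= b -> c <= d ->
  (forall j, (j <= n)%nat -> edgesC (f j) a b c d) ->
  rect (fun w => Csum (fun j => f j w) n) a b c d = Csum (fun j => rect (f j) a b c d) n /\
  edgesC (fun w => Csum (fun j => f j w) n) a b c d.
Proof.
intros Hab Hcd.
assert (Ext : forall f g : C -> C, (forall w, f w = g w) -> edgesC f a b c d -> edgesC g a b c d).
{ clear - Hab Hcd; intros f g H (H1 & H2 & H3 & H4).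
  split; [|split; [|split]];
    [eapply exC_ext; [lra| |exact H1]|eapply exC_ext; [lra| |exact H2]
    |eapply exC_ext; [lra| |exact H3]|eapply exC_ext; [lra| |exact H4]];
    intros; apply H. }
induction n as [|n IH]; intros H.
- split.
  + rewrite Csum_0; apply rect_ext; auto; intros; rewrite Csum_0; reflexivity.
  + apply (Ext (f 0%nat)); [intros; rewrite Csum_0; reflexivity|auto].
- destruct IH as [I1 I2]; [auto|]; split.
  + rewrite Csum_S, <- I1, <- rect_plus by auto.
    apply rect_ext; auto; intros; rewrite Csum_S; reflexivity.
  + apply (Ext (fun w => Csum (fun j => f j w) n + f (S n) w)%C);
      [intros; rewrite Csum_S; reflexivity|apply edgesC_plus; auto].
Qed.

(** Only the terms with [a j = p] are singular at [p]; their number becomes the coefficient of the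
    polar part, to be matched with the order of the zero. *)
Lemma Csum_polar_part (a : nat -> C) (n : nat) (p : C) :
  exists D, Ccont D p /\ forall w, Csum (fun j => a j * / (w + - a j))%C n =
    (Csum (fun j => if Ceq_dec (a j) p then 1%C else 0%C) n * (p * / (w + - p)) + D w)%C.
Proof.
exists (fun w => Csum (fun j => if Ceq_dec (a j) p then 0%C else (a j * / (w + - a j))%C) n); split.
- apply (Ccont_Csum (fun j w => if Ceq_dec (a j) p then 0%C else (a j * / (w + - a j))%C)).
  intros j _; destruct (Ceq_dec (a j) p) as [E|E]; [apply Ccont_const|].
  apply Ccont_mult; [apply Ccont_const|]; apply Ccont_inv_sub.
  intros K; apply E; symmetry; replace p with (p + - a j + a j)%C by ring; rewrite K; ring.
- intros w; rewrite (Cmult_comm (Csum _ _)), <- Csum_scal, <- Csum_plus; apply Csum_ext.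
  intros j _; destruct (Ceq_dec (a j) p) as [->|E]; ring.
Qed.

Definition W_shift (K : nat) (x : C) (j : nat) : C := LambertW (Z.of_nat j - Z.of_nat K) x.

(** The number of indices with value [p] is the order of [p] as a zero of [root_fun x]: one, by
    [LambertW_inj], except at -1, where the indices [K] and [K - 1], that is the branches 0 and -1,
    both count. The condition [1 <= K] puts the branch -1 in the range. *)
Lemma weighted_pole_multiplicity (x p : C) (K : nat) : x <> 0%C -> (1 <= K)%nat ->
  (exists j, (j <= 2 * K)%nat /\ W_shift K x j = p) ->
  exists D, Ccont D p /\ near p (fun w => w <> p -> weighted x w =
    (Csum (fun j => if Ceq_dec (W_shift K x j) p then 1%C else 0%C) (2 * K) * (p * / (w + - p)) + D w)%C).
Proof.
intros Hx HK (j0 & Hj0 & Ej0).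
assert (Hp : (p * Cexp p)%C = x) by (rewrite <- Ej0; apply LambertW_root, Hx).
destruct (Ceq_dec p (RtoC (-1))) as [E|E].
- replace (Csum (fun j => if Ceq_dec (W_shift K x j) p then 1%C else 0%C) (2 * K)) with (1 + 1)%C.
  { apply weighted_double_pole; assumption. }
  rewrite <- (Csum_delta (2 * K) K ltac:(lia)) at 1.
  rewrite <- (Csum_delta (2 * K) (K - 1) ltac:(lia)) at 1.
  rewrite <- Csum_plus; apply Csum_ext; intros j Hj.
  unfold W_shift in Ej0; rewrite E in Ej0.
  destruct (LambertW_minus_1 _ x Hx Ej0) as [_ [W0 W1]].
  destruct (Ceq_dec (W_shift K x j) p) as [F|F].
  + unfold W_shift in F; rewrite E in F.
    destruct (LambertW_minus_1 _ x Hx F) as [[H|H] _];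
      destruct (Nat.eq_dec j K); destruct (Nat.eq_dec j (K - 1)); try lia; ring.
  + destruct (Nat.eq_dec j K) as [G|G];
      [exfalso; apply F; unfold W_shift; rewrite E, <- W0; f_equal; lia|].
    destruct (Nat.eq_dec j (K - 1)) as [G'|G'];
      [exfalso; apply F; unfold W_shift; rewrite E, <- W1; f_equal; lia|ring].
- replace (Csum (fun j => if Ceq_dec (W_shift K x j) p then 1%C else 0%C) (2 * K)) with (RtoC 1).
  { apply weighted_simple_pole; assumption. }
  rewrite <- (Csum_delta (2 * K) j0 Hj0) at 1.
  apply Csum_ext; intros j Hj.
  destruct (Ceq_dec (W_shift K x j) p) as [F|F]; destruct (Nat.eq_dec j j0) as [G|G];
    try reflexivity; [|congruence].
  exfalso; rewrite <- Ej0 in F; unfold W_shift in F, Ej0.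
  destruct (LambertW_inj _ _ x Hx F) as [H|H]; [lia|congruence].
Qed.

(** The derivative of [weighted x], kept in the unsimplified shape that [HD_mult], [HD_plus] and
    [HD_inv] produce. *)
Definition weighted' (x w : C) : C :=
  ((1 * ((1 + w) * Cexp w) + w * ((0 + 1) * Cexp w + (1 + w) * Cexp w)) * / root_fun x w
   + w * ((1 + w) * Cexp w) * - ((1 * Cexp w + w * Cexp w + 0) * (/ root_fun x w * / root_fun x w)))%C.

Lemma Ccont_root_fun (x p : C) : Ccont (root_fun x) p.
Proof. unfold root_fun; ccont. Qed.

Lemma HD_weighted (x p : C) : root_fun x p <> 0%C -> HD (weighted x) p (weighted' x p).
Proof.
intros H; apply (HD_mult (fun w => w * ((1 + w) * Cexp w))%C (fun w => / root_fun x w)%C).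
- apply (HD_mult (fun w => w) (fun w => (1 + w) * Cexp w)%C); [apply HD_id|].
  apply (HD_mult (fun w => 1 + w)%C Cexp); [|apply HD_Cexp].
  apply HD_plus; [apply HD_const|apply HD_id].
- apply (HD_inv (root_fun x)); [exact H|].
  apply HD_plus; [apply (HD_mult (fun w => w) Cexp); [apply HD_id|apply HD_Cexp]|apply HD_const].
Qed.

Lemma Ccont_weighted (x p : C) : root_fun x p <> 0%C -> Ccont (weighted x) p.
Proof.
intros H; assert (I := Ccont_inv (root_fun x) p H (Ccont_root_fun x p)).
unfold weighted; ccont.
Qed.

Lemma Ccont_weighted' (x p : C) : root_fun x p <> 0%C -> Ccont (weighted' x) p.
Proof.
intros H; assert (I := Ccont_inv (root_fun x) p H (Ccont_root_fun x p)).
unfold weighted'; ccont.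
Qed.

(** Subtracting all polar parts [W_j / (w - W_j)] leaves only removable singularities, to which
    [Cauchy_removable] applies, and each polar part contributes [2 pi i W_j] by [rect_inv]. The last
    hypothesis, combined with [LambertW_surj], guarantees that the closed rectangle contains no
    other zero. *)
Theorem sum_LambertW_contour (x : C) (K : nat) (a b c d : R) :
  x <> 0%C -> (1 <= K)%nat -> a <= b -> c <= d ->
  (forall j, (j <= 2 * K)%nat -> a < Re (W_shift K x j) < b /\ c < Im (W_shift K x j) < d) ->
  (forall k u v, a <= u <= b -> c <= v <= d -> LambertW k x = (u, v) ->
     (- Z.of_nat K <= k <= Z.of_nat K)%Z) ->
  rect (weighted x) a b c d = (2 * RtoC PI * Ci * Csum (W_shift K x) (2 * K))%C.
Proof.
intros Hx HK Hab Hcd Hin Hall.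
set (S := map (W_shift K x) (seq 0 (Datatypes.S (2 * K)))).
assert (InS : forall p, In p S <-> exists j, (j <= 2 * K)%nat /\ W_shift K x j = p).
{ intros p; unfold S; rewrite in_map_iff; split; intros [j [H1 H2]]; exists j.
  - apply in_seq in H2; split; [lia|exact H1].
  - split; [exact H2|apply in_seq; lia]. }
set (t := fun j w => (W_shift K x j * / (w + - W_shift K x j))%C).
set (t' := fun j w => (0 * / (w + - W_shift K x j) + W_shift K x j *
  - ((1 + 0) * (/ (w + - W_shift K x j) * / (w + - W_shift K x j))))%C).
assert (Hroot : forall u v, a <= u <= b -> c <= v <= d -> ~ In (u, v) S -> root_fun x (u, v) <> 0%C).
{ intros u v Hu Hv Hn E; apply Hn, InS.
  destruct (LambertW_surj x (u, v) Hx) as [k Hk].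
  - unfold root_fun in E.
    transitivity ((u, v) * Cexp (u, v) + - x + x)%C; [ring|rewrite E; ring].
  - assert (B := Hall k u v Hu Hv (eq_sym Hk)).
    exists (Z.to_nat (k + Z.of_nat K)); split; [lia|].
    unfold W_shift; rewrite Hk; f_equal; lia. }
assert (Hne : forall p j, (j <= 2 * K)%nat -> ~ In p S -> (p + - W_shift K x j)%C <> 0%C).
{ intros p j Hj Hn E; apply Hn, InS; exists j; split; [exact Hj|].
  replace p with (p + - W_shift K x j + W_shift K x j)%C by ring; rewrite E; ring. }
assert (Ct : forall p j, (j <= 2 * K)%nat -> ~ In p S -> Ccont (t j) p).
{ intros p j Hj Hn; apply Ccont_mult; [apply Ccont_const|apply Ccont_inv_sub; auto]. }
assert (E0 : rect (fun w => weighted x w + - (1) * Csum (fun j => t j w) (2 * K))%C a b c d = 0%C).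
{ apply (Cauchy_removable _
    (fun w => weighted' x w + (0 * Csum (fun j => t j w) (2 * K) + - (1) * Csum (fun j => t' j w) (2 * K)))%C S);
    auto.
  - intros p Hp; apply InS in Hp; destruct Hp as [j [Hj <-]]; auto.
  - intros u v Hu Hv Hn; assert (Hr := Hroot u v Hu Hv Hn); split.
    + apply Ccont_plus; [apply Ccont_weighted, Hr|].
      apply Ccont_mult; [apply Ccont_const|apply Ccont_Csum; auto].
    + split.
      * assert (Hl : near (u, v) (fun w => ~ In w S)).
        { generalize (list_isolated S (u, v)); apply near_imp; intros w Hw Hi.
          apply Hn; rewrite <- (Hw Hi); exact Hi. }
        generalize (near_and _ _ _ Hl (near_neq_0 _ _ (Ccont_root_fun x (u, v)) Hr)).
        apply near_imp; cbv beta; intros w [Hw1 Hw2].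
        apply HD_plus; [apply HD_weighted, Hw2|].
        apply (HD_mult (fun _ => - (1))%C (fun w => Csum (fun j => t j w) (2 * K))); [apply HD_const|].
        apply (HD_Csum t (fun j => t' j w)); intros j Hj.
        apply (HD_mult (fun _ => W_shift K x j) (fun w => / (w + - W_shift K x j))%C); [apply HD_const|].
        apply (HD_inv (fun w => w + - W_shift K x j)%C); [auto|].
        apply HD_plus; [apply HD_id|apply HD_const].
      * apply Ccont_plus; [apply Ccont_weighted', Hr|].
        apply Ccont_plus; apply Ccont_mult; try apply Ccont_const; apply Ccont_Csum; auto.
        intros j Hj.
        assert (I := Ccont_inv_sub _ _ (Hne (u, v) j Hj Hn)); unfold t'; ccont.
  - intros p Hp; apply InS in Hp.
    destruct (weighted_pole_multiplicity x p K Hx HK Hp) as [D [D1 D2]].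
    destruct (Csum_polar_part (W_shift K x) (2 * K) p) as [D' [D1' D2']].
    exists (fun w => D w + - D' w)%C; split; [apply Ccont_plus; [exact D1|apply Ccont_opp, D1']|].
    revert D2; apply near_imp; intros w Hw Hne'; rewrite (Hw Hne'); unfold t; rewrite D2'; ring. }
assert (Hedge : forall u v, a <= u <= b -> c <= v <= d -> u = a \/ u = b \/ v = c \/ v = d -> ~ In (u, v) S).
{ intros u v Hu Hv He Hi; apply InS in Hi; destruct Hi as [j [Hj Ej]].
  specialize (Hin j Hj); rewrite Ej in Hin; cbn in Hin; lra. }
assert (X1 : edgesC (weighted x) a b c d).
{ apply edgesC_cont; auto; intros u v Hu Hv He; apply Ccont_weighted, Hroot; auto. }
assert (X2 : forall j, (j <= 2 * K)%nat -> edgesC (t j) a b c d).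
{ intros j Hj; apply edgesC_cont; auto. }
destruct (rect_Csum t (2 * K) a b c d Hab Hcd X2) as [R1 R2].
rewrite (rect_plus (weighted x) (fun w => - (1) * Csum (fun j => t j w) (2 * K))%C) in E0
  by (auto; apply edgesC_scal, R2).
rewrite rect_scal, R1 in E0 by exact R2.
replace (rect (weighted x) a b c d) with (Csum (fun j => rect (t j) a b c d) (2 * K))
  by (transitivity (Csum (fun j => rect (t j) a b c d) (2 * K) + 0)%C; [ring|rewrite <- E0; ring]).
rewrite <- Csum_scal; apply Csum_ext; intros j Hj; unfold t.
rewrite (rect_scal _ (fun w => / (w + - W_shift K x j))%C).
- destruct (Hin j Hj) as [H1 H2]; assert (RI : rect (fun w => / (w + - W_shift K x j))%C a b c d = (2 * RtoC PI * Ci)%C)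
    by exact (rect_inv _ a b c d H1 H2).
  rewrite RI; ring.
- apply edgesC_cont; auto; intros u v Hu Hv He; apply Ccont_inv_sub; auto.
Qed.

(** * Behaviour near a horizontal edge *)

Lemma Cmod_inv_le (z : C) (r : R) : 0 < r -> r <= Cmod z -> Cmod (/ z)%C <= / r.
Proof.
intros Hr H; rewrite Cmod_inv by (apply Cmod_gt_0; lra).
apply Rinv_le_contravar; assumption.
Qed.

(** The quadratic bound is for [half_sq_asymptotic], where the remainder of the logarithm is
    multiplied by a factor of size [N]; the linear one suffices for the exponentially small
    arguments in [edge_asymptotic]. *)
Lemma Log1_bounds (e : C) : Cmod e <= 1 / 2 ->
  Cmod (Log1 (1 + e)) <= 4 * Cmod e /\ Cmod (Log1 (1 + e) - e) <= 4 * Cmod e ^ 2.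
Proof.
intros He.
assert (Hre : forall t, 0 <= t <= 1 -> 1 / 2 <= Re (1 + RtoC t * e)%C).
{ intros t Ht; replace (Re (1 + RtoC t * e)%C) with (1 + t * Re e) by (cbn; unfold Re, Im; ring).
  assert (K := re_le_Cmod e); apply Rabs_le_between in K; nra. }
assert (Hc : forall t, 0 <= t <= 1 -> cderiv (fun t => Log1 (1 + RtoC t * e)) t (e * / (1 + RtoC t * e))%C).
{ intros t Ht; apply cderiv_Log1; [specialize (Hre t Ht); lra|apply cderiv_line]. }
assert (Hi : forall t, 0 <= t <= 1 -> Cmod (/ (1 + RtoC t * e))%C <= 2).
{ intros t Ht; replace 2 with (/ (1 / 2)) by field; apply Cmod_inv_le; [lra|].
  eapply Rle_trans; [apply (Hre t Ht)|]; eapply Rle_trans; [apply Rle_abs|apply re_le_Cmod]. }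
assert (Hne : forall t, 0 <= t <= 1 -> (1 + RtoC t * e)%C <> 0%C).
{ intros t Ht E; specialize (Hre t Ht); rewrite E in Hre; cbn in Hre; lra. }
assert (P := Cmod_ge_0 e).
split.
- assert (K := cderiv_increment_bound _ _ (2 * Cmod e) Hc).
  cbv beta in K; replace (1 + RtoC 0 * e)%C with (RtoC 1) in K by ring; rewrite Log1_1 in K.
  replace (1 + RtoC 1 * e)%C with (1 + e)%C in K by ring.
  replace (Log1 (1 + e) - 0)%C with (Log1 (1 + e)) in K by ring.
  eapply Rle_trans; [apply K|lra].
  intros t Ht; rewrite Cmod_mult; specialize (Hi t Ht); nra.
- assert (Hc' : forall t, 0 <= t <= 1 -> cderiv (fun t => Log1 (1 + RtoC t * e) + - (1) * (0 + RtoC t * e))%C t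
    (- (RtoC t * (e * e)) * / (1 + RtoC t * e))%C).
  { intros t Ht; eapply cderiv_ext_val; [|apply cderiv_plus; [apply Hc, Ht|
      apply (cderiv_mult (fun _ => - (1))%C); [apply cderiv_const|apply cderiv_line]]].
    field; apply Hne, Ht. }
  assert (K := cderiv_increment_bound _ _ (2 * Cmod e ^ 2) Hc').
  cbv beta in K; replace (1 + RtoC 0 * e)%C with (RtoC 1) in K by ring; rewrite Log1_1 in K.
  replace (1 + RtoC 1 * e)%C with (1 + e)%C in K by ring.
  replace (Log1 (1 + e) + - (1) * (0 + RtoC 1 * e) - (0 + - (1) * (0 + RtoC 0 * e)))%C
    with (Log1 (1 + e) - e)%C in K by ring.
  eapply Rle_trans; [apply K|lra].
  intros t Ht; rewrite Cmod_mult, Cmod_opp, !Cmod_mult, Cmod_R, Rabs_pos_eq by lra.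
  specialize (Hi t Ht); assert (Q := Cmod_ge_0 (/ (1 + RtoC t * e))%C).
  simpl; rewrite Rmult_1_r.
  assert (t * (Cmod e * Cmod e) <= Cmod e * Cmod e) by nra.
  apply Rle_trans with (Cmod e * Cmod e * 2); [|lra].
  apply Rmult_le_compat; nra.
Qed.

(* Common limit profile of the integrand near the two horizontal edges, where
   the integrand switches from about [0] to about [w + 1]; it cancels between them. *)
Definition profile (s : R) : R := - Rabs s / (1 + exp (Rabs s)).

Lemma continuous_profile (s : R) : continuous profile s.
Proof.
unfold profile.
apply (continuous_comp Rabs (fun y => - y / (1 + exp y))); [apply continuous_Rabs|].
apply (ex_derive_continuous (K := R_AbsRing) (V := R_NormedModule)); auto_derive.
assert (K := exp_pos (Rabs s)); lra.
Qed.

Lemma ex_RInt_profile (a b : R) : ex_RInt profile a b.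
Proof. apply (ex_RInt_continuous (V := R_CompleteNormedModule)); intros; apply continuous_profile. Qed.

Lemma exC_profile (a b : R) : exC (fun s => RtoC (profile s)) a b.
Proof. split; [apply ex_RInt_profile|exact (ex_RInt_const a b 0)]. Qed.

Lemma CInt_profile (a b : R) : CInt (fun s => RtoC (profile s)) a b = RtoC (RInt profile a b).
Proof.
apply C_ext; [reflexivity|].
change (RInt (fun _ : R => 0) a b = 0); rewrite RInt_const; apply Rmult_0_r.
Qed.

Lemma Ccont_exC (f : C -> C) (a b : R) :
  a <= b -> (forall s, a <= s <= b -> Ccont f (RtoC s)) -> exC (fun s => f (RtoC s)) a b.
Proof.
intros Hab H; apply exC_cont; [exact Hab|]; intros t Ht.
apply Ccur_horizontal, H, Ht.
Qed.

Section Edge.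
Variables (x zeta : C) (a b : R).
Hypotheses (Hz : zeta <> 0%C) (Hroot : (zeta * Cexp zeta)%C = (- x)%C) (Ha : 0 <= a) (Hb : 0 <= b).
(** Will hold on the edges because [zeta] is almost purely imaginary; it excludes any cancellation
    between the two terms of [D]. *)
Hypothesis Heta : forall s, - a <= s <= b -> 1 / 2 <= Re (1 + RtoC s * / zeta)%C.

Let eta := (/ zeta)%C.
(** [root_fun x (zeta + w)] is [zeta e^zeta] times [D w], and [D'] is the derivative of [D]. *)
Let D (w : C) : C := (1 + (1 + w * eta) * Cexp w)%C.
Let D' (w : C) : C := (eta * Cexp w + (1 + w * eta) * Cexp w)%C.
(** [G] is [D] divided by [(1 + w eta) e^w], its dominant term far to the right, and [mu] is
    [- G' / G]. *)
Let G (w : C) : C := (1 + Cexp (- w) * / (1 + w * eta))%C.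
Let mu (w : C) : C := ((1 + w * eta + eta) * / (1 + w * eta) * / D w)%C.

Lemma edge_Re_D (s : R) : - a <= s <= b -> 1 + exp s / 2 <= Re (D (RtoC s)).
Proof.
intros Hs; unfold D; rewrite Cexp_RtoC.
replace (Re (1 + (1 + RtoC s * eta) * RtoC (exp s))%C)
  with (1 + Re (1 + RtoC s * eta)%C * exp s) by (cbn; unfold Re, Im; ring).
specialize (Heta s Hs); fold eta in Heta; assert (P := exp_pos s); nra.
Qed.

Lemma edge_Cmod_D (s : R) : - a <= s <= b -> 1 + exp s / 2 <= Cmod (D (RtoC s)).
Proof.
intros Hs; eapply Rle_trans; [apply edge_Re_D, Hs|].
eapply Rle_trans; [apply Rle_abs|apply re_le_Cmod].
Qed.

Lemma edge_D_neq_0 (s : R) : - a <= s <= b -> D (RtoC s) <> 0%C.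
Proof.
intros Hs; apply Cmod_gt_0; assert (K := edge_Cmod_D s Hs); assert (P := exp_pos s); lra.
Qed.

Lemma edge_lin_neq_0 (s : R) : - a <= s <= b -> (1 + RtoC s * eta)%C <> 0%C.
Proof.
intros Hs E; specialize (Heta s Hs); fold eta in Heta; rewrite E in Heta; cbn in Heta; lra.
Qed.

Lemma edge_Cmod_lin (s : R) : - a <= s <= b -> Cmod (/ (1 + RtoC s * eta))%C <= 2.
Proof.
intros Hs; replace 2 with (/ (1 / 2)) by field; apply Cmod_inv_le; [lra|].
eapply Rle_trans; [apply Heta, Hs|]; eapply Rle_trans; [apply Rle_abs|apply re_le_Cmod].
Qed.

Lemma edge_root (s : R) : root_fun x (zeta + RtoC s) = (Cexp zeta * zeta * D (RtoC s))%C.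
Proof.
unfold root_fun, D, eta; replace (- x)%C with (zeta * Cexp zeta)%C by exact Hroot.
rewrite Cexp_plus; field; exact Hz.
Qed.

Lemma edge_root_neq_0 (s : R) : - a <= s <= b -> root_fun x (zeta + RtoC s) <> 0%C.
Proof.
intros Hs; rewrite edge_root; apply Cmult_neq_0; [|apply edge_D_neq_0, Hs].
apply Cmult_neq_0; [apply Cexp_neq_0|exact Hz].
Qed.

Lemma edge_weighted_left (s : R) : - a <= s <= b ->
  weighted x (zeta + RtoC s) = ((zeta + RtoC s) * (D' (RtoC s) * / D (RtoC s)))%C.
Proof.
intros Hs; assert (H := edge_D_neq_0 s Hs); assert (P := Cexp_neq_0 zeta).
unfold weighted; rewrite edge_root, Cexp_plus; unfold D'.
transitivity ((zeta + RtoC s) * ((1 + (zeta + RtoC s)) * Cexp (RtoC s) / zeta / D (RtoC s)))%C.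
- field; auto.
- unfold eta; field; auto.
Qed.

(** From [(zeta + s) e^s = zeta (D - 1)], the integrand at [w = zeta + s] is [(w + 1) (1 - 1/D)],
    and [(w + 1) / D] equals [w mu]. This isolates the main part [w + 1] to the right of [zeta]. *)
Lemma edge_weighted_right (s : R) : - a <= s <= b ->
  weighted x (zeta + RtoC s) = ((zeta + RtoC s + 1) + - ((zeta + RtoC s) * mu (RtoC s)))%C.
Proof.
intros Hs; assert (H := edge_D_neq_0 s Hs); assert (H1 := edge_lin_neq_0 s Hs).
rewrite (edge_weighted_left s Hs); unfold mu.
assert (H2 : (zeta + RtoC s)%C <> 0%C).
{ intros E; apply H1; unfold eta; transitivity ((zeta + RtoC s) / zeta)%C; [field; exact Hz|].
  rewrite E; field; exact Hz. }
assert (E1 : (1 + RtoC s * eta)%C = ((zeta + RtoC s) / zeta)%C) by (unfold eta; field; exact Hz).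
rewrite E1.
assert (E2 : (D' (RtoC s) = (zeta + RtoC s + 1) / zeta * Cexp (RtoC s))%C).
{ unfold D', eta; field; exact Hz. }
assert (E3 : ((zeta + RtoC s) * Cexp (RtoC s) = zeta * D (RtoC s) - zeta)%C).
{ unfold D, eta; field; exact Hz. }
rewrite E2.
transitivity ((zeta + RtoC s + 1) / zeta * ((zeta + RtoC s) * Cexp (RtoC s)) / D (RtoC s))%C; [field; auto|].
rewrite E3; unfold eta; field; auto.
Qed.

Lemma edge_Ccont (s : R) : - a <= s <= b ->
  Ccont (fun w => weighted x (zeta + w)) (RtoC s) /\
  Ccont (fun w => D' w * / D w)%C (RtoC s) /\ Ccont mu (RtoC s).
Proof.
intros Hs.
assert (CD : Ccont D (RtoC s)) by (unfold D; ccont).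
assert (CI := Ccont_inv D (RtoC s) (edge_D_neq_0 s Hs) CD).
assert (CL : Ccont (fun w => / (1 + w * eta))%C (RtoC s)).
{ apply (Ccont_inv (fun w => 1 + w * eta)%C); [apply edge_lin_neq_0, Hs|ccont]. }
split; [|split].
- unfold weighted; ccont.
  apply (Ccont_inv (fun w => root_fun x (zeta + w))); [apply edge_root_neq_0, Hs|unfold root_fun; ccont].
- unfold D'; ccont.
- unfold mu; ccont.
Qed.

Lemma cderiv_RtoC (s : R) : cderiv RtoC s 1.
Proof. split; cbn; auto_derive; auto. Qed.

(** At 0 both [D] and [G] equal 2 whatever [zeta] is. The same [Log1 2] therefore appears here and
    in [edge_CInt_right], and it cancels when the two integrals are weighted by [zeta] and
    [- zeta]. *)
Lemma edge_CInt_left : CInt (fun s => D' (RtoC s) * / D (RtoC s))%C (- a) 0 =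
  (Log1 2 - Log1 (D (RtoC (- a))))%C.
Proof.
replace (RtoC 2) with (D (RtoC 0))
  by (unfold D; rewrite Cexp_0; apply C_ext; cbn; ring).
apply (CInt_FTC (fun s => Log1 (D (RtoC s)))); [lra| |].
- intros s Hs; apply (cderiv_Log1 (fun s => D (RtoC s))).
  + assert (K := edge_Re_D s ltac:(lra)); assert (P := exp_pos s); lra.
  + unfold D, D'.
    eapply cderiv_ext_val; [|apply cderiv_plus; [apply cderiv_const|
      apply (cderiv_mult (fun s => 1 + RtoC s * eta)%C);
        [apply cderiv_line|apply (cderiv_Cexp RtoC), cderiv_RtoC]]].
    cbv beta; ring.
- intros s Hs; apply (Ccur_horizontal (fun w => D' w * / D w)%C); apply (edge_Ccont s); lra.
Qed.

Lemma edge_G (s : R) : - a <= s <= b -> 1 <= Re (G (RtoC s)).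
Proof.
intros Hs; unfold G; rewrite <- RtoC_opp, Cexp_RtoC.
replace (Re (1 + RtoC (exp (- s)) * / (1 + RtoC s * eta))%C)
  with (1 + exp (- s) * Re (/ (1 + RtoC s * eta))%C) by (cbn; unfold Re, Im; ring).
assert (K : 0 <= Re (/ (1 + RtoC s * eta))%C).
{ rewrite Re_inv; specialize (Heta s Hs); fold eta in Heta.
  apply Rmult_le_pos; [lra|left; apply Rinv_0_lt_compat; nra]. }
assert (P := exp_pos (- s)); nra.
Qed.

Lemma edge_CInt_right : CInt (fun s => mu (RtoC s)) 0 b = (Log1 2 - Log1 (G (RtoC b)))%C.
Proof.
assert (E0 : G (RtoC 0) = RtoC 2).
{ unfold G; replace (- RtoC 0)%C with (RtoC 0) by ring; rewrite Cexp_0.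
  replace (1 + RtoC 0 * eta)%C with (RtoC 1) by ring.
  replace (1 + 1 * / 1)%C with (1 + 1)%C by (field; apply RtoC_neq_0; lra).
  apply C_ext; cbn; ring. }
rewrite <- E0.
assert (K : CInt (fun s => mu (RtoC s)) 0 b =
  (- (1) * Log1 (G (RtoC b)) - - (1) * Log1 (G (RtoC 0)))%C); [|rewrite K; ring].
apply (CInt_FTC (fun s => - (1) * Log1 (G (RtoC s)))%C); [lra| |].
- intros s Hs.
  assert (Hs' : - a <= s <= b) by lra.
  assert (H1 := edge_lin_neq_0 s Hs'); assert (H2 := edge_D_neq_0 s Hs').
  eapply cderiv_ext_val; [|apply (cderiv_mult (fun _ => - (1))%C); [apply cderiv_const|
    apply (cderiv_Log1 (fun s => G (RtoC s)));
     [assert (K := edge_G s Hs'); lra|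
      unfold G; apply cderiv_plus; [apply cderiv_const|
        apply (cderiv_mult (fun s => Cexp (- RtoC s))%C);
          [apply (cderiv_Cexp (fun s => - RtoC s)%C)|
           apply (cderiv_inv (fun s => 1 + RtoC s * eta)%C); [exact H1|apply cderiv_line]]]]]].
  2: { eapply cderiv_ext_val; [|apply (cderiv_ext_loc (fun s => - (1) * RtoC s)%C);
        [apply filter_forall; intros; ring|apply (cderiv_mult (fun _ => - (1))%C RtoC);
          [apply cderiv_const|apply cderiv_RtoC]]].
       reflexivity. }
  assert (P := Cexp_neq_0 (RtoC s)).
  assert (H3 : (1 + (1 + RtoC s * eta) * Cexp (RtoC s))%C <> 0%C) by exact H2.
  cbv beta; unfold mu, G, D; rewrite Cexp_opp.
  field; repeat split; auto.
- intros s Hs; apply (Ccur_horizontal mu); apply (edge_Ccont s); lra.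
Qed.

(** Over a common denominator the difference acquires an exact factor [eta]; this is the source of
    an error of order [1 / |zeta|], with a weight that is integrable on the half line. *)
Lemma edge_error_left (s : R) : - a <= s <= 0 ->
  Cmod (weighted x (zeta + RtoC s) + - zeta * (D' (RtoC s) * / D (RtoC s)) + - RtoC (profile s))%C
  <= Cmod eta * ((2 * s ^ 2 - 4 * s) * exp s).
Proof.
intros Hs; assert (Hs' : - a <= s <= b) by lra.
assert (H := edge_D_neq_0 s Hs'); assert (P := exp_pos s).
rewrite (edge_weighted_left s Hs').
(* After removal of the part proportional to [zeta], the term [s D' / D] remains; its limit as [eta]
   tends to 0 is [s e^s / (1 + e^s)], which is [profile s] for [s <= 0]. *)
assert (Ep : RtoC (profile s) = (RtoC s * (RtoC (exp s) / (1 + RtoC (exp s))))%C).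
{ unfold profile; rewrite Rabs_left1 by lra; rewrite exp_Ropp.
  rewrite <- RtoC_plus, <- RtoC_div, <- RtoC_mult; [f_equal; field|]; lra. }
rewrite Ep; unfold D' in *.
assert (HD : D (RtoC s) = (1 + (1 + RtoC s * eta) * RtoC (exp s))%C)
  by (unfold D; rewrite Cexp_RtoC; reflexivity).
rewrite Cexp_RtoC; set (E := RtoC (exp s)) in *.
assert (HE : (1 + E)%C <> 0%C).
{ intros K; apply (f_equal Re) in K; cbn in K; lra. }
replace ((zeta + RtoC s) * ((eta * E + (1 + RtoC s * eta) * E) * / D (RtoC s)) +
   - zeta * ((eta * E + (1 + RtoC s * eta) * E) * / D (RtoC s)) + - (RtoC s * (E / (1 + E))))%C
  with (RtoC s * (E * (eta * (RtoC s + 1 + E))) * (/ D (RtoC s) * / (1 + E)))%C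
  by (rewrite HD in *; field; auto).
rewrite !Cmod_mult.
assert (B1 : Cmod (/ D (RtoC s))%C <= 1).
{ rewrite <- Rinv_1; apply Cmod_inv_le; [lra|]; assert (K := edge_Cmod_D s Hs'); lra. }
assert (B2 : Cmod (/ (1 + E))%C <= 1).
{ rewrite <- Rinv_1; apply Cmod_inv_le; [lra|].
  unfold E; rewrite <- RtoC_plus, Cmod_R, Rabs_pos_eq; lra. }
assert (E1 : exp s <= 1) by (rewrite <- exp_0; destruct (proj2 Hs) as [K| ->];
  [left; apply exp_increasing, K|right; reflexivity]).
assert (B3 : Cmod (RtoC s + 1 + E)%C <= - s + 2).
{ unfold E; rewrite <- !RtoC_plus, Cmod_R; apply Rabs_le; lra. }
assert (B4 : Cmod E = exp s) by (unfold E; rewrite Cmod_R, Rabs_pos_eq; lra).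
rewrite B4, Cmod_R, Rabs_left1 by lra.
assert (Q1 := Cmod_ge_0 (/ D (RtoC s))%C); assert (Q2 := Cmod_ge_0 (/ (1 + E))%C).
assert (Q3 := Cmod_ge_0 (RtoC s + 1 + E)%C); assert (Q4 := Cmod_ge_0 eta).
assert (B5 : Cmod (/ D (RtoC s))%C * Cmod (/ (1 + E))%C <= 1) by nra.
apply Rle_trans with (- s * (exp s * (Cmod eta * (- s + 2))) * 1).
- apply Rmult_le_compat; [|nra| |exact B5].
  + repeat apply Rmult_le_pos; lra.
  + apply Rmult_le_compat_l; [lra|]; apply Rmult_le_compat_l; [lra|].
    apply Rmult_le_compat_l; lra.
- replace (- s * (exp s * (Cmod eta * (- s + 2))) * 1)
    with (Cmod eta * ((s ^ 2 - 2 * s) * exp s)) by ring.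
  apply Rmult_le_compat_l; [lra|]; apply Rmult_le_compat_r; nra.
Qed.

Lemma edge_error_right (s : R) : 0 <= s <= b ->
  Cmod (weighted x (zeta + RtoC s) + - (zeta + RtoC s + 1) + zeta * mu (RtoC s) + - RtoC (profile s))%C
  <= Cmod eta * ((2 * s ^ 2 + 4 * s) * exp (- s)).
Proof.
intros Hs; assert (Hs' : - a <= s <= b) by lra.
assert (H := edge_D_neq_0 s Hs'); assert (P := exp_pos s).
assert (H1 := edge_lin_neq_0 s Hs').
rewrite (edge_weighted_right s Hs').
(* On this side [- s mu] remains, with limit [- s / (1 + e^s)]: the same even function as on the
   left. *)
assert (Ep : RtoC (profile s) = (RtoC s * (- / (1 + RtoC (exp s))))%C).
{ unfold profile; rewrite Rabs_pos_eq by lra.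
  rewrite <- RtoC_plus, <- RtoC_inv, <- RtoC_opp, <- RtoC_mult; [f_equal; field|]; lra. }
rewrite Ep; unfold mu in *.
assert (HD : D (RtoC s) = (1 + (1 + RtoC s * eta) * RtoC (exp s))%C)
  by (unfold D; rewrite Cexp_RtoC; reflexivity).
set (E := RtoC (exp s)) in *.
assert (HE : (1 + E)%C <> 0%C).
{ intros K; apply (f_equal Re) in K; cbn in K; lra. }
match goal with |- Cmod ?z <= _ =>
  replace z with (- (RtoC s) * (eta * (/ (1 + RtoC s * eta) * (1 + E) + - (RtoC s * E)) * (/ D (RtoC s) * / (1 + E))))%C
  by (rewrite HD in *; field; auto) end.
rewrite Cmod_mult, Cmod_opp, Cmod_R, Rabs_pos_eq, !Cmod_mult by lra.
assert (L0 := edge_Cmod_lin s Hs').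
assert (B4 : Cmod E = exp s) by (unfold E; rewrite Cmod_R, Rabs_pos_eq; lra).
assert (B6 : Cmod (1 + E) = 1 + exp s)
  by (unfold E; rewrite <- RtoC_plus, Cmod_R, Rabs_pos_eq; lra).
assert (B1 : Cmod (/ D (RtoC s))%C <= / ((1 + exp s) / 2)).
{ apply Cmod_inv_le; [lra|]; assert (K := edge_Cmod_D s Hs'); lra. }
assert (B2 : Cmod (/ (1 + E))%C = / (1 + exp s)) by (rewrite Cmod_inv, B6; auto).
assert (B3 : Cmod (/ (1 + RtoC s * eta) * (1 + E) + - (RtoC s * E))%C <= (2 + s) * (1 + exp s)).
{ eapply Rle_trans; [apply Cmod_triangle|].
  rewrite Cmod_opp, !Cmod_mult, B4, B6, Cmod_R, Rabs_pos_eq by lra; nra. }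
assert (Q1 := Cmod_ge_0 (/ D (RtoC s))%C); assert (Q4 := Cmod_ge_0 eta).
assert (Q3 := Cmod_ge_0 (/ (1 + RtoC s * eta) * (1 + E) + - (RtoC s * E))%C).
rewrite B2.
assert (I1 : 0 < / (1 + exp s)) by (apply Rinv_0_lt_compat; lra).
assert (I2 : / (1 + exp s) <= exp (- s)).
{ rewrite exp_Ropp; apply Rinv_le_contravar; lra. }
apply Rle_trans with (s * (Cmod eta * ((2 + s) * (1 + exp s)) * (/ ((1 + exp s) / 2) * / (1 + exp s)))).
- apply Rmult_le_compat_l; [lra|]; apply Rmult_le_compat.
  + apply Rmult_le_pos; assumption.
  + apply Rmult_le_pos; lra.
  + apply Rmult_le_compat_l; assumption.
  + apply Rmult_le_compat_r; lra.
- replace (s * (Cmod eta * ((2 + s) * (1 + exp s)) * (/ ((1 + exp s) / 2) * / (1 + exp s))))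
    with (Cmod eta * ((2 * s ^ 2 + 4 * s) * / (1 + exp s))) by (field; lra).
  apply Rmult_le_compat_l; [lra|]; apply Rmult_le_compat_l; nra.
Qed.

End Edge.

(** 8 is the integral over the whole half line. *)
Lemma RInt_tail_right (b : R) : 0 <= b ->
  ex_RInt (fun s => (2 * s ^ 2 + 4 * s) * exp (- s)) 0 b /\
  RInt (fun s => (2 * s ^ 2 + 4 * s) * exp (- s)) 0 b <= 8.
Proof.
intros Hb.
assert (K : is_RInt (fun s => (2 * s ^ 2 + 4 * s) * exp (- s)) 0 b
  (minus (- (2 * b ^ 2 + 8 * b + 8) * exp (- b)) (- (2 * 0 ^ 2 + 8 * 0 + 8) * exp (- 0)))).
{ apply (is_RInt_derive (V := R_CompleteNormedModule) (fun s => - (2 * s ^ 2 + 8 * s + 8) * exp (- s))).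
  - intros; auto_derive; [auto|ring].
  - intros; apply (ex_derive_continuous (K := R_AbsRing) (V := R_NormedModule)); auto_derive; auto. }
split; [eexists; exact K|].
rewrite (is_RInt_unique _ _ _ _ K); unfold minus, plus, opp; cbn.
rewrite Ropp_0, exp_0; assert (P := exp_pos (- b)); nra.
Qed.

Lemma RInt_tail_left (a : R) : 0 <= a ->
  ex_RInt (fun s => (2 * s ^ 2 - 4 * s) * exp s) (- a) 0 /\
  RInt (fun s => (2 * s ^ 2 - 4 * s) * exp s) (- a) 0 <= 8.
Proof.
intros Ha.
assert (K : is_RInt (fun s => (2 * s ^ 2 - 4 * s) * exp s) (- a) 0
  (minus ((2 * 0 ^ 2 - 8 * 0 + 8) * exp 0) ((2 * (- a) ^ 2 - 8 * (- a) + 8) * exp (- a)))).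
{ apply (is_RInt_derive (V := R_CompleteNormedModule) (fun s => (2 * s ^ 2 - 8 * s + 8) * exp s)).
  - intros; auto_derive; [auto|ring].
  - intros; apply (ex_derive_continuous (K := R_AbsRing) (V := R_NormedModule)); auto_derive; auto. }
split; [eexists; exact K|].
rewrite (is_RInt_unique _ _ _ _ K); unfold minus, plus, opp; cbn.
rewrite exp_0; assert (P := exp_pos (- a)); nra.
Qed.

(** The primitive of [w + 1], called P in the overview. *)
Definition half_sq (w : C) : C := (w * w * / 2 + w)%C.

Lemma CInt_half_sq (zeta : C) (b : R) : 0 <= b ->
  CInt (fun s => zeta + RtoC s + 1)%C 0 b = (half_sq (zeta + RtoC b) - half_sq zeta)%C.
Proof.
intros Hb.
assert (K : CInt (fun s => zeta + RtoC s + 1)%C 0 b =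
  (half_sq (zeta + RtoC b * 1) - half_sq (zeta + RtoC 0 * 1))%C).
{ apply (CInt_FTC (fun s => half_sq (zeta + RtoC s * 1))); [exact Hb| |].
  - intros t Ht; unfold half_sq.
    eapply cderiv_ext_val; [|apply cderiv_plus; [apply (cderiv_mult (fun s => (zeta + RtoC s * 1) * (zeta + RtoC s * 1))%C);
      [apply cderiv_mult; apply cderiv_line|apply cderiv_const]|apply cderiv_line]].
    cbv beta; field; apply RtoC_neq_0; lra.
  - intros t Ht; apply (cderiv_Ccur _ _ (0 + 1 + 0)%C).
    apply (cderiv_plus (fun s => zeta + RtoC s)%C); [|apply cderiv_const].
    apply cderiv_plus; [apply cderiv_const|apply cderiv_RtoC]. }
rewrite K; do 2 f_equal; [|f_equal]; f_equal; ring.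
Qed.

(** The contributions [zeta log 2] of the two sides cancel. From the far ends there remain
    [zeta Log1 (1 + da)] and [zeta Log1 (1 + db)], exponentially small in [a] and [b] and thus
    harmless despite the factor [zeta]. The constant 32 is four times the tail integral 8: two
    sides, each with the factor 2 of [CInt_bound]. *)
Theorem edge_asymptotic (x zeta : C) (a b : R) :
  zeta <> 0%C -> (zeta * Cexp zeta)%C = (- x)%C -> 0 <= a -> 0 <= b ->
  (forall s, - a <= s <= b -> 1 / 2 <= Re (1 + RtoC s * / zeta)%C) ->
  (1 + a * Cmod (/ zeta)) * exp (- a) <= 1 / 2 -> 2 * exp (- b) <= 1 / 2 ->
  Cmod (CInt (fun s => weighted x (zeta + RtoC s)) (- a) b
    - (half_sq (zeta + RtoC b) - half_sq zeta) - RtoC (RInt profile (- a) b))%C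
  <= 32 * Cmod (/ zeta)%C + 4 * Cmod zeta * ((1 + a * Cmod (/ zeta)) * exp (- a) + 2 * exp (- b)).
Proof.
intros Hz Hr Ha Hb Heta Sa Sb.
set (eta := (/ zeta)%C) in *.
set (lam := fun s => ((eta * Cexp (RtoC s) + (1 + RtoC s * eta) * Cexp (RtoC s)) *
  / (1 + (1 + RtoC s * eta) * Cexp (RtoC s)))%C).
set (mu := fun s => ((1 + RtoC s * eta + eta) * / (1 + RtoC s * eta) *
  / (1 + (1 + RtoC s * eta) * Cexp (RtoC s)))%C).
set (f := fun s => weighted x (zeta + RtoC s)).
assert (CC := edge_Ccont x zeta a b Hz Hr Heta).
assert (f1 : exC f (- a) 0).
{ apply (Ccont_exC (fun w => weighted x (zeta + w))); [lra|]; intros s Hs; apply CC; lra. }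
assert (f2 : exC f 0 b).
{ apply (Ccont_exC (fun w => weighted x (zeta + w))); [lra|]; intros s Hs; apply CC; lra. }
assert (l1 : exC lam (- a) 0).
{ apply (Ccont_exC (fun w => (eta * Cexp w + (1 + w * eta) * Cexp w) * / (1 + (1 + w * eta) * Cexp w))%C); [lra|].
  intros s Hs; apply CC; lra. }
assert (m2 : exC mu 0 b).
{ apply (Ccont_exC (fun w => (1 + w * eta + eta) * / (1 + w * eta) * / (1 + (1 + w * eta) * Cexp w))%C); [lra|].
  intros s Hs; apply CC; lra. }
assert (h2 : exC (fun s => zeta + RtoC s + 1)%C 0 b).
{ apply (Ccont_exC (fun w => zeta + w + 1)%C); [lra|]; intros s Hs.
  ccont. }
assert (p1 := exC_profile (- a) 0); assert (p2 := exC_profile 0 b).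
set (e1 := fun s => (f s + - zeta * lam s + - (1) * RtoC (profile s))%C).
set (e2 := fun s => (f s + - (1) * (zeta + RtoC s + 1) + zeta * mu s + - (1) * RtoC (profile s))%C).
assert (x1 : exC e1 (- a) 0) by (unfold e1; exc).
assert (x2 : exC e2 0 b) by (unfold e2; exc).
assert (I1 : CInt e1 (- a) 0 = (CInt f (- a) 0 + - zeta * CInt lam (- a) 0 + - (1) * RtoC (RInt profile (- a) 0))%C).
{ unfold e1; rewrite !CInt_plus, !CInt_scal, CInt_profile by exc; reflexivity. }
assert (I2 : CInt e2 0 b = (CInt f 0 b + - (1) * (half_sq (zeta + RtoC b) - half_sq zeta)
   + zeta * CInt mu 0 b + - (1) * RtoC (RInt profile 0 b))%C).
{ unfold e2; rewrite !CInt_plus, !CInt_scal, CInt_profile by exc.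
  rewrite (CInt_half_sq zeta b Hb); reflexivity. }
set (da := ((1 + RtoC (- a) * eta) * Cexp (RtoC (- a)))%C).
set (db := (Cexp (- RtoC b) * / (1 + RtoC b * eta))%C).
assert (L1 : CInt lam (- a) 0 = (Log1 2 - Log1 (1 + da))%C)
  by exact (edge_CInt_left x zeta a b Hz Hr Ha Hb Heta).
assert (L2 : CInt mu 0 b = (Log1 2 - Log1 (1 + db))%C)
  by exact (edge_CInt_right x zeta a b Hz Hr Ha Hb Heta).
assert (Na : Cmod da <= (1 + a * Cmod eta) * exp (- a)).
{ unfold da; rewrite Cexp_RtoC, Cmod_mult, (Cmod_R (exp (- a))), (Rabs_pos_eq (exp (- a)))
    by (left; apply exp_pos).
  apply Rmult_le_compat_r; [left; apply exp_pos|].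
  eapply Rle_trans; [apply Cmod_triangle|]; rewrite Cmod_1, Cmod_mult, Cmod_R, Rabs_left1; lra. }
assert (Nb : Cmod db <= 2 * exp (- b)).
{ unfold db; rewrite <- RtoC_opp, Cexp_RtoC, Cmod_mult, Cmod_R, Rabs_pos_eq by (left; apply exp_pos).
  rewrite Rmult_comm; apply Rmult_le_compat_r; [left; apply exp_pos|].
  apply (edge_Cmod_lin zeta a b Heta); lra. }
destruct (Log1_bounds da ltac:(lra)) as [Ga _]; destruct (Log1_bounds db ltac:(lra)) as [Gb _].
assert (Q := Cmod_ge_0 eta); assert (Qz := Cmod_ge_0 zeta).
destruct (RInt_tail_left a Ha) as [T1 T1']; destruct (RInt_tail_right b Hb) as [T2 T2'].
assert (B1 : Cmod (CInt e1 (- a) 0) <= 16 * Cmod eta).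
{ eapply Rle_trans; [apply (CInt_bound e1 (fun s => scal (Cmod eta) ((2 * s ^ 2 - 4 * s) * exp s))); [lra|exact x1| |]|].
  - apply (ex_RInt_scal (V := R_NormedModule)), T1.
  - intros s Hs; unfold e1, scal; cbn -[Cmod exp pow].
    replace (f s + - zeta * lam s + - (1) * RtoC (profile s))%C
      with (f s + - zeta * lam s + - RtoC (profile s))%C by ring.
    apply (edge_error_left x zeta a b Hz Hr Hb Heta); lra.
  - rewrite (RInt_scal (V := R_CompleteNormedModule)) by exact T1; unfold scal; cbn -[Cmod exp pow RInt].
    unfold mult; cbn -[Cmod exp pow RInt]; nra. }
assert (B2 : Cmod (CInt e2 0 b) <= 16 * Cmod eta).
{ eapply Rle_trans; [apply (CInt_bound e2 (fun s => scal (Cmod eta) ((2 * s ^ 2 + 4 * s) * exp (- s)))); [lra|exact x2| |]|].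
  - apply (ex_RInt_scal (V := R_NormedModule)), T2.
  - intros s Hs; unfold e2, scal; cbn -[Cmod exp pow].
    replace (f s + - (1) * (zeta + RtoC s + 1) + zeta * mu s + - (1) * RtoC (profile s))%C
      with (f s + - (zeta + RtoC s + 1) + zeta * mu s + - RtoC (profile s))%C by ring.
    apply (edge_error_right x zeta a b Hz Hr Ha Heta); lra.
  - rewrite (RInt_scal (V := R_CompleteNormedModule)) by exact T2; unfold scal; cbn -[Cmod exp pow RInt].
    unfold mult; cbn -[Cmod exp pow RInt]; nra. }
rewrite <- (CInt_Chasles f (- a) 0 b f1 f2).
rewrite <- (RInt_Chasles (V := R_CompleteNormedModule) profile (- a) 0 b (ex_RInt_profile _ _) (ex_RInt_profile _ _)).
match goal with |- Cmod ?z <= _ =>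
  replace z with (CInt e1 (- a) 0 + CInt e2 0 b + (zeta * (- Log1 (1 + da)) + zeta * Log1 (1 + db)))%C end.
- eapply Rle_trans; [apply Cmod_triangle|].
  assert (X1 := Cmod_triangle (CInt e1 (- a) 0) (CInt e2 0 b)).
  assert (X2 := Cmod_triangle (zeta * (- Log1 (1 + da))) (zeta * Log1 (1 + db))).
  rewrite !Cmod_mult, Cmod_opp in X2.
  assert (Cmod zeta * Cmod (Log1 (1 + da)) <= Cmod zeta * (4 * ((1 + a * Cmod eta) * exp (- a))))
    by (apply Rmult_le_compat_l; lra).
  assert (Cmod zeta * Cmod (Log1 (1 + db)) <= Cmod zeta * (4 * (2 * exp (- b))))
    by (apply Rmult_le_compat_l; lra).
  lra.
- rewrite I1, I2, L1, L2; change (plus ?u ?v) with (u + v); rewrite RtoC_plus; ring.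
Qed.

(** * Estimates on the four edges *)

Lemma CInt_translate (f : C -> C) (zeta : C) (a b : R) :
  exC (fun u => f (u, Im zeta)) a b ->
  CInt (fun u => f (u, Im zeta)) a b =
  CInt (fun s => f (zeta + RtoC s)%C) (a - Re zeta) (b - Re zeta).
Proof.
intros [H1 H2].
assert (G : forall p : R -> R, ex_RInt p a b ->
  RInt p a b = RInt (fun s => p (s + Re zeta)) (a - Re zeta) (b - Re zeta)).
{ intros p Hp; symmetry.
  assert (K := is_RInt_comp_lin (V := R_CompleteNormedModule) p 1 (Re zeta) (a - Re zeta) (b - Re zeta) (RInt p a b)).
  apply is_RInt_unique; eapply is_RInt_ext; [|apply K].
  - intros s _; unfold scal; cbn; unfold mult; cbn; rewrite !Rmult_1_l; reflexivity.
  - replace (1 * (a - Re zeta) + Re zeta) with a by ring.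
    replace (1 * (b - Re zeta) + Re zeta) with b by ring.
    apply (RInt_correct (V := R_CompleteNormedModule)), Hp. }
assert (E : forall s, (zeta + RtoC s)%C = (s + Re zeta, Im zeta)).
{ intros s; apply C_ext; cbn; unfold Re, Im; ring. }
unfold CInt; rewrite (G _ H1), (G _ H2); f_equal; apply RInt_ext; intros s _; rewrite E; reflexivity.
Qed.

Lemma ln_le_half (y : R) : 0 < y -> ln y <= y / 2.
Proof.
intros H; assert (K := ln_le_sub1 (y / 2) ltac:(lra)).
assert (E : ln y = ln (y / 2) + ln 2) by (rewrite <- ln_mult by lra; f_equal; field).
assert (K2 := ln_le_sub1 2 ltac:(lra)); lra.
Qed.

Lemma PI_bounds : 3 < PI <= 4.
Proof. split; [assert (K := PI2_3_2); unfold PI2 in K; lra|apply PI_4]. Qed.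

(** The imaginary part comes first, since the argument is at most [PI]. Then
    [Re zeta = al - ln |zeta|] with [ln y <= y / 2] bounds the modulus, and feeding this back into
    the logarithm bounds the real part. The sign [sg] serves both horizontal edges. *)
Lemma w_plus_log_size (zeta : C) (al be N sg : R) :
  zeta <> 0%C -> (zeta + Clog zeta)%C = (al, be) -> sg * sg = 1 ->
  Rabs (be - sg * N) <= PI -> Rabs al + 20 <= N ->
  Rabs (Im zeta - sg * N) <= 2 * PI /\ N / 2 <= Cmod zeta <= 4 * N /\
  Rabs (Re zeta) <= Rabs al + ln N + 3.
Proof.
intros Hz E Hs Hb HN; assert (P := PI_bounds).
assert (B := Im_Clog_bound zeta Hz).
assert (Er := f_equal Re E); assert (Ei := f_equal Im E).
change (Re zeta + ln (Cmod zeta) = al) in Er; change (Im zeta + Im (Clog zeta) = be) in Ei.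
assert (A0 := Rabs_pos al).
assert (Hi : Rabs (Im zeta - sg * N) <= 2 * PI).
{ replace (Im zeta - sg * N) with ((be - sg * N) + - Im (Clog zeta)) by lra.
  eapply Rle_trans; [apply Rabs_triang|]; rewrite Rabs_Ropp.
  assert (Rabs (Im (Clog zeta)) <= PI) by (apply Rabs_le; lra); lra. }
assert (Hs1 : Rabs sg = 1).
{ assert (K : Rabs sg * Rabs sg = 1) by (rewrite <- Rabs_mult, Hs; apply Rabs_R1).
  assert (K2 := Rabs_pos sg); nra. }
assert (Hsn : Rabs (sg * N) = N) by (rewrite Rabs_mult, Hs1, (Rabs_pos_eq N); lra).
assert (I1 : Rabs (Im zeta) <= N + 2 * PI).
{ replace (Im zeta) with ((Im zeta - sg * N) + sg * N) by ring.
  eapply Rle_trans; [apply Rabs_triang|]; lra. }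
assert (I2 : N - 2 * PI <= Rabs (Im zeta)).
{ assert (K := Rabs_triang_inv (sg * N) (Im zeta)); rewrite Rabs_minus_sym in Hi;
  assert (K3 := Rabs_triang (sg * N - Im zeta) (Im zeta)).
  replace (sg * N - Im zeta + Im zeta) with (sg * N) in K3 by ring; lra. }
assert (L := Im_le_Cmod zeta).
assert (Hc : 0 < Cmod zeta) by (apply Cmod_gt_0, Hz).
assert (L0 : 0 <= ln (Cmod zeta)) by (rewrite <- ln_1; apply ln_le; lra).
assert (L1 := ln_le_half (Cmod zeta) Hc).
assert (U := Cmod_le_Re_Im zeta).
assert (R1 : Rabs (Re zeta) <= Rabs al + ln (Cmod zeta)).
{ replace (Re zeta) with (al + - ln (Cmod zeta)) by lra.
  eapply Rle_trans; [apply Rabs_triang|]; rewrite Rabs_Ropp, (Rabs_pos_eq (ln _)); lra. }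
assert (C4 : Cmod zeta <= 4 * N) by lra.
split; [exact Hi|]; split; [lra|].
assert (L2 : ln (Cmod zeta) <= ln 4 + ln N).
{ rewrite <- ln_mult by lra; apply ln_le; lra. }
assert (K2 := ln_le_sub1 4 ltac:(lra)); lra.
Qed.

Lemma profile_tail (N p q : R) : 0 < N -> N / 2 <= p <= 2 * N -> N / 2 <= q <= 2 * N ->
  Rabs (RInt profile p q) <= 4 * N ^ 2 * exp (- (N / 2)).
Proof.
intros HN Hp Hq.
assert (G : forall p q, p <= q -> N / 2 <= p -> q <= 2 * N -> Rabs (RInt profile p q) <= 4 * N ^ 2 * exp (- (N / 2))).
{ clear; intros p q Hpq Hp Hq; destruct (Rle_dec N 0) as [H0|H0].
  - replace q with p by lra; rewrite RInt_point; unfold zero; cbn; rewrite Rabs_R0.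
    assert (P := exp_pos (- (N / 2))); nra.
  - eapply Rle_trans; [apply (abs_RInt_le_const profile p q (2 * N * exp (- (N / 2))))|].
    + exact Hpq.
    + apply ex_RInt_profile.
    + intros t Ht; unfold profile; rewrite (Rabs_pos_eq t) by lra.
      assert (P := exp_pos t); rewrite Rabs_div, Rabs_Ropp, (Rabs_pos_eq t), (Rabs_pos_eq (1 + exp t)) by lra.
      apply Rle_trans with (t * exp (- t)).
      * rewrite exp_Ropp; apply Rmult_le_compat_l; [lra|]; apply Rinv_le_contravar; lra.
      * apply Rmult_le_compat; try lra; [left; apply exp_pos|].
        destruct (Req_dec t (N / 2)) as [->|]; [lra|left; apply exp_increasing; lra].
    + assert (P := exp_pos (- (N / 2))).
      replace (4 * N ^ 2 * exp (- (N / 2))) with ((2 * N) * (2 * N * exp (- (N / 2)))) by ring.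
      apply Rmult_le_compat_r; [|lra]; apply Rmult_le_pos; lra. }
destruct (Rle_dec p q) as [H|H]; [apply G; lra|].
rewrite <- (opp_RInt_swap (V := R_CompleteNormedModule)) by apply ex_RInt_profile.
change (Rabs (- RInt profile q p) <= 4 * N ^ 2 * exp (- (N / 2))); rewrite Rabs_Ropp; apply G; lra.
Qed.

(** The two edges see different windows because zeta_+ and zeta_- have different real parts.
    Evenness of [profile] folds the discrepancy onto positive arguments, where [profile_tail]
    applies. *)
Lemma profile_windows (N a1 b1 a2 b2 : R) : 0 < N ->
  N / 2 <= a1 <= 2 * N -> N / 2 <= b1 <= 2 * N -> N / 2 <= a2 <= 2 * N -> N / 2 <= b2 <= 2 * N ->
  Rabs (RInt profile (- a1) b1 - RInt profile (- a2) b2) <= 8 * N ^ 2 * exp (- (N / 2)).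
Proof.
intros HN H1 H2 H3 H4.
assert (Ch : forall p q r, RInt profile p q + RInt profile q r = RInt profile p r)
  by (intros; exact (RInt_Chasles (V := R_CompleteNormedModule) profile p q r (ex_RInt_profile _ _) (ex_RInt_profile _ _))).
assert (Ev : forall p q, RInt profile (- p) (- q) = - RInt profile p q).
{ intros p q.
  assert (K := is_RInt_comp_opp (V := R_CompleteNormedModule) profile p q _
    (RInt_correct (V := R_CompleteNormedModule) _ _ _ (ex_RInt_profile (- p) (- q)))).
  apply is_RInt_unique in K; transitivity (RInt (fun y => opp (profile y)) p q).
  - rewrite <- K; apply RInt_ext; intros s _; unfold profile; rewrite Rabs_Ropp; reflexivity.
  - exact (RInt_opp (V := R_CompleteNormedModule) profile p q (ex_RInt_profile p q)). }
rewrite <- (Ch (- a1) (- a2) b1), <- (Ch (- a2) b2 b1), Ev.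
replace (- RInt profile a1 a2 + (RInt profile (- a2) b2 + RInt profile b2 b1) - RInt profile (- a2) b2)
  with (- RInt profile a1 a2 + RInt profile b2 b1) by ring.
eapply Rle_trans; [apply Rabs_triang|]; rewrite Rabs_Ropp.
assert (K1 := profile_tail N a1 a2 HN H1 H3); assert (K2 := profile_tail N b2 b1 HN H4 H2); lra.
Qed.

(** [N^3 e^(-N/2)] majorises all exponentially small terms. The second condition gives
    [|Re zeta| <= N / 16]; its 11 is the 3 of [w_plus_log_size] plus [2 * PI <= 8]. The third lets
    [w e^w] dominate [x] on the right edge, and the last lets [x] dominate on the left edge. *)
Definition big_enough (x : C) (N : R) : Prop :=
  20 <= N /\ 16 * (Rabs (Re (Clog x)) + ln N + 11) <= N /\ 2 * Cmod x <= N /\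
  10 * (N ^ 3 * exp (- (N / 2))) <= 1 /\ 10 * (N ^ 3 * exp (- (N / 2))) <= Cmod x.

Lemma horizontal_edge (x zeta : C) (be N sg : R) :
  big_enough x N ->
  zeta <> 0%C -> (zeta + Clog zeta)%C = (Re (Clog x), be) -> sg * sg = 1 ->
  Rabs (be - sg * N) <= PI -> (zeta * Cexp zeta)%C = (- x)%C ->
  exists a b, N / 2 <= a <= 2 * N /\ N / 2 <= b <= 2 * N /\
  (forall u, - N <= u <= N -> root_fun x (u, Im zeta) <> 0%C) /\
  Cmod (CInt (fun u => weighted x (u, Im zeta)) (- N) N
    - (half_sq (N, Im zeta) - half_sq zeta) - RtoC (RInt profile (- a) b))%C
  <= 64 / N + 112 * (N ^ 3 * exp (- (N / 2))).
Proof.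
intros (N1 & N2 & N3 & N4 & N5) Hz E Hs Hb Hr.
assert (P := PI_bounds).
assert (A0 := Rabs_pos (Re (Clog x))).
assert (LN : 0 <= ln N) by (rewrite <- ln_1; apply ln_le; lra).
destruct (w_plus_log_size zeta _ be N sg Hz E Hs Hb ltac:(lra)) as (Hi & [Z1 Z2] & HR).
assert (HR' : Rabs (Re zeta) <= N / 16) by lra.
apply Rabs_le_between in HR'.
(* The distances from [Re zeta] to the two ends of the edge: the window in the coordinate
   [s = w - zeta]. *)
set (a := N + Re zeta); set (b := N - Re zeta).
assert (Pe := exp_pos (- (N / 2))).
set (tau := N ^ 3 * exp (- (N / 2))) in *.
assert (T1 : N * exp (- (N / 2)) <= tau / 400).
{ unfold tau; assert (N * N >= 400) by nra.
  replace (N ^ 3 * exp (- (N / 2)) / 400) with ((N * exp (- (N / 2))) * (N * N / 400)) by field.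
  assert (0 < N * exp (- (N / 2))) by (apply Rmult_lt_0_compat; lra). nra. }
assert (T0 : exp (- (N / 2)) <= tau / 400) by nra.
assert (Ea : exp (- a) <= exp (- (N / 2))) by (left; apply exp_increasing; unfold a; lra).
assert (Eb : exp (- b) <= exp (- (N / 2))) by (left; apply exp_increasing; unfold b; lra).
assert (Ie : Cmod (/ zeta)%C <= 2 / N).
{ replace (2 / N) with (/ (N / 2)) by (field; lra); apply Cmod_inv_le; lra. }
assert (Ie0 := Cmod_ge_0 (/ zeta)%C).
assert (aI : a * Cmod (/ zeta)%C <= 4).
{ apply Rle_trans with ((2 * N) * (2 / N)); [apply Rmult_le_compat; unfold a; lra|right; field; lra]. }
assert (Heta : forall s, - a <= s <= b -> 1 / 2 <= Re (1 + RtoC s * / zeta)%C).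
{ intros s Hs'.
  replace (Re (1 + RtoC s * / zeta)%C) with (1 + s * Re (/ zeta)%C) by (cbn; unfold Re, Im; ring).
  assert (Hq : Re zeta * Re zeta + Im zeta * Im zeta = Cmod zeta ^ 2) by (rewrite Cmod2_alt; ring).
  rewrite Re_inv, Hq.
  assert (Hq2 : N * N / 4 <= Cmod zeta ^ 2) by nra.
  assert (Hs2 : Rabs s <= 2 * N) by (apply Rabs_le; unfold a, b in Hs'; lra).
  (* [|s| <= 2 N], [|Re zeta| <= N / 16] and [|zeta|^2 >= N^2 / 4] combine to exactly 1/2. *)
  assert (K : Rabs (s * (Re zeta / Cmod zeta ^ 2)) <= 1 / 2).
  { rewrite Rabs_mult, Rabs_div, (Rabs_pos_eq (Cmod zeta ^ 2)) by nra.
    apply Rle_trans with (2 * N * ((N / 16) * / (N * N / 4))).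
    - apply Rmult_le_compat; [apply Rabs_pos| |exact Hs2|].
      + apply Rmult_le_pos; [apply Rabs_pos|left; apply Rinv_0_lt_compat; nra].
      + apply Rmult_le_compat; [apply Rabs_pos|left; apply Rinv_0_lt_compat; nra|apply Rabs_le; lra|].
        apply Rinv_le_contravar; nra.
    - right; field; lra. }
  apply Rabs_le_between in K; lra. }
assert (RF : forall u, - N <= u <= N -> root_fun x (u, Im zeta) <> 0%C).
{ intros u Hu; replace (u, Im zeta) with (zeta + RtoC (u - Re zeta))%C
    by (apply C_ext; cbn; unfold Re, Im; ring).
  apply (edge_root_neq_0 x zeta a b Hz Hr Heta); unfold a, b; lra. }
exists a, b; split; [unfold a; lra|split; [unfold b; lra|split; [exact RF|]]].
assert (Sa : (1 + a * Cmod (/ zeta)%C) * exp (- a) <= 5 * exp (- (N / 2))).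
{ apply Rmult_le_compat; try lra; [|left; apply exp_pos].
  assert (0 <= a * Cmod (/ zeta)%C) by (apply Rmult_le_pos; unfold a; lra); lra. }
assert (K := edge_asymptotic x zeta a b Hz Hr ltac:(unfold a; lra) ltac:(unfold b; lra) Heta ltac:(lra) ltac:(lra)).
rewrite (CInt_translate (weighted x) zeta).
- replace (- N - Re zeta) with (- a) by (unfold a; ring); fold b.
  replace (N, Im zeta) with (zeta + RtoC b)%C by (unfold b; apply C_ext; cbn; unfold Re, Im; ring).
  eapply Rle_trans; [exact K|].
  assert (32 * Cmod (/ zeta)%C <= 64 / N) by (replace (64 / N) with (32 * (2 / N)) by (field; lra); lra).
  assert (4 * Cmod zeta * ((1 + a * Cmod (/ zeta)%C) * exp (- a) + 2 * exp (- b)) <=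
    4 * (4 * N) * (7 * exp (- (N / 2)))).
  { apply Rmult_le_compat; try lra.
    assert (0 <= (1 + a * Cmod (/ zeta)%C) * exp (- a)).
    { apply Rmult_le_pos; [|left; apply exp_pos].
      assert (0 <= a * Cmod (/ zeta)%C) by (apply Rmult_le_pos; unfold a; lra); lra. }
    assert (Pb := exp_pos (- b)); lra. }
  assert (0 < tau) by (unfold tau; apply Rmult_lt_0_compat; [apply pow_lt; lra|exact Pe]).
  nra.
- apply (exC_horizontal (weighted x)); [lra|]; intros u Hu; apply Ccont_weighted, RF, Hu.
Qed.

Lemma CInt_vertical_half_sq (N c d : R) : c <= d ->
  (Ci * CInt (fun v => (N, v) + 1) c d)%C = (half_sq (N, d) - half_sq (N, c))%C.
Proof.
intros Hcd.
assert (Hc : forall t, cderiv (fun v => ((N, v) + 1)%C) t (Ci + 0)%C).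
{ intros t; apply cderiv_plus; [apply cderiv_vertical|apply cderiv_const]. }
assert (Hx : exC (fun v => ((N, v) + 1)%C) c d).
{ apply exC_cont; [exact Hcd|]; intros t _; exact (cderiv_Ccur _ _ _ (Hc t)). }
rewrite <- CInt_scal by exact Hx.
apply (CInt_FTC (fun v => half_sq (N, v))); [exact Hcd| |].
- intros t _; unfold half_sq.
  eapply cderiv_ext_val; [|apply cderiv_plus; [apply (cderiv_mult (fun v => (N, v) * (N, v))%C);
    [apply cderiv_mult; apply cderiv_vertical|apply cderiv_const]|apply cderiv_vertical]].
  cbv beta; field; apply RtoC_neq_0; lra.
- intros t _; eapply cderiv_Ccur, (cderiv_mult (fun _ => Ci)); [apply cderiv_const|apply Hc].
Qed.

(** With [F = root_fun x w], the integrand differs from [w + 1] by [(w + 1) x / F], and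
    [|F| >= |w| e^N / 2] on this edge. *)
Lemma right_edge (x : C) (N c d : R) : big_enough x N -> -2 * N <= c <= d -> d <= 2 * N ->
  (forall v, root_fun x (N, v) <> 0%C) /\
  Cmod (Ci * CInt (fun v => weighted x (N, v)) c d - (half_sq (N, d) - half_sq (N, c)))%C
  <= 32 * Cmod x * (N ^ 3 * exp (- (N / 2))).
Proof.
intros (N1 & N2 & N3 & N4 & N5) Hcd Hd.
assert (Px := Cmod_ge_0 x); assert (PE := exp_pos N).
assert (E1 : 1 <= exp N) by (assert (K := exp_ineq1_le N); lra).
assert (Hw : forall v, N <= Cmod (N, v)).
{ intros v; eapply Rle_trans; [|apply (re_le_Cmod (N, v))]; cbn; rewrite Rabs_pos_eq; lra. }
assert (Hm : forall v, Cmod ((N, v) * Cexp (N, v)) = Cmod (N, v) * exp N).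
{ intros v; rewrite Cmod_mult, Cmod_Cexp; reflexivity. }
assert (Hlow : forall v, Cmod (N, v) * exp N / 2 <= Cmod (root_fun x (N, v))).
{ intros v; unfold root_fun.
  assert (T := Cmod_triangle ((N, v) * Cexp (N, v) + - x) x).
  replace ((N, v) * Cexp (N, v) + - x + x)%C with ((N, v) * Cexp (N, v))%C in T by ring.
  rewrite Hm in T; specialize (Hw v).
  assert (Cmod x <= Cmod (N, v) * exp N / 2) by nra; lra. }
assert (Hne : forall v, root_fun x (N, v) <> 0%C).
{ intros v; apply Cmod_gt_0; specialize (Hlow v); specialize (Hw v); nra. }
split; [exact Hne|].
assert (Hx : exC (fun v => weighted x (N, v)) c d).
{ apply exC_vertical; [lra|]; intros v _; apply Ccont_weighted, Hne. }
assert (Hl : exC (fun v => ((N, v) + 1)%C) c d).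
{ apply (exC_vertical (fun w => w + 1)%C); [lra|]; intros v _; ccont. }
rewrite <- CInt_vertical_half_sq by lra.
replace (Ci * CInt (fun v => weighted x (N, v)) c d - Ci * CInt (fun v => (N, v) + 1) c d)%C
  with (Ci * CInt (fun v => weighted x (N, v) + - (1) * ((N, v) + 1)) c d)%C.
2: { rewrite (CInt_plus (fun v => weighted x (N, v))), CInt_scal; auto; [ring|].
     apply (exC_scal _ (fun v => (N, v) + 1)%C), Hl. }
rewrite Cmod_mult, Cmod_Ci, Rmult_1_l.
eapply Rle_trans; [apply (CInt_bound_const _ (4 * Cmod x * exp (- N)))|].
- lra.
- apply exC_plus; [exact Hx|apply (exC_scal _ (fun v => (N, v) + 1)%C), Hl].
- intros v _; set (w := (N, v)) in *; specialize (Hlow v); specialize (Hw v); specialize (Hne v); fold w in Hlow, Hw, Hne.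
  replace (weighted x w + - (1) * (w + 1))%C with ((w + 1) * x * / root_fun x w)%C
    by (unfold weighted, root_fun in *; field; exact Hne).
  rewrite !Cmod_mult, exp_Ropp.
  assert (W1 : Cmod (w + 1) <= 2 * Cmod w).
  { eapply Rle_trans; [apply Cmod_triangle|]; rewrite Cmod_1; lra. }
  assert (Hp : 0 < Cmod w * exp N / 2) by nra.
  assert (I := Cmod_inv_le _ _ Hp Hlow).
  assert (I0 := Cmod_ge_0 (/ root_fun x w)%C).
  apply Rle_trans with (2 * Cmod w * Cmod x * / (Cmod w * exp N / 2)).
  + apply Rmult_le_compat; auto.
    * apply Rmult_le_pos; [apply Cmod_ge_0|exact Px].
    * apply Rmult_le_compat_r; auto.
  + right; field; split; lra.
- assert (PN := exp_pos (- (N / 2))).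
  assert (EN : exp (- N) <= exp (- (N / 2))) by (left; apply exp_increasing; lra).
  assert (PN' := exp_pos (- N)).
  apply Rle_trans with (2 * ((4 * N) * (4 * Cmod x * exp (- (N / 2))))).
  + apply Rmult_le_compat_l; [lra|]; apply Rmult_le_compat; try lra.
    * repeat apply Rmult_le_pos; lra.
    * apply Rmult_le_compat_l; lra.
  + replace (2 * (4 * N * (4 * Cmod x * exp (- (N / 2))))) with (32 * Cmod x * (N * exp (- (N / 2)))) by ring.
    apply Rmult_le_compat_l; [lra|]; apply Rmult_le_compat_r; [lra|]; nra.
Qed.

(** Here [w e^w] is exponentially small, so [|root_fun x w| >= |x| / 2] and the integrand itself is
    negligible. *)
Lemma left_edge (x : C) (N c d : R) : x <> 0%C -> big_enough x N -> -2 * N <= c <= d -> d <= 2 * N ->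
  (forall v, c <= v <= d -> root_fun x (- N, v)%R <> 0%C) /\
  Cmod (Ci * CInt (fun v => weighted x (- N, v)%R) c d)%C
  <= 192 / Cmod x * (N ^ 3 * exp (- (N / 2))).
Proof.
intros Hx0 (N1 & N2 & N3 & N4 & N5) Hcd Hd.
assert (Px : 0 < Cmod x) by (apply Cmod_gt_0, Hx0).
assert (PN := exp_pos (- (N / 2))); assert (PN' := exp_pos (- N)).
assert (EN : exp (- N) <= exp (- (N / 2))) by (left; apply exp_increasing; lra).
assert (Hw : forall v, c <= v <= d -> Cmod (- N, v)%R <= 3 * N).
{ intros v Hv; eapply Rle_trans; [apply Cmod_le_Re_Im|]; cbn.
  assert (Rabs v <= 2 * N) by (apply Rabs_le; lra); rewrite Rabs_Ropp, Rabs_pos_eq; lra. }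
assert (Hm : forall v, Cmod ((- N, v)%R * Cexp (- N, v)%R) = Cmod (- N, v)%R * exp (- N)).
{ intros v; rewrite Cmod_mult, Cmod_Cexp; reflexivity. }
assert (Hlow : forall v, c <= v <= d -> Cmod x / 2 <= Cmod (root_fun x (- N, v)%R)).
{ intros v Hv; unfold root_fun.
  assert (T := Cmod_triangle (- ((- N, v)%R * Cexp (- N, v)%R + - x)) ((- N, v)%R * Cexp (- N, v)%R)).
  replace (- ((- N, v)%R * Cexp (- N, v)%R + - x) + (- N, v)%R * Cexp (- N, v)%R)%C with x in T by ring.
  rewrite Cmod_opp, Hm in T; specialize (Hw v Hv).
  assert (G := Cmod_ge_0 (- N, v)%R).
  assert (Cmod (- N, v)%R * exp (- N) <= 3 * N * exp (- (N / 2))) by (apply Rmult_le_compat; lra).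
  assert (N * exp (- (N / 2)) <= N ^ 3 * exp (- (N / 2))) by (apply Rmult_le_compat_r; [lra|]; nra).
  lra. }
assert (Hne : forall v, c <= v <= d -> root_fun x (- N, v)%R <> 0%C).
{ intros v Hv; apply Cmod_gt_0; specialize (Hlow v Hv); lra. }
split; [exact Hne|].
assert (Hx : exC (fun v => weighted x (- N, v)%R) c d).
{ apply exC_vertical; [lra|]; intros v Hv; apply Ccont_weighted, Hne, Hv. }
rewrite Cmod_mult, Cmod_Ci, Rmult_1_l.
eapply Rle_trans; [apply (CInt_bound_const _ (24 * N ^ 2 * exp (- N) / Cmod x)); [lra|exact Hx|]|].
- intros v Hv; set (w := (- N, v)%R) in *.
  specialize (Hlow v ltac:(lra)); specialize (Hw v ltac:(lra)); fold w in Hlow, Hw.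
  unfold weighted; rewrite !Cmod_mult, Cmod_Cexp; change (Re w) with (- N).
  assert (W1 : Cmod (1 + w) <= 4 * N).
  { eapply Rle_trans; [apply Cmod_triangle|]; rewrite Cmod_1; lra. }
  assert (Hp : 0 < Cmod x / 2) by lra.
  assert (I := Cmod_inv_le _ _ Hp Hlow).
  assert (I0 := Cmod_ge_0 (/ root_fun x w)%C); assert (G := Cmod_ge_0 w); assert (G1 := Cmod_ge_0 (1 + w)%C).
  apply Rle_trans with (3 * N * (4 * N * exp (- N)) * / (Cmod x / 2)).
  + apply Rmult_le_compat; auto.
    * repeat apply Rmult_le_pos; lra.
    * apply Rmult_le_compat; try lra; [apply Rmult_le_pos; lra|apply Rmult_le_compat_r; lra].
  + right; field; lra.
- apply Rle_trans with (2 * ((4 * N) * (24 * N ^ 2 * exp (- (N / 2)) / Cmod x))).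
  + apply Rmult_le_compat_l; [lra|].
    assert (Q : 0 < / Cmod x) by (apply Rinv_0_lt_compat, Px).
    assert (N2p : 0 <= N ^ 2) by nra.
    apply Rmult_le_compat; try lra; unfold Rdiv.
    * repeat apply Rmult_le_pos; lra.
    * apply Rmult_le_compat_r; [lra|]; apply Rmult_le_compat_l; lra.
  + right; field; lra.
Qed.

(** * Asymptotics of the sum over the branches *)

Definition half_period (K : nat) : R := (2 * INR K + 1) * PI.

(* Solutions of [w e^w = - x] halfway between [W_K] and [W_(K+1)] (for [sg = 1]),
   or between [W_(-K-1)] and [W_(-K)] (for [sg = -1]). *)
Lemma halfway_point (x : C) (K : nat) (sg : R) : x <> 0%C -> (1 <= K)%nat -> sg = 1 \/ sg = -1 ->
  exists zeta : C, zeta <> 0%C /\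
    (zeta + Clog zeta)%C = (Re (Clog x), Im (Clog x) + sg * half_period K) /\
    (zeta * Cexp zeta)%C = (- x)%C /\ 0 < sg * Im zeta.
Proof.
intros Hx HK Hsg; assert (P := PI_bounds); assert (B := Im_Clog_bound x Hx).
assert (HN : 3 * PI <= half_period K).
{ unfold half_period; apply Rmult_le_compat_r; [lra|].
  apply le_INR in HK; simpl in HK; lra. }
destruct (w_plus_log_exists_unique (Re (Clog x)) (Im (Clog x) + sg * half_period K)) as [zeta [[H1 H2] _]].
(* As [1 <= K], the imaginary part has modulus at least [2 * PI], so the degenerate case of the
   existence theorem does not arise. *)
{ intros E; exfalso; unfold Rabs in E; destruct (Rcase_abs _); destruct Hsg; subst sg; lra. }
exists zeta; split; [exact H1|split; [exact H2|split]].
- rewrite <- (Cexp_Clog zeta H1) at 1; rewrite <- Cexp_plus.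
  replace (Clog zeta + zeta)%C with (zeta + Clog zeta)%C by ring; rewrite H2.
  assert (Ec : cos (Im (Clog x) + sg * half_period K) = - cos (Im (Clog x)) /\
               sin (Im (Clog x) + sg * half_period K) = - sin (Im (Clog x))).
  { assert (C2 : forall t, cos (t + half_period K) = - cos t /\ sin (t + half_period K) = - sin t).
    { intros t; replace (t + half_period K) with (t + PI + 2 * INR K * PI) by (unfold half_period; ring).
      rewrite cos_period, sin_period, neg_cos, neg_sin; split; reflexivity. }
    destruct Hsg as [-> | ->].
    - replace (Im (Clog x) + 1 * half_period K) with (Im (Clog x) + half_period K) by ring; apply C2.
    - destruct (C2 (Im (Clog x) + -1 * half_period K)) as [E1 E2].
      replace (Im (Clog x) + -1 * half_period K + half_period K) with (Im (Clog x)) in E1, E2 by ring.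
      split; lra. }
  destruct Ec as [E1 E2].
  rewrite <- (Cexp_Clog x Hx) at 3.
  apply C_ext; cbn -[Clog cos sin half_period]; change (fst (Clog x)) with (Re (Clog x));
   [rewrite E1|rewrite E2]; unfold Cexp; cbn -[Clog cos sin]; unfold Re, Im; ring.
- assert (Ei := f_equal Im H2).
  change (Im zeta + Im (Clog zeta) = Im (Clog x) + sg * half_period K) in Ei.
  assert (B2 := Im_Clog_bound zeta H1).
  destruct Hsg; subst sg; lra.
Qed.

(** [N] is an odd multiple of [PI], so [2 k PI] stays at distance at least [PI] from [N] and [- N];
    this gap outweighs the possible change of argument and decides on which side of each horizontal
    edge a value lies. The real parts are controlled by [|w| e^(Re w) = |x|]. *)
Lemma roots_in_rectangle (x : C) (K : nat) (zp zm : C) :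
  x <> 0%C -> (1 <= K)%nat -> big_enough x (half_period K) ->
  0 < Im zp <= 2 * half_period K -> - 2 * half_period K <= Im zm < 0 ->
  Im zp + Im (Clog zp) = Im (Clog x) + half_period K ->
  Im zm + Im (Clog zm) = Im (Clog x) - half_period K ->
  (forall j, (j <= 2 * K)%nat ->
     - half_period K < Re (W_shift K x j) < half_period K /\ Im zm < Im (W_shift K x j) < Im zp) /\
  (forall k u v, - half_period K <= u <= half_period K -> Im zm <= v <= Im zp ->
     LambertW k x = (u, v) -> (- Z.of_nat K <= k <= Z.of_nat K)%Z).
Proof.
intros Hx HK (N1 & N2 & N3 & N4 & N5) Hp Hm Ep Em.
assert (P := PI_bounds).
assert (Tp := Im_Clog_upper zp (proj1 Hp)); assert (Tm := Im_Clog_lower zm (proj2 Hm)).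
set (N := half_period K) in *.
assert (HN : N = 2 * IZR (Z.of_nat K) * PI + PI) by (unfold N, half_period; rewrite INR_IZR_INZ; ring).
assert (Px : 0 < Cmod x) by (apply Cmod_gt_0, Hx).
assert (Re_im : forall k, (- Z.of_nat K <= k <= Z.of_nat K)%Z -> Im zm < Im (LambertW k x) < Im zp).
{ intros k Hk; assert (Hk1 := IZR_le _ _ (proj1 Hk)); assert (Hk2 := IZR_le _ _ (proj2 Hk)).
  rewrite opp_IZR in Hk1.
  assert (M1 : 2 * IZR k * PI <= N - PI) by (rewrite HN; nra).
  assert (M2 : - N + PI <= 2 * IZR k * PI) by (rewrite HN; nra).
  destruct (LambertW_cases k x Hx) as [[H1 H2]|(_ & H & _)]; [|rewrite H; lra].
  apply Im_branch in H2; set (w := LambertW k x) in *.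
  destruct (Rtotal_order (Im w) 0) as [S|[S|S]].
  - assert (T := Im_Clog_lower w S); lra.
  - lra.
  - assert (T := Im_Clog_upper w S); lra. }
split.
- intros j Hj; assert (I := Re_im (Z.of_nat j - Z.of_nat K)%Z ltac:(lia)).
  assert (R := LambertW_root (Z.of_nat j - Z.of_nat K) x Hx).
  fold (W_shift K x j) in I, R; set (w := W_shift K x j) in *.
  split; [|exact I].
  apply (f_equal Cmod) in R; rewrite Cmod_mult, Cmod_Cexp in R.
  assert (Hw : Cmod w <= Rabs (Re w) + 2 * N).
  { eapply Rle_trans; [apply Cmod_le_Re_Im|].
    assert (Rabs (Im w) <= 2 * N) by (apply Rabs_le; lra); lra. }
  assert (Hw2 := re_le_Cmod w).
  split; apply Rnot_le_lt; intros L.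
  (* With [r = - Re w >= N] one has [|w| <= 3 r]. Half of the exponential absorbs [r], and what
     remains is at most [6 e^(-N/2)], contradicting the last condition of [big_enough]. *)
  + rewrite Rabs_left in Hw by lra.
    set (r := - Re w) in *; assert (Hr : N <= r) by (unfold r; lra).
    replace (Re w) with (- (r / 2) + - (r / 2)) in R by (unfold r; lra).
    rewrite exp_plus in R.
    assert (E1 : r / 2 * exp (- (r / 2)) <= 1).
    { assert (K1 := exp_ineq1_le (r / 2)).
      assert (K2 : exp (r / 2) * exp (- (r / 2)) = 1) by (rewrite <- exp_plus, Rplus_opp_r; apply exp_0).
      assert (K3 := exp_pos (- (r / 2))); nra. }
    assert (E2 : exp (- (r / 2)) <= exp (- (N / 2))).
    { destruct (Req_dec r N) as [->|]; [lra|left; apply exp_increasing; lra]. }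
    assert (E0 := exp_pos (- (r / 2))); assert (E3 := exp_pos (- (N / 2))).
    assert (Cmod w * (exp (- (r / 2)) * exp (- (r / 2))) <= 6 * exp (- (N / 2))).
    { apply Rle_trans with ((3 * r) * (exp (- (r / 2)) * exp (- (r / 2)))).
      - apply Rmult_le_compat_r; nra.
      - replace (3 * r * (exp (- (r / 2)) * exp (- (r / 2))))
          with (6 * ((r / 2 * exp (- (r / 2))) * exp (- (r / 2)))) by field.
        apply Rmult_le_compat_l; [lra|]. nra. }
    assert (exp (- (N / 2)) <= N ^ 3 * exp (- (N / 2))).
    { rewrite <- (Rmult_1_l (exp (- (N / 2)))) at 1; apply Rmult_le_compat_r; [lra|].
      assert (400 <= N * N) by nra. simpl; nra. }
    lra.
  + rewrite Rabs_pos_eq in Hw2 by lra.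
    assert (E1 := exp_ineq1_le (Re w)).
    assert (N * 1 <= Cmod w * exp (Re w)) by (apply Rmult_le_compat; lra).
    lra.
- intros k u v Hu Hv E.
  destruct (LambertW_cases k x Hx) as [[H1 H2]|(_ & _ & _ & _ & [[-> _]|[-> _]])]; [|lia|lia].
  apply Im_branch in H2.
  assert (Ew : Im (LambertW k x) = v) by (rewrite E; reflexivity).
  set (w := LambertW k x) in *.
  assert (T := Im_Clog_bound w H1).
  split; apply Z.nlt_ge; intros L.
  + assert (L' : (k <= - Z.of_nat K - 1)%Z) by lia; apply IZR_le in L'.
    rewrite minus_IZR, opp_IZR in L'.
    assert (2 * IZR k * PI <= - N - PI) by (rewrite HN; nra). lra.
  + assert (L' : (Z.of_nat K + 1 <= k)%Z) by lia; apply IZR_le in L'.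
    rewrite plus_IZR in L'.
    assert (N + PI <= 2 * IZR k * PI) by (rewrite HN; nra). lra.
Qed.

(** The values of [half_sq] at the two right corners cancel between the horizontal edges and the
    right edge, and the two [profile] integrals cancel up to [profile_windows]. The constants are
    [128 = 2 * 64] and [232 = 2 * 112 + 8]. *)
Theorem sum_LambertW_half_sq (x : C) (K : nat) : x <> 0%C -> (1 <= K)%nat ->
  let N := half_period K in big_enough x N ->
  exists zp zm : C,
    zp <> 0%C /\ zm <> 0%C /\ 0 < Im zp /\ Im zm < 0 /\
    (zp + Clog zp)%C = (Re (Clog x), Im (Clog x) + N) /\
    (zm + Clog zm)%C = (Re (Clog x), Im (Clog x) - N) /\
    Cmod (2 * RtoC PI * Ci * Csum (W_shift K x) (2 * K) - (half_sq zp - half_sq zm))%C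
    <= 128 / N + (232 + 32 * Cmod x + 192 / Cmod x) * (N ^ 3 * exp (- (N / 2))).
Proof.
intros Hx HK N HB; assert (P := PI_bounds); assert (B := Im_Clog_bound x Hx).
destruct (halfway_point x K 1 Hx HK ltac:(auto)) as (zp & P1 & P2 & P3 & P4).
destruct (halfway_point x K (-1) Hx HK ltac:(auto)) as (zm & M1 & M2 & M3 & M4).
fold N in P2, M2.
assert (HB' := HB); destruct HB' as (N1 & N2 & N3 & N4 & N5).
assert (A0 := Rabs_pos (Re (Clog x))).
assert (LN : 0 <= ln N) by (rewrite <- ln_1; apply ln_le; lra).
assert (Bp : Rabs (Im (Clog x) + 1 * N - 1 * N) <= PI) by (apply Rabs_le; lra).
assert (Bm : Rabs (Im (Clog x) + -1 * N - -1 * N) <= PI) by (apply Rabs_le; lra).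
destruct (w_plus_log_size zp _ _ N 1 P1 P2 ltac:(lra) Bp ltac:(lra)) as (Sp & _ & _).
destruct (w_plus_log_size zm _ _ N (-1) M1 M2 ltac:(lra) Bm ltac:(lra)) as (Sm & _ & _).
apply Rabs_le_between in Sp, Sm.
destruct (horizontal_edge x zp _ N 1 HB P1 P2 ltac:(lra) Bp P3) as (ap & bp & Hap & Hbp & Fp & Ep).
destruct (horizontal_edge x zm _ N (-1) HB M1 M2 ltac:(lra) Bm M3) as (am & bm & Ham & Hbm & Fm & Em).
assert (Ip : Im zp + Im (Clog zp) = Im (Clog x) + N).
{ assert (E := f_equal Im P2); change (Im zp + Im (Clog zp) = Im (Clog x) + 1 * N) in E; lra. }
assert (Im' : Im zm + Im (Clog zm) = Im (Clog x) - N).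
{ assert (E := f_equal Im M2); change (Im zm + Im (Clog zm) = Im (Clog x) + -1 * N) in E; lra. }
exists zp, zm; split; [exact P1|split; [exact M1|split; [lra|split; [lra|split; [|split]]]]].
{ rewrite P2; f_equal; ring. }
{ rewrite M2; f_equal; ring. }
destruct (right_edge x N (Im zm) (Im zp) HB ltac:(lra) ltac:(lra)) as [Fr Er].
destruct (left_edge x N (Im zm) (Im zp) Hx HB ltac:(lra) ltac:(lra)) as [Fl El].
destruct (roots_in_rectangle x K zp zm Hx HK HB ltac:(fold N; lra) ltac:(fold N; lra) Ip Im') as [R1 R2].
fold N in R1, R2.
rewrite <- (sum_LambertW_contour x K (- N) N (Im zm) (Im zp) Hx HK ltac:(lra) ltac:(lra) R1 R2).
assert (W := profile_windows N am bm ap bp ltac:(lra) Ham Hbm Hap Hbp).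
unfold rect.
set (It := CInt (fun u => weighted x (u, Im zp)) (- N) N) in *.
set (Ib := CInt (fun u => weighted x (u, Im zm)) (- N) N) in *.
set (Ir := (Ci * CInt (fun v => weighted x (N, v)) (Im zm) (Im zp))%C) in *.
set (Il := (Ci * CInt (fun v => weighted x ((- N)%R, v)) (Im zm) (Im zp))%C) in *.
set (Jp := RInt profile (- ap) bp) in *; set (Jm := RInt profile (- am) bm) in *.
replace (Ib + Ir - It - Il - (half_sq zp - half_sq zm))%C with
  ((Ib - (half_sq (N, Im zm) - half_sq zm) - RtoC Jm)
   + - (It - (half_sq (N, Im zp) - half_sq zp) - RtoC Jp)
   + ((Ir - (half_sq (N, Im zp) - half_sq (N, Im zm))) + - Il + RtoC (Jm - Jp)))%C
  by (rewrite RtoC_minus; ring).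
eapply Rle_trans; [apply Cmod_triangle|].
eapply Rle_trans; [apply Rplus_le_compat; [apply Cmod_triangle|
  eapply Rle_trans; [apply Cmod_triangle|apply Rplus_le_compat_r, Cmod_triangle]]|].
rewrite !Cmod_opp, Cmod_R.
assert (Pe := exp_pos (- (N / 2))).
assert (T : 8 * N ^ 2 * exp (- (N / 2)) <= 8 * (N ^ 3 * exp (- (N / 2)))).
{ rewrite Rmult_assoc; apply Rmult_le_compat_l; [lra|]; apply Rmult_le_compat_r; [lra|].
  assert (0 <= N ^ 2) by (apply pow2_ge_0); simpl in *; nra. }
replace (128 / N) with (64 / N + 64 / N) by (field; lra).
lra.
Qed.

Lemma Clog_near_axis (N sg : R) (e : C) : 0 < N -> sg = 1 \/ sg = -1 -> Cmod e <= 1 / 2 ->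
  Clog (RtoC (sg * N) * Ci * (1 + e))%C = (RtoC (ln N) + RtoC (sg * (PI / 2)) * Ci + Log1 (1 + e))%C.
Proof.
intros HN Hsg He; assert (P := PI_RGT_0).
assert (Hre : 0 < Re (1 + e)%C).
{ assert (K := re_le_Cmod e); apply Rabs_le_between in K.
  change (0 < 1 + Re e); lra. }
symmetry; apply Clog_unique.
- rewrite !Cexp_plus, Cexp_Log1, Cexp_RtoC, exp_ln by assumption; f_equal.
  replace (Cexp (RtoC (sg * (PI / 2)) * Ci)) with (RtoC sg * Ci)%C; [rewrite RtoC_mult; ring|].
  replace (RtoC (sg * (PI / 2)) * Ci)%C with (0, sg * (PI / 2)) by (apply C_ext; cbn; ring).
  unfold Cexp, Re, Im; cbn [fst snd]; rewrite exp_0.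
  destruct Hsg as [-> | ->].
  + replace (1 * (PI / 2)) with (PI / 2) by ring; rewrite cos_PI2, sin_PI2; apply C_ext; cbn; ring.
  + replace (-1 * (PI / 2)) with (- (PI / 2)) by ring; rewrite cos_neg, sin_neg, cos_PI2, sin_PI2.
    apply C_ext; cbn; ring.
- replace (Im (RtoC (ln N) + RtoC (sg * (PI / 2)) * Ci + Log1 (1 + e))%C)
    with (sg * (PI / 2) + atan (Im (1 + e)%C / Re (1 + e)%C))
    by (unfold Log1; cbn; unfold Re, Im; cbn; ring).
  assert (K := atan_bound (Im (1 + e)%C / Re (1 + e)%C)).
  destruct Hsg; subst sg; lra.
Qed.

(** Put [zeta = iN + dl = iN (1 + e)], where [iN] is [sg N i]. The equation reads [dl = q - e - r]
    with [r = log (1 + e) - e], and [iN e = dl]; hence [iN dl = iN q - dl - iN r], and the [dl] here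
    cancels the one in the linear term of [half_sq]. There remain [iN q] and [dl^2 / 2], the latter
    within order [M^2 / N] of [q^2 / 2], as is [iN r] of 0. *)
Lemma half_sq_asymptotic (c zeta : C) (N sg : R) : zeta <> 0%C -> sg = 1 \/ sg = -1 ->
  Rabs (Im c) <= PI -> 20 <= N -> 16 * (Rabs (Re c) + ln N + 11) <= N ->
  (zeta + Clog zeta)%C = (Re c, Im c + sg * N) ->
  let p := (c - RtoC (ln N))%C in
  let q := (p - RtoC (sg * (PI / 2)) * Ci)%C in
  Cmod (half_sq zeta - (RtoC (- N ^ 2 / 2) + RtoC (sg * N) * Ci * p + RtoC (N * PI / 2)
     + RtoC (sg * N) * Ci + q * q * / 2))%C <= 7 * (Rabs (Re c) + ln N + 11) ^ 2 / N.
Proof.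
intros Hz Hsg Hc N1 N2 E p q; assert (P := PI_bounds).
assert (Hs2 : sg * sg = 1) by (destruct Hsg; subst; ring).
assert (A0 := Rabs_pos (Re c)).
assert (LN : 0 <= ln N) by (rewrite <- ln_1; apply ln_le; lra).
assert (Hb : Rabs (Im c + sg * N - sg * N) <= PI)
  by (replace (Im c + sg * N - sg * N) with (Im c) by ring; exact Hc).
destruct (w_plus_log_size zeta _ _ N sg Hz E Hs2 Hb ltac:(lra)) as (S1 & _ & S3).
set (M := Rabs (Re c) + ln N + 11) in *.
set (iN := (RtoC (sg * N) * Ci)%C).
assert (HiN : Cmod iN = N).
{ unfold iN; rewrite Cmod_mult, Cmod_Ci, Cmod_R, Rabs_mult, (Rabs_pos_eq N), Rmult_1_r by lra.
  destruct Hsg; subst sg; [rewrite Rabs_R1|rewrite Rabs_left by lra]; ring. }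
assert (iN0 : iN <> 0%C) by (apply Cmod_gt_0; lra).
set (dl := (zeta - iN)%C).
assert (Hd : Cmod dl <= M).
{ eapply Rle_trans; [apply Cmod_le_Re_Im|].
  replace (Re dl) with (Re zeta) by (unfold dl, iN; cbn; unfold Re, Im; ring).
  replace (Im dl) with (Im zeta - sg * N) by (unfold dl, iN; cbn; unfold Re, Im; ring).
  unfold M; lra. }
set (e := (dl / iN)%C).
assert (He : Cmod e <= M / N).
{ unfold e; rewrite Cmod_div, HiN by exact iN0; apply Rmult_le_compat_r; [left; apply Rinv_0_lt_compat; lra|exact Hd]. }
assert (HM : M / N <= 1 / 16).
{ apply (Rmult_le_reg_r N); [lra|]; unfold Rdiv at 1; rewrite Rmult_assoc, Rinv_l; lra. }
assert (HM0 : 0 < M / N) by (apply Rdiv_lt_0_compat; unfold M; lra).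
destruct (Log1_bounds e ltac:(lra)) as [_ L2].
set (r := (Log1 (1 + e) - e)%C) in *.
assert (He0 := Cmod_ge_0 e).
assert (Hr : Cmod r <= 4 * (M / N) ^ 2).
{ eapply Rle_trans; [exact L2|]; apply Rmult_le_compat_l; [lra|]; apply pow_incr; lra. }
assert (Ez : zeta = (iN + dl)%C) by (unfold dl; ring).
assert (Ez2 : zeta = (iN * (1 + e))%C) by (rewrite Ez; unfold e; field; exact iN0).
assert (El : Clog zeta = (RtoC (ln N) + RtoC (sg * (PI / 2)) * Ci + (e + r))%C).
{ rewrite Ez2; unfold iN; rewrite Clog_near_axis by (auto; lra); f_equal; unfold r; ring. }
assert (Ed : dl = (q - e - r)%C).
{ assert (Ec : (Re c, Im c + sg * N) = (c + iN)%C) by (unfold iN; apply C_ext; cbn; unfold Re, Im; ring).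
  rewrite Ec, El in E; rewrite Ez in E at 1.
  unfold q, p; transitivity (iN + dl + (RtoC (ln N) + RtoC (sg * (PI / 2)) * Ci + (e + r))
    - (iN + (RtoC (ln N) + RtoC (sg * (PI / 2)) * Ci + (e + r))))%C; [ring|].
  rewrite E; ring. }
assert (Ee : (iN * e)%C = dl) by (unfold e; field; exact iN0).
assert (Ei2 : (iN * iN)%C = RtoC (- N ^ 2)).
{ unfold iN; transitivity (RtoC (sg * N) * RtoC (sg * N) * (Ci * Ci))%C; [ring|].
  rewrite <- RtoC_mult; replace (sg * N * (sg * N)) with (N ^ 2) by (replace (sg * N * (sg * N)) with (sg * sg * N ^ 2) by ring; rewrite Hs2; ring).
  apply C_ext; cbn; ring. }
assert (Eq : (iN * q)%C = (iN * p + RtoC (N * PI / 2))%C).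
{ unfold q, iN; transitivity (RtoC (sg * N) * Ci * p - (RtoC (sg * N) * RtoC (sg * (PI / 2))) * (Ci * Ci))%C; [ring|].
  rewrite <- RtoC_mult; replace (sg * N * (sg * (PI / 2))) with (N * PI / 2) by
    (replace (sg * N * (sg * (PI / 2))) with (sg * sg * (N * PI / 2)) by field; rewrite Hs2; ring).
  unfold Cminus; f_equal; apply C_ext; cbn; ring. }
match goal with |- Cmod ?z <= _ => replace z with (- (iN * r) + (- (e + r)) * (dl + q) * / 2)%C end.
- eapply Rle_trans; [apply Cmod_triangle|].
  rewrite Cmod_opp, !Cmod_mult, Cmod_opp, HiN.
  assert (I2 : Cmod (/ 2)%C = / 2)
    by (rewrite Cmod_inv, Cmod_R, Rabs_pos_eq by (try lra; apply RtoC_neq_0; lra); reflexivity).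
  rewrite I2.
  assert (B1 : Cmod (e + r) <= 5 / 4 * (M / N)).
  { eapply Rle_trans; [apply Cmod_triangle|]; nra. }
  assert (B2 : Cmod (dl + q) <= 3 * M).
  { replace (dl + q)%C with (dl + dl + (e + r))%C by (rewrite Ed; ring).
    eapply Rle_trans; [apply Cmod_triangle|]; assert (K := Cmod_triangle dl dl).
    assert (1 <= M) by (unfold M; lra). lra. }
  assert (G1 := Cmod_ge_0 (e + r)%C); assert (G2 := Cmod_ge_0 (dl + q)%C).
  assert (B3 : Cmod (e + r) * Cmod (dl + q) <= 5 / 4 * (M / N) * (3 * M)) by (apply Rmult_le_compat; lra).
  assert (B4 : N * Cmod r <= N * (4 * (M / N) ^ 2)) by (apply Rmult_le_compat_l; lra).
  replace (N * (4 * (M / N) ^ 2)) with (4 * M ^ 2 / N) in B4 by (field; lra).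
  replace (5 / 4 * (M / N) * (3 * M)) with (15 / 4 * (M ^ 2 / N)) in B3 by (field; lra).
  assert (0 <= M ^ 2 / N) by (apply Rmult_le_pos; [apply pow2_ge_0|left; apply Rinv_0_lt_compat; lra]).
  replace (7 * M ^ 2 / N) with (7 * (M ^ 2 / N)) by (field; lra).
  replace (4 * M ^ 2 / N) with (4 * (M ^ 2 / N)) in B4 by (field; lra).
  lra.
- fold iN; unfold half_sq; rewrite Ez.
  replace (RtoC (- N ^ 2 / 2)) with (iN * iN * / 2)%C
    by (rewrite Ei2, <- RtoC_inv, <- RtoC_mult by lra; f_equal; field).
  transitivity ((iN * dl + dl * dl * / 2 + dl) - (iN * p + RtoC (N * PI / 2)) - q * q * / 2)%C.
  + rewrite <- Eq. transitivity (iN * (q - e - r) - iN * q + dl + (dl * dl - q * q) * / 2)%C.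
    * replace (iN * (q - e - r) - iN * q + dl)%C with (- (iN * r) + (dl - iN * e))%C by ring.
      rewrite Ee, Ed; field; apply RtoC_neq_0; lra.
    * rewrite <- Ed; ring.
  + field; apply RtoC_neq_0; lra.
Qed.

(** In the difference of the two expansions [- N^2 / 2] and [N PI / 2] drop out, while the squares
    [(p - i PI/2)^2 / 2] and [(p + i PI/2)^2 / 2] leave [- i PI p]. Division of
    [2 i N p + 2 i N - i PI p] by [2 pi i] turns the coefficient [2 K + 1] of [p] into
    [2 K + 1/2]. *)
Theorem sum_LambertW_asymptotic (x : C) (K : nat) : x <> 0%C -> (1 <= K)%nat ->
  let N := half_period K in big_enough x N ->
  Cmod (Csum (W_shift K x) (2 * K) -
    (RtoC (2 * INR K + 1 / 2) * (Clog x - RtoC (ln N)) + RtoC (2 * INR K + 1)))%C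
  <= 14 * (Rabs (Re (Clog x)) + ln N + 11) ^ 2 / N + 128 / N
     + (232 + 32 * Cmod x + 192 / Cmod x) * (N ^ 3 * exp (- (N / 2))).
Proof.
intros Hx HK N HB; assert (P := PI_bounds); assert (B := Im_Clog_bound x Hx).
destruct (sum_LambertW_half_sq x K Hx HK HB) as (zp & zm & P1 & M1 & _ & _ & P2 & M2 & E).
fold N in P2, M2, E; destruct HB as (N1 & N2 & _).
set (c := Clog x) in *.
assert (Hc : Rabs (Im c) <= PI) by (apply Rabs_le; lra).
assert (P2' : (zp + Clog zp)%C = (Re c, Im c + 1 * N)) by (rewrite P2; f_equal; ring).
assert (M2' : (zm + Clog zm)%C = (Re c, Im c + -1 * N)) by (rewrite M2; f_equal; ring).
assert (Ap := half_sq_asymptotic c zp N 1 P1 ltac:(auto) Hc N1 N2 P2').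
assert (Am := half_sq_asymptotic c zm N (-1) M1 ltac:(auto) Hc N1 N2 M2').
cbv zeta in Ap, Am; set (p := (c - RtoC (ln N))%C) in *.
set (S := Csum (W_shift K x) (2 * K)) in *.
set (Rp := (RtoC (- N ^ 2 / 2) + RtoC (1 * N) * Ci * p + RtoC (N * PI / 2) + RtoC (1 * N) * Ci
  + (p - RtoC (1 * (PI / 2)) * Ci) * (p - RtoC (1 * (PI / 2)) * Ci) * / 2)%C) in *.
set (Rm := (RtoC (- N ^ 2 / 2) + RtoC (-1 * N) * Ci * p + RtoC (N * PI / 2) + RtoC (-1 * N) * Ci
  + (p - RtoC (-1 * (PI / 2)) * Ci) * (p - RtoC (-1 * (PI / 2)) * Ci) * / 2)%C) in *.
assert (H2 := RtoC_neq_0 2 ltac:(lra)).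
assert (ER : (Rp - Rm)%C = (2 * RtoC PI * Ci * (RtoC (2 * INR K + 1 / 2) * p + RtoC (2 * INR K + 1)))%C).
{ unfold Rp, Rm, N, half_period.
  rewrite ?RtoC_mult, ?RtoC_plus, ?RtoC_div, ?RtoC_opp, ?RtoC_mult by lra.
  replace (RtoC (-1)) with (- (1))%C by (apply C_ext; cbn; lra).
  field; exact H2. }
assert (E2 : Cmod (2 * RtoC PI * Ci * (S - (RtoC (2 * INR K + 1 / 2) * p + RtoC (2 * INR K + 1))))%C
  <= 14 * (Rabs (Re c) + ln N + 11) ^ 2 / N + 128 / N
     + (232 + 32 * Cmod x + 192 / Cmod x) * (N ^ 3 * exp (- (N / 2)))).
{ replace (2 * RtoC PI * Ci * (S - (RtoC (2 * INR K + 1 / 2) * p + RtoC (2 * INR K + 1))))%C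
    with ((2 * RtoC PI * Ci * S - (half_sq zp - half_sq zm)) + ((half_sq zp - Rp) + - (half_sq zm - Rm)))%C.
  - eapply Rle_trans; [apply Cmod_triangle|].
    eapply Rle_trans; [apply Rplus_le_compat_l, Cmod_triangle|]; rewrite Cmod_opp.
    replace (14 * (Rabs (Re c) + ln N + 11) ^ 2 / N) with
      (7 * (Rabs (Re c) + ln N + 11) ^ 2 / N + 7 * (Rabs (Re c) + ln N + 11) ^ 2 / N) by (field; lra).
    lra.
  - transitivity (2 * RtoC PI * Ci * S - (Rp - Rm))%C; [ring|]; rewrite ER; ring. }
rewrite !Cmod_mult, Cmod_Ci, !Cmod_R, !Rabs_pos_eq in E2 by lra.
assert (G := Cmod_ge_0 (S - (RtoC (2 * INR K + 1 / 2) * p + RtoC (2 * INR K + 1)))%C).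
nra.
Qed.

(** * Stirling's formula and the limit *)

(** Midpoint and trapezoidal rules for the convex function [1/u] on [[1, 1 + t]]; the proof compares
    derivatives. *)
Lemma ln_1_plus_bounds (t : R) : 0 <= t ->
  2 * t / (2 + t) <= ln (1 + t) <= (t + t / (1 + t)) / 2.
Proof.
intros [Ht|<-]; [|replace (1 + 0) with 1 by ring; rewrite ln_1; split; right; field].
assert (Sq : forall c k, 0 < c -> 0 < k -> 0 < c * c / k * (t - 0)).
{ intros c k Hc Hk; apply Rmult_lt_0_compat; [apply Rdiv_lt_0_compat; nra|lra]. }
split.
- destruct (MVT_is_derive (fun t => ln (1 + t) - 2 * t / (2 + t))
    (fun t => t * t / ((1 + t) * (2 + t) ^ 2)) 0 t Ht) as [c [Hc E]].
  + intros s Hs; auto_derive; [lra|field; lra].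
  + assert (K := Sq c ((1 + c) * (2 + c) ^ 2) ltac:(lra) ltac:(simpl; nra)).
    rewrite Rplus_0_r, ln_1 in E; replace (2 * 0 / (2 + 0)) with 0 in E by field; lra.
- destruct (MVT_is_derive (fun t => (t + t / (1 + t)) / 2 - ln (1 + t))
    (fun t => t * t / (2 * (1 + t) ^ 2)) 0 t Ht) as [c [Hc E]].
  + intros s Hs; auto_derive; [lra|field; lra].
  + assert (K := Sq c (2 * (1 + c) ^ 2) ltac:(lra) ltac:(simpl; nra)).
    rewrite Rplus_0_r, ln_1 in E; replace ((0 + 0 / 1) / 2) with 0 in E by field; lra.
Qed.

Definition stirling_rem (n : nat) : R := ln (INR (fact n)) - (INR n + 1 / 2) * ln (INR n) + INR n.

(** For [t = 1/n] the midpoint bound reads exactly [(n + 1/2) ln (1 + 1/n) >= 1], so the remainder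
    decreases, and the trapezoidal bound leaves an excess that telescopes. *)
Lemma stirling_rem_step (n : nat) : (1 <= n)%nat ->
  stirling_rem n - (/ INR n - / INR (S n)) / 4 <= stirling_rem (S n) <= stirling_rem n.
Proof.
intros Hn; apply le_INR in Hn; simpl INR in Hn.
assert (Hf := INR_fact_lt_0 n); set (y := INR n) in *.
assert (HS : INR (S n) = y + 1) by (rewrite S_INR; reflexivity).
assert (E : stirling_rem (S n) - stirling_rem n = 1 - (y + 1 / 2) * ln (1 + / y)).
{ assert (El : ln (y + 1) = ln y + ln (1 + / y)).
  { assert (K := Rinv_0_lt_compat y ltac:(lra)).
    rewrite <- ln_mult by lra; f_equal; field; lra. }
  unfold stirling_rem; rewrite fact_simpl, mult_INR, HS, ln_mult, El by lra; fold y; ring. }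
destruct (ln_1_plus_bounds (/ y)) as [L U]; [left; apply Rinv_0_lt_compat; lra|].
assert (L' : 1 <= (y + 1 / 2) * ln (1 + / y)).
{ apply Rle_trans with ((y + 1 / 2) * (2 * / y / (2 + / y))); [right; field; lra|].
  apply Rmult_le_compat_l; lra. }
assert (U' : (y + 1 / 2) * ln (1 + / y) <= 1 + (/ y - / (y + 1)) / 4).
{ apply Rle_trans with ((y + 1 / 2) * ((/ y + / y / (1 + / y)) / 2)); [apply Rmult_le_compat_l; lra|].
  right; field; lra. }
rewrite HS; lra.
Qed.

Lemma stirling_rem_cv : exists l : R, is_lim_seq stirling_rem l.
Proof.
(* The sequence is started at index 1, as [stirling_rem 0] involves the conventional value of
   [ln 0]. *)
assert (D : forall n, stirling_rem (S (S n)) <= stirling_rem (S n)) by (intros; apply stirling_rem_step; lia).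
assert (M : forall n, stirling_rem 1 - / INR 1 / 4 <= stirling_rem (S n) - / INR (S n) / 4).
{ induction n as [|n IH]; [lra|].
  destruct (stirling_rem_step (S n) ltac:(lia)) as [H _]; lra. }
destruct (ex_finite_lim_seq_decr (fun n => stirling_rem (S n)) (stirling_rem 1 - / INR 1 / 4) D) as [l Hl].
- intros n; specialize (M n); assert (0 < / INR (S n)) by (apply Rinv_0_lt_compat, lt_0_INR; lia); lra.
- exists l; apply is_lim_seq_incr_1; exact Hl.
Qed.

(** * Wallis integrals and the constant in Stirling's formula *)

Definition wallis (n : nat) : R := RInt (fun t => sin t ^ n) 0 (PI / 2).

Lemma ex_RInt_wallis (n : nat) : ex_RInt (fun t => sin t ^ n) 0 (PI / 2).
Proof.
apply (ex_RInt_continuous (V := R_CompleteNormedModule)); intros t _.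
apply (ex_derive_continuous (K := R_AbsRing) (V := R_NormedModule)); auto_derive; auto.
Qed.

(** Integration by parts, in the form of the primitive [- cos t * sin t ^ S n], which vanishes at
    both ends. *)
Lemma wallis_rec (n : nat) : (INR n + 2) * wallis (S (S n)) = (INR n + 1) * wallis n.
Proof.
assert (P := PI_RGT_0).
assert (K : is_RInt (fun t => (INR n + 2) * sin t ^ S (S n) - (INR n + 1) * sin t ^ n) 0 (PI / 2)
  (minus (- cos (PI / 2) * sin (PI / 2) ^ S n) (- cos 0 * sin 0 ^ S n))).
{ apply (is_RInt_derive (V := R_CompleteNormedModule) (fun t => - cos t * sin t ^ S n)).
  - intros t _; auto_derive; [auto|].
    assert (E := sin2_cos2 t); unfold Rsqr in E.
    change (match n with 0%nat => 1 | S _ => INR n + 1 end) with (INR (S n)).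
    rewrite S_INR; cbn [pow].
    transitivity (sin t * sin t * sin t ^ n - (INR n + 1) * (1 - sin t * sin t) * sin t ^ n);
      [replace (1 - sin t * sin t) with (cos t * cos t) by lra; ring|ring].
  - intros t _; apply (ex_derive_continuous (K := R_AbsRing) (V := R_NormedModule)); auto_derive; auto. }
apply (is_RInt_unique (V := R_CompleteNormedModule)) in K.
rewrite cos_PI2, sin_0, pow_ne_zero, Ropp_0, Rmult_0_l, Rmult_0_r in K by lia.
assert (E : RInt (fun t => (INR n + 2) * sin t ^ S (S n) - (INR n + 1) * sin t ^ n) 0 (PI / 2) =
  (INR n + 2) * wallis (S (S n)) - (INR n + 1) * wallis n).
{ apply (is_RInt_unique (V := R_CompleteNormedModule)).
  apply (is_RInt_minus (V := R_NormedModule) (fun t => (INR n + 2) * sin t ^ S (S n)) (fun t => (INR n + 1) * sin t ^ n)).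
  - apply (is_RInt_scal (V := R_NormedModule) (fun t => sin t ^ S (S n))), (RInt_correct (V := R_CompleteNormedModule)), ex_RInt_wallis.
  - apply (is_RInt_scal (V := R_NormedModule) (fun t => sin t ^ n)), (RInt_correct (V := R_CompleteNormedModule)), ex_RInt_wallis. }
rewrite E in K; unfold minus, plus, opp in K; cbn -[wallis INR] in K; lra.
Qed.

Lemma wallis_decr (n : nat) : 0 <= wallis (S n) <= wallis n.
Proof.
assert (P := PI_RGT_0); split.
- apply RInt_ge_0; [lra|apply ex_RInt_wallis|].
  intros t Ht; apply pow_le, sin_ge_0; lra.
- apply RInt_le; [lra|apply ex_RInt_wallis|apply ex_RInt_wallis|].
  intros t Ht; assert (S1 := SIN_bound t); assert (S0 := sin_ge_0 t ltac:(lra) ltac:(lra)).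
  simpl; assert (Q := pow_le (sin t) n S0); nra.
Qed.

Lemma wallis_0 : wallis 0 = PI / 2.
Proof. unfold wallis; simpl; rewrite RInt_const; unfold scal; cbn; unfold mult; cbn; lra. Qed.

Lemma wallis_1 : wallis 1 = 1.
Proof.
apply (is_RInt_unique (V := R_CompleteNormedModule)).
replace 1 with (minus (- cos (PI / 2)) (- cos 0)) by (rewrite cos_PI2, cos_0; unfold minus, plus, opp; cbn; ring).
apply (is_RInt_derive (V := R_CompleteNormedModule) (fun t => - cos t)).
- intros t _; auto_derive; [auto|ring].
- intros t _; apply (ex_derive_continuous (K := R_AbsRing) (V := R_NormedModule)); auto_derive; auto.
Qed.

(** By [wallis_rec] the product does not depend on [n], so its value is that at 0. *)
Lemma wallis_prod (n : nat) : (INR n + 1) * (wallis n * wallis (S n)) = PI / 2.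
Proof.
induction n as [|n IH]; [rewrite wallis_0, wallis_1; simpl; lra|].
assert (R := wallis_rec n); rewrite S_INR.
transitivity (wallis (S n) * ((INR n + 2) * wallis (S (S n)))); [ring|rewrite R, <- IH; ring].
Qed.

Lemma wallis_even (n : nat) : wallis (2 * n) * (4 ^ n * INR (fact n) ^ 2) = PI / 2 * INR (fact (2 * n)).
Proof.
induction n as [|n IH]; [simpl; rewrite wallis_0; ring|].
replace (2 * S n)%nat with (S (S (2 * n))) by lia.
assert (R := wallis_rec (2 * n)).
rewrite !fact_simpl, !mult_INR, !S_INR.
assert (E : INR (2 * n) = 2 * INR n) by (rewrite mult_INR; reflexivity).
rewrite E in R |- *.
transitivity (((2 * INR n + 2) * wallis (S (S (2 * n)))) * ((2 * INR n + 2) * (4 ^ n * INR (fact n) ^ 2)));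
  [simpl; ring|].
rewrite R.
transitivity ((2 * INR n + 1) * (2 * INR n + 2) * (wallis (2 * n) * (4 ^ n * INR (fact n) ^ 2))); [ring|].
rewrite IH; ring.
Qed.

(** Logarithms of [wallis_even] express the combination of remainders through [ln (wallis (2 * n))].
    The square of this integral is squeezed by replacing one factor with its neighbour of index
    [2 n + 1] or [2 n - 1], where [wallis_prod] applies. *)
Lemma stirling_wallis (n : nat) : (1 <= n)%nat ->
  - ln (2 * PI) / 2 - / INR n <= stirling_rem (2 * n) - 2 * stirling_rem n <= - ln (2 * PI) / 2.
Proof.
intros Hn; assert (P := PI_RGT_0).
assert (Hy : 1 <= INR n) by (apply le_INR in Hn; exact Hn).
assert (F1 := INR_fact_lt_0 n); assert (F2 := INR_fact_lt_0 (2 * n)).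
assert (E2 : INR (2 * n) = 2 * INR n) by (rewrite mult_INR; reflexivity).
assert (P4 : 0 < 4 ^ n) by (apply pow_lt; lra).
assert (W := wallis_even n).
assert (Wp : 0 < wallis (2 * n)).
{ assert (0 < 4 ^ n * INR (fact n) ^ 2) by (apply Rmult_lt_0_compat; [exact P4|apply pow_lt, F1]).
  assert (0 < PI / 2 * INR (fact (2 * n))) by (apply Rmult_lt_0_compat; lra). nra. }
assert (LW : ln (wallis (2 * n)) = ln PI - ln 2 / 2 + stirling_rem (2 * n) - 2 * stirling_rem n - ln (INR n) / 2).
{ apply (f_equal ln) in W.
  rewrite !ln_mult in W by (try apply Rmult_lt_0_compat; try apply pow_lt; lra).
  rewrite !ln_pow in W by lra.
  replace (ln (PI / 2)) with (ln PI - ln 2) in W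
    by (unfold Rdiv; rewrite ln_mult, ln_Rinv by (try apply Rinv_0_lt_compat; lra); ring).
  replace (ln 4) with (2 * ln 2) in W
    by (replace 4 with (2 * 2) by ring; rewrite (ln_mult 2 2) by lra; ring).
  unfold stirling_rem; rewrite E2, (ln_mult 2) by lra.
  change (INR 2) with (1 + 1) in W; lra. }
assert (L2P : ln (2 * PI) = ln 2 + ln PI) by (apply ln_mult; lra).
split.
- assert (A : PI / 2 <= (2 * INR n + 1) * (wallis (2 * n) * wallis (2 * n))).
  { rewrite <- (wallis_prod (2 * n)), E2; apply Rmult_le_compat_l; [lra|].
    apply Rmult_le_compat_l; [lra|apply wallis_decr]. }
  assert (B : ln (PI / 2) <= ln ((2 * INR n + 1) * (wallis (2 * n) * wallis (2 * n)))) by (apply ln_le; lra).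
  rewrite !ln_mult in B by (try apply Rmult_lt_0_compat; lra).
  replace (ln (PI / 2)) with (ln PI - ln 2) in B
    by (unfold Rdiv; rewrite ln_mult, ln_Rinv by (try apply Rinv_0_lt_compat; lra); ring).
  assert (C : ln (2 * INR n + 1) <= ln 2 + ln (INR n) + / (2 * INR n)).
  { replace (2 * INR n + 1) with (2 * INR n * (1 + / (2 * INR n))) by (field; lra).
    assert (0 < / (2 * INR n)) by (apply Rinv_0_lt_compat; lra).
    rewrite !ln_mult by lra.
    assert (K := ln_le_sub1 (1 + / (2 * INR n)) ltac:(lra)); lra. }
  replace (/ (2 * INR n)) with (/ INR n / 2) in C by (field; lra).
  assert (0 < / INR n) by (apply Rinv_0_lt_compat; lra).
  lra.
- destruct n as [|m]; [lia|].
  assert (A : (2 * INR (S m)) * (wallis (2 * S m) * wallis (2 * S m)) <= PI / 2).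
  { rewrite <- (wallis_prod (2 * m + 1)).
    replace (INR (2 * m + 1) + 1) with (2 * INR (S m))
      by (rewrite <- E2, <- S_INR; f_equal; lia).
    replace (S (2 * m + 1)) with (2 * S m)%nat by lia.
    apply Rmult_le_compat_l; [lra|].
    apply Rmult_le_compat_r; [lra|].
    replace (2 * S m)%nat with (S (2 * m + 1)) by lia; apply wallis_decr. }
  assert (B : ln ((2 * INR (S m)) * (wallis (2 * S m) * wallis (2 * S m))) <= ln (PI / 2)).
  { apply ln_le; [repeat apply Rmult_lt_0_compat; lra|exact A]. }
  rewrite !ln_mult in B by (try apply Rmult_lt_0_compat; try apply Rmult_lt_0_compat; lra).
  replace (ln (PI / 2)) with (ln PI - ln 2) in B
    by (unfold Rdiv; rewrite ln_mult, ln_Rinv by (try apply Rinv_0_lt_compat; lra); ring).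
  lra.
Qed.

(** The limit [l] exists by monotonicity, and [stirling_wallis] identifies it through
    [l - 2 l = - ln (2 PI) / 2]. *)
Theorem stirling : is_lim_seq stirling_rem (ln (2 * PI) / 2).
Proof.
destruct stirling_rem_cv as [l Hl].
assert (H2 : is_lim_seq (fun n => stirling_rem (2 * n)) l).
{ apply (is_lim_seq_subseq stirling_rem l (fun n => (2 * n)%nat)); [|exact Hl].
  apply eventually_subseq; intros n; lia. }
assert (Hd : is_lim_seq (fun n => stirling_rem (2 * n) - 2 * stirling_rem n) (l - 2 * l)).
{ apply is_lim_seq_minus'; [exact H2|].
  exact (is_lim_seq_scal_l _ 2 l Hl). }
assert (Hi : is_lim_seq (fun n => - ln (2 * PI) / 2 - / INR n) (- ln (2 * PI) / 2 - 0)).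
{ apply is_lim_seq_minus'; [apply is_lim_seq_const|].
  apply (is_lim_seq_inv INR p_infty is_lim_seq_INR); discriminate. }
assert (A : Rbar_le (- ln (2 * PI) / 2 - 0) (l - 2 * l)).
{ refine (is_lim_seq_le_loc _ _ _ _ _ Hi Hd).
  exists 1%nat; intros n Hn; apply (stirling_wallis n Hn). }
assert (B : Rbar_le (l - 2 * l) (- ln (2 * PI) / 2)).
{ refine (is_lim_seq_le_loc _ _ _ _ _ Hd (is_lim_seq_const _)).
  exists 1%nat; intros n Hn; apply (stirling_wallis n Hn). }
cbn in A, B; replace (ln (2 * PI) / 2) with l by lra; exact Hl.
Qed.

Lemma ln_le_2sqrt (y : R) : 0 < y -> ln y <= 2 * sqrt y.
Proof.
intros H; rewrite <- (sqrt_sqrt y) at 1 by lra.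
assert (S := sqrt_lt_R0 y H); rewrite ln_mult by exact S.
assert (K := ln_le_sub1 (sqrt y) S); lra.
Qed.

Lemma ln_sqr_le (y : R) : 1 <= y -> (ln y) ^ 2 <= 16 * sqrt y.
Proof.
intros H; assert (S1 : 1 <= sqrt y) by (rewrite <- sqrt_1; apply sqrt_le_1; lra).
assert (E : ln y = ln (sqrt y) + ln (sqrt y))
  by (rewrite <- ln_mult, sqrt_sqrt by lra; reflexivity).
assert (K := ln_le_2sqrt (sqrt y) ltac:(lra)).
assert (L0 : 0 <= ln (sqrt y)) by (rewrite <- ln_1; apply ln_le; lra).
assert (Q := sqrt_sqrt (sqrt y) ltac:(lra)); assert (Q0 := sqrt_pos (sqrt y)).
rewrite E; nra.
Qed.

(** Fourth power of [e^(y/8) >= y/8], with [4096 = 8^4]. *)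
Lemma cube_exp_le (y : R) : 0 < y -> y ^ 3 * exp (- (y / 2)) <= 4096 / y.
Proof.
intros H; assert (K := exp_ineq1_le (y / 8)).
assert (E : exp (y / 2) = exp (y / 8) ^ 4).
{ replace (y / 2) with (y / 8 + y / 8 + (y / 8 + y / 8)) by field; rewrite !exp_plus; ring. }
assert (G : (y / 8) ^ 4 <= exp (y / 2)) by (rewrite E; apply pow_incr; lra).
assert (P := exp_pos (y / 2)).
rewrite exp_Ropp; apply (Rmult_le_reg_r (exp (y / 2) * y)); [nra|].
replace (y ^ 3 * / exp (y / 2) * (exp (y / 2) * y)) with (y ^ 4) by (field; lra).
replace (4096 / y * (exp (y / 2) * y)) with (4096 * exp (y / 2)) by (field; lra).
replace (y ^ 4) with (4096 * (y / 8) ^ 4) by field; lra.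
Qed.

Lemma half_period_large (T : R) : eventually (fun K => T <= half_period K).
Proof.
destruct (nfloor_ex (Rmax 0 T) (Rmax_l _ _)) as [n [_ Hn]].
exists (S n); intros K HK; assert (P := PI_bounds).
apply le_INR in HK; rewrite S_INR in HK.
assert (M := Rmax_r 0 T); assert (G := pos_INR n); unfold half_period; nra.
Qed.

Lemma big_enough_eventually (x : C) : x <> 0%C -> eventually (fun K => big_enough x (half_period K)).
Proof.
intros Hx; assert (Px : 0 < Cmod x) by (apply Cmod_gt_0, Hx).
(* [40960 = 10 * 4096] combines [cube_exp_le] with the factor 10 of [big_enough]; it also gives
   [sqrt N >= 64], hence [ln N <= 2 sqrt N <= N / 32]. *)
set (T := Rmax (Rmax 40960 (32 * (Rabs (Re (Clog x)) + 11))) (Rmax (2 * Cmod x) (40960 / Cmod x))).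
generalize (half_period_large T); apply filter_imp; intros K HT.
set (N := half_period K) in *.
assert (T1 : 40960 <= N) by (eapply Rle_trans; [|exact HT]; eapply Rle_trans; [|apply Rmax_l]; apply Rmax_l).
assert (T2 : 32 * (Rabs (Re (Clog x)) + 11) <= N)
  by (eapply Rle_trans; [|exact HT]; eapply Rle_trans; [|apply Rmax_l]; apply Rmax_r).
assert (T3 : 2 * Cmod x <= N) by (eapply Rle_trans; [|exact HT]; eapply Rle_trans; [|apply Rmax_r]; apply Rmax_l).
assert (T4 : 40960 / Cmod x <= N) by (eapply Rle_trans; [|exact HT]; eapply Rle_trans; [|apply Rmax_r]; apply Rmax_r).
assert (Q := cube_exp_le N ltac:(lra)).
assert (L := ln_le_2sqrt N ltac:(lra)); assert (S := sqrt_sqrt N ltac:(lra)); assert (S0 := sqrt_pos N).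
assert (S1 : 64 <= sqrt N) by nra.
split; [lra|split; [nra|split; [exact T3|split]]].
- assert (4096 / N <= 1 / 10); [|lra].
  apply (Rmult_le_reg_r N); [lra|]; replace (4096 / N * N) with 4096 by (field; lra); lra.
- assert (4096 / N <= Cmod x / 10); [|lra].
  apply (Rmult_le_reg_r N); [lra|]; replace (4096 / N * N) with 4096 by (field; lra).
  apply (Rmult_le_compat_l (Cmod x)) in T4; [|lra].
  replace (Cmod x * (40960 / Cmod x)) with 40960 in T4 by (field; lra); lra.
Qed.

Lemma error_small (A B : R) : 0 <= A -> 0 <= B -> forall eps : posreal,
  eventually (fun K => let N := half_period K in
    14 * (A + ln N + 11) ^ 2 / N + 128 / N + B * (N ^ 3 * exp (- (N / 2))) < eps).
Proof.
intros HA HB eps; assert (He := cond_pos eps).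
(* Every error term is at most a multiple of [1 / sqrt N]; [c - 1] adds up these multiples, and the
   extra 1 makes the final inequality strict. *)
set (c := 28 * (A + 11) ^ 2 + 28 * 16 + 128 + B * 4096 + 1).
assert (Hc : 0 < c) by (unfold c; assert (K := pow2_ge_0 (A + 11)); nra).
generalize (half_period_large (Rmax 1 ((c / eps) ^ 2 + 1))); apply filter_imp; intros K HT N.
fold N in HT.
assert (T1 : 1 <= N) by (eapply Rle_trans; [apply Rmax_l|exact HT]).
assert (T2 : (c / eps) ^ 2 + 1 <= N) by (eapply Rle_trans; [apply Rmax_r|exact HT]).
assert (S := sqrt_sqrt N ltac:(lra)); assert (S0 : 0 < sqrt N) by (apply sqrt_lt_R0; lra).
assert (S1 : 1 <= sqrt N) by (rewrite <- sqrt_1; apply sqrt_le_1; lra).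
assert (Hq : c / eps < sqrt N).
{ apply Rnot_le_lt; intros L; assert (0 < c / eps) by (apply Rdiv_lt_0_compat; lra). nra. }
assert (L0 : 0 <= ln N) by (rewrite <- ln_1; apply ln_le; lra).
assert (L2 := ln_sqr_le N T1).
assert (Q := cube_exp_le N ltac:(lra)).
assert (E1 : 14 * (A + ln N + 11) ^ 2 <= (28 * (A + 11) ^ 2 + 28 * 16) * sqrt N).
{ assert (K2 := pow2_ge_0 (A + 11)). assert (K3 := pow2_ge_0 (A + 11 - ln N)). nra. }
apply Rle_lt_trans with ((c - 1) / sqrt N).
- apply (Rmult_le_reg_r N); [lra|].
  replace ((c - 1) / sqrt N * N) with ((c - 1) * sqrt N) by
    (transitivity ((c - 1) / sqrt N * (sqrt N * sqrt N)); [field; lra|rewrite S; reflexivity]).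
  replace ((14 * (A + ln N + 11) ^ 2 / N + 128 / N + B * (N ^ 3 * exp (- (N / 2)))) * N)
    with (14 * (A + ln N + 11) ^ 2 + 128 + B * (N ^ 3 * exp (- (N / 2)) * N)) by (field; lra).
  assert (E2 : N ^ 3 * exp (- (N / 2)) * N <= 4096).
  { apply (Rmult_le_compat_r N) in Q; [|lra]; replace (4096 / N * N) with 4096 in Q by (field; lra); exact Q. }
  unfold c; nra.
- apply (Rmult_lt_reg_r (sqrt N)); [lra|].
  unfold Rdiv at 1; rewrite Rmult_assoc, Rinv_l, Rmult_1_r by lra.
  apply (Rmult_lt_compat_l eps) in Hq; [|lra].
  replace (eps * (c / eps)) with c in Hq by (field; lra); lra.
Qed.

(** The expression equals [stirling_rem (2 K + 1) - ln PI / 2]: the factor [2 K + 1] that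
    distinguishes [(2 K + 1)!] from [(2 K)!] accounts for the exponent [2 K + 1/2] in place of
    [2 K + 3/2]. *)
Lemma real_part_limit : is_lim_seq (fun K =>
  - (2 * INR K + 1 / 2) * ln (half_period K) + (2 * INR K + 1) + ln (PI ^ (2 * K) * INR (fact (2 * K))))
  (ln 2 / 2).
Proof.
assert (P := PI_RGT_0).
assert (H : is_lim_seq (fun K => stirling_rem (S (2 * K)) - ln PI / 2) (ln (2 * PI) / 2 - ln PI / 2)).
{ apply is_lim_seq_minus'; [|apply is_lim_seq_const].
  apply (is_lim_seq_subseq stirling_rem _ (fun K => S (2 * K))); [|exact stirling].
  apply eventually_subseq; intros n; lia. }
rewrite ln_mult in H by lra.
replace ((ln 2 + ln PI) / 2 - ln PI / 2) with (ln 2 / 2) in H by field.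
revert H; apply is_lim_seq_ext; intros K.
assert (F := INR_fact_lt_0 (2 * K)); assert (G := pos_INR K).
unfold stirling_rem, half_period; rewrite fact_simpl, mult_INR.
assert (E : INR (S (2 * K)) = 2 * INR K + 1) by (rewrite S_INR, mult_INR; reflexivity).
assert (E' : INR (2 * K) = 2 * INR K) by (rewrite mult_INR; reflexivity).
rewrite E, !ln_mult, ln_pow, E' by (try apply pow_lt; lra); field.
Qed.

(* The sum over -K <= k <= K is indexed by k = j - K with 0 <= j <= 2K. *)
Theorem theorem3p3 (x : C) (hx : x <> 0%C) :
  filterlim
    (fun K : nat =>
       (sum_n (fun j : nat => LambertW (Z.of_nat j - Z.of_nat K) x) (2 * K)
        + Clog (RtoC (PI ^ (2 * K) * INR (fact (2 * K))))
        - RtoC (2 * INR K + 1 / 2) * Clog x)%C)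
    eventually (locally (Clog (RtoC 2) / RtoC 2)%C).
Proof.
intros Q [eps HQ]; unfold filtermap.
assert (He2 : 0 < eps / 2) by (assert (H := cond_pos eps); lra).
assert (L := real_part_limit); apply is_lim_seq_spec in L; specialize (L (mkposreal _ He2)).
assert (Px : 0 < Cmod x) by (apply Cmod_gt_0, hx).
assert (HB : 0 <= 232 + 32 * Cmod x + 192 / Cmod x).
{ assert (0 < 192 / Cmod x) by (apply Rdiv_lt_0_compat; lra); lra. }
assert (ES := error_small (Rabs (Re (Clog x))) _ (Rabs_pos _) HB (mkposreal _ He2)).
assert (K1 : eventually (fun K => (1 <= K)%nat)) by (exists 1%nat; auto).
generalize (filter_and _ _ (filter_and _ _ K1 (big_enough_eventually x hx)) (filter_and _ _ L ES)).
apply filter_imp; intros K [[HK HBig] [HL HE]]; cbv zeta in HE; cbn [pos] in HL, HE.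
apply HQ.
assert (A := sum_LambertW_asymptotic x K hx HK HBig); cbv zeta in A.
set (N := half_period K) in *.
assert (F : 0 < PI ^ (2 * K) * INR (fact (2 * K))).
{ apply Rmult_lt_0_compat; [apply pow_lt, PI_RGT_0|apply INR_fact_lt_0]. }
change (sum_n (fun j : nat => LambertW (Z.of_nat j - Z.of_nat K) x) (2 * K)) with (Csum (W_shift K x) (2 * K)).
set (S := Csum (W_shift K x) (2 * K)) in *.
rewrite !Clog_pos by (try exact F; lra).
set (Z := (S + RtoC (ln (PI ^ (2 * K) * INR (fact (2 * K)))) - RtoC (2 * INR K + 1 / 2) * Clog x)%C).
assert (D : Cmod (Z - RtoC (ln 2) / RtoC 2)%C < eps).
{ set (sK := - (2 * INR K + 1 / 2) * ln N + (2 * INR K + 1) + ln (PI ^ (2 * K) * INR (fact (2 * K)))) in *.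
  (* The terms in [Clog x] cancel identically, so beyond the error of [sum_LambertW_asymptotic] only
     the real sequence of [real_part_limit] is left. *)
  replace (Z - RtoC (ln 2) / RtoC 2)%C with
    ((S - (RtoC (2 * INR K + 1 / 2) * (Clog x - RtoC (ln N)) + RtoC (2 * INR K + 1)))
     + RtoC (sK - ln 2 / 2))%C.
  - eapply Rle_lt_trans; [apply Cmod_triangle|]; rewrite Cmod_R; lra.
  - unfold Z, sK.
    generalize (2 * INR K + 1 / 2) (2 * INR K + 1) (ln (PI ^ (2 * K) * INR (fact (2 * K)))) (ln N).
    intros y1 y2 y3 y4; rewrite RtoC_minus, !RtoC_plus, RtoC_mult, RtoC_opp, RtoC_div by lra; ring. }
split.
- eapply Rle_lt_trans; [|exact D]; exact (re_le_Cmod (Z - RtoC (ln 2) / RtoC 2)%C).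
- eapply Rle_lt_trans; [|exact D]; exact (Im_le_Cmod (Z - RtoC (ln 2) / RtoC 2)%C).
Qed.
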